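(* Let $F$ be a graph with $e(F)>1$ and $m=|F|$, and let $0<p\le 1$. If $F$ is a regular graph, or a star, or disconnected, then $\mathcal P(F;1/m,\dots,1/m)$ and the weaker $\widetilde{\mathcal P}(F;1/m,\dots,1/m)$ are $p$-quasi-random properties.
   Context: Graphs are finite, simple, undirected; $|G|$ is the number of vertices, $e(G)$ the number of edges. A labelled graph $F$ has $V(F)=\{1,\dots,m\}$. For a labelled graph $F$, a graph $G$ and $U_1,\dots,U_m\subseteq V(G)$, $N(F,G;U_1,\dots,U_m)$ is the number of injective graph homomorphisms $\varphi:V(F)\to V(G)$ with $\varphi(i)\in U_i$ for all $i$; $\widetilde N(F,G;U_1,\dots,U_m):=\frac1{m!}\sum_{\sigma}N(F,G;U_{\sigma(1)},\dots,U_{\sigma(m)})$ over all permutations $\sigma$. $N(F,G)$ is the number of injective homomorphisms $V(F)\to V(G)$. A sequence $(G_n)$ with $|G_n|\to\infty$ is $p$-quasi-random if $N(F,G_n)=(p^{e(F)}+o(1))|G_n|^{|F|}$ for every graph $F$; a property of such sequences is $p$-quasi-random if it is satisfied exactly by the $p$-quasi-random sequences. $\mathcal P(F;1/m,\dots,1/m)$ means: for all pairwise disjoint $U_1,\dots,U_m\subseteq V(G_n)$ with $|U_i|=\lfloor|G_n|/m\rfloor$, $N(F,G_n;U_1,\dots,U_m)=p^{e(F)}\prod_i|U_i|+o(|G_n|^m)$, uniformly in the subsets (this does not depend on the labelling of $F$); $\widetilde{\mathcal P}(F;1/m,\dots,1/m)$ is the same with $\widetilde N$ in place of $N$. *)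

(* Defs.v *)
From HB Require Import structures.
From mathcomp Require Import all_boot all_order all_algebra all_fingroup.
From mathcomp Require Import all_classical all_reals all_analysis.

Set Implicit Arguments.
Unset Strict Implicit.
Unset Printing Implicit Defensive.

Import Order.TTheory GRing.Theory Num.Theory.
Import numFieldNormedType.Exports.

Local Open Scope ring_scope.

Record sgraph := SGraph {
  vertex :> finType;
  adj : rel vertex;
  adj_sym : symmetric adj;
  adj_irrefl : irreflexive adj
}.

Definition nverts (G : sgraph) : nat := #|{: G}|.

Definition edge_set (G : sgraph) : {set {set G}} :=
  [set [set xy.1; xy.2] | xy : G * G & adj xy.1 xy.2]%SET.

Definition nedges (G : sgraph) : nat := #|edge_set G|.

Definition vdegree (G : sgraph) (x : G) : nat := #|[set y | adj x y]%SET|.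

Definition regular_graph (G : sgraph) : Prop :=
  exists d : nat, forall x : G, vdegree x = d.

Definition star_graph (G : sgraph) : Prop :=
  exists c : G, forall x y : G,
    adj x y = (x != y) && ((x == c) || (y == c)).

Definition connected_graph (G : sgraph) : Prop :=
  (0 < nverts G)%N /\ forall x y : G, connect (@adj G) x y.

Definition inj_hom (F G : sgraph) (f : {ffun F -> G}) : bool :=
  injectiveb f && [forall x, forall y, adj x y ==> adj (f x) (f y)].

Definition hom_count (F G : sgraph) : nat :=
  #|[set f : {ffun F -> G} | inj_hom f]%SET|.

(* The vertices of F serve as their own labels: a family U_1, ..., U_m is a
   function on the vertices of F, and the permutations of {1, ..., m} are the
   permutations of the vertices of F. *)
Definition hom_count_in (F G : sgraph) (U : F -> {set G}) : nat :=
  #|[set f : {ffun F -> G} | inj_hom f && [forall i, f i \in U i]]%SET|.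

Definition sym_hom_count_in (R : realType) (F G : sgraph) (U : F -> {set G}) : R :=
  ((nverts F)`!%:R)^-1 *
  \sum_(s : {perm F}) (hom_count_in (fun i => U (s i)))%:R.

Definition balanced_family (F G : sgraph) (U : F -> {set G}) : Prop :=
  (forall i j : F, i != j -> [disjoint U i & U j]) /\
  (forall i : F, #|U i| = (nverts G %/ nverts F)%N).

Local Open Scope classical_set_scope.
Local Open Scope ring_scope.

Definition order_to_infty (G : nat -> sgraph) : Prop :=
  nverts (G n) @[n --> \oo] --> \oo.

Definition quasi_random (R : realType) (p : R) (G : nat -> sgraph) : Prop :=
  forall (F : sgraph) (eps : R), 0 < eps ->
  \forall n \near \oo,
    `|(hom_count F (G n))%:R - p ^+ nedges F * (nverts (G n))%:R ^+ nverts F|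
      <= eps * (nverts (G n))%:R ^+ nverts F.

Definition quasi_random_property (R : realType) (p : R)
    (P : (nat -> sgraph) -> Prop) : Prop :=
  forall G : nat -> sgraph, order_to_infty G -> (P G <-> quasi_random p G).

(* The little-o term is uniform in U: U is quantified after n. *)
Definition count_property (R : realType) (p : R) (F : sgraph)
    (G : nat -> sgraph) : Prop :=
  forall eps : R, 0 < eps ->
  \forall n \near \oo, forall U : F -> {set G n}, balanced_family U ->
    `|(hom_count_in U)%:R - p ^+ nedges F * \prod_(i : F) #|U i|%:R|
      <= eps * (nverts (G n))%:R ^+ nverts F.

Definition sym_count_property (R : realType) (p : R) (F : sgraph)
    (G : nat -> sgraph) : Prop :=
  forall eps : R, 0 < eps ->
  \forall n \near \oo, forall U : F -> {set G n}, balanced_family U ->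
    `|sym_hom_count_in R U - p ^+ nedges F * \prod_(i : F) #|U i|%:R|
      <= eps * (nverts (G n))%:R ^+ nverts F.

(* Main.v *)
(** Quasi-randomness is equivalent to the cut property
    [e(S, T) = p |S| |T| + o(n^2)]: one direction is the C4 argument, the other
    the counting lemma, which also yields both counting properties. What has to
    be shown is that the symmetrized counts over balanced families force the cut
    property.

    Let [f] be the symmetric multilinear form whose value at the indicators of
    [U_1, ..., U_m] is the deviation of the symmetrized count. Pipage rounding
    extends the bound on [f] from balanced families to fractional partitions.
    Second differences of fractional partitions then show that [f] is
    approximately additive: on densities [a_1, ..., a_m] it is close to the sum
    of [f (1, ..., a_l, ..., 1)], that is, of averages of a function [g] of a
    single vertex. Evaluating this on large subsets that are pairwise regular
    (they exist by an energy increment) gives equations between densities.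

    Suppose that [g] takes both signs substantially. Iterated limits along an
    ultrafilter give densities [u], [v] inside and [w] between the two level
    sets, and the equations for tuples with one vertex of the other type force
    [u = v], by interpolating each degree of [F] between the degrees of a
    matching and of a star; this contradicts the two levels of [g]. So [g] is
    small in mean. If now a pair [S, T] had a density away from [p], the same
    limits would give [v = p] and [w <> p], against the equation for tuples
    with a single vertex in [S]. *)

Require Import Defs.
From HB Require Import structures.
From mathcomp Require Import all_boot all_order all_algebra all_fingroup.
From mathcomp Require Import all_classical all_reals all_analysis.
From mathcomp Require Import ring lra zify.

Set Implicit Arguments.
Unset Strict Implicit.
Unset Printing Implicit Defensive.

Import Order.TTheory GRing.Theory Num.Theory.
Import numFieldNormedType.Exports.

Local Open Scope ring_scope.

(** * Two-type identities for the degree sequence *)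

(** Bounds over partitions cannot force [f] itself to be small: if [g] has mean zero, the form
    [sum_l <g, a_l> prod_(j != l) <1, a_j>] vanishes on every fractional partition. Approximate
    additivity is thus the most that partitions give, and [g] has to be removed by other means: the
    density of a regular family is a product over the edges, and products fit an additive right-hand
    side only in special ways.

    The degrees [d_i] of [F] enter through two moments, [sum d_i = 2e] and [sum d_i^2 <= e^2 + e],
    the latter attained by stars. For [v < u], the two equations place [w] strictly below the
    geometric mean of [u] and [v] and also at or above it.

    A fixed number of sets is made regular by passing to subsets, not by refining a partition. The
    subsets keep a proportion independent of the graph, which bounds the densities to which
    additivity is applied. *)

Section PowerSums.
Variable R : realType.
Implicit Types (u v w x y a b : R) (d e n : nat).

(** The terms [i] and [n - i] are paired: the difference of the two sides is half a sum of
    squares. *)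
Lemma sum_squares_ge a b n :
  n.+1%:R * (a ^+ n * b ^+ n) <= \sum_(i < n.+1) (a ^+ 2) ^+ (n - i) * (b ^+ 2) ^+ i.
Proof.
have E : \sum_(i < n.+1) (a ^+ 2) ^+ (n - i) * (b ^+ 2) ^+ i
   - n.+1%:R * (a ^+ n * b ^+ n)
   = 2^-1 * \sum_(i < n.+1) (a ^+ (n - i) * b ^+ i - a ^+ i * b ^+ (n - i)) ^+ 2.
  have E1 : \sum_(i < n.+1) (a ^+ 2) ^+ (n - i) * (b ^+ 2) ^+ i =
            \sum_(i < n.+1) (a ^+ 2) ^+ i * (b ^+ 2) ^+ (n - i).
    rewrite (reindex_inj rev_ord_inj) /=; apply: eq_bigr => i _.
    by rewrite subSS subKn // -ltnS.
  have E2 : n.+1%:R * (a ^+ n * b ^+ n) = \sum_(i < n.+1) (a ^+ n * b ^+ n).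
    by rewrite sumr_const card_ord mulr_natl.
  rewrite mulr_sumr.
  transitivity (2^-1 * (\sum_(i < n.+1) (a ^+ 2) ^+ (n - i) * (b ^+ 2) ^+ i +
     \sum_(i < n.+1) (a ^+ 2) ^+ i * (b ^+ 2) ^+ (n - i) - 2 * \sum_(i < n.+1) (a ^+ n * b ^+ n))).
    rewrite -E1 E2; lra.
  rewrite -big_split /= mulr_sumr -sumrB mulr_sumr; apply: eq_bigr => i _.
  have -> : a ^+ n = a ^+ (n - i) * a ^+ i by rewrite -exprD subnK // -ltnS.
  have -> : b ^+ n = b ^+ (n - i) * b ^+ i by rewrite -exprD subnK // -ltnS.
  rewrite -!exprM ![(2 * _)%N]mulnC !exprM; ring.
rewrite -subr_ge0 E mulr_ge0 ?invr_ge0 //.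
by apply: sumr_ge0 => i _; rewrite sqr_ge0.
Qed.

(** Strictness comes from the two end terms, whose excess is [(a^n - b^n)^2]. The inner terms are
    [a^2 b^2] times the same sum for [n - 2], where the weak inequality suffices. *)
Lemma sum_squares_gt a b n : 0 <= a -> 0 <= b -> a != b -> (0 < n)%N ->
  n.+1%:R * (a ^+ n * b ^+ n) < \sum_(i < n.+1) (a ^+ 2) ^+ (n - i) * (b ^+ 2) ^+ i.
Proof.
move=> a0 b0 ab n0; rewrite lt_neqAle sum_squares_ge andbT.
apply/eqP => E; have := sum_squares_ge a b n; rewrite -E => _.
case: n n0 E => [//|n _] E.
have H1 := sum_squares_ge a b n.-1.
move: E; rewrite big_ord_recl big_ord_recr /= /bump /=.
have -> : \sum_(i < n) (a ^+ 2) ^+ (n.+1 - (1 + i)) * (b ^+ 2) ^+ (1 + i) =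
   a ^+ 2 * b ^+ 2 * \sum_(i < n) (a ^+ 2) ^+ (n.-1 - i) * (b ^+ 2) ^+ i.
  rewrite mulr_sumr; apply: eq_bigr => i _.
  have -> : (n.+1 - (1 + i) = (n.-1 - i).+1)%N by have := ltn_ord i; lia.
  by rewrite add1n !exprS; ring.
rewrite subn0 subnn !expr0 mulr1 mul1r.
have H2 : n%:R * (a ^+ n.+1 * b ^+ n.+1) <=
   a ^+ 2 * b ^+ 2 * \sum_(i < n) (a ^+ 2) ^+ (n.-1 - i) * (b ^+ 2) ^+ i.
  case: n H1 => [|n] H1; first by rewrite mul0r big_ord0 mulr0.
  apply: le_trans (ler_wpM2l _ H1) => /=; last by rewrite mulr_ge0 // sqr_ge0.
  by rewrite [X in X <= _](_ : _ = a ^+ 2 * b ^+ 2 * (n.+1%:R * (a ^+ n * b ^+ n))) // !exprS; ring.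
have ne : a ^+ n.+1 != b ^+ n.+1 by rewrite eqrXn2.
have : 0 < (a ^+ n.+1 - b ^+ n.+1) ^+ 2 by rewrite exprn_even_gt0 //= subr_eq0.
rewrite -(exprAC a) -(exprAC b) -[n.+2]addn2 natrD mulrDl; lra.
Qed.

(** Factoring out [x - y] leaves the sum of the previous lemma, taken at the square roots. The
    increment of the power exceeds its linearization at the geometric mean of [x] and [y]. *)
Lemma subrXX_ge_geom x y n : 0 <= y -> y < x -> (0 < n)%N ->
  n.+1%:R * (x - y) * (Num.sqrt x * Num.sqrt y) ^+ n < x ^+ n.+1 - y ^+ n.+1.
Proof.
move=> y0 yx n0; have x0 : 0 <= x by lra.
rewrite subrXX mulrAC [_ * (x - y)]mulrC ltr_pM2l ?subr_gt0 // exprMn.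
rewrite (lt_le_trans (sum_squares_gt _ _ _ n0)) ?sqrtr_ge0 //.
  by rewrite eqr_sqrt // gt_eqF.
by rewrite !sqr_sqrtr // le_eqVlt; apply/orP; left; apply/eqP/eq_bigr => i _; rewrite subSS.
Qed.

(** The union bound for independent events of probability [1 - y i]. *)
Lemma sub_prod_le_sum (I : finType) (y : I -> R) (r : seq I) :
  (forall i, 0 <= y i <= 1) -> 1 - \prod_(i <- r) y i <= \sum_(i <- r) (1 - y i).
Proof.
move=> hy; elim: r => [|i r IH]; first by rewrite !big_nil subrr.
rewrite !big_cons.
have P1 : 0 <= \prod_(j <- r) y j <= 1.
  elim: (r) => [|j s /andP[s0 s1]]; first by rewrite big_nil ler01 lexx.
  rewrite big_cons; have /andP[j0 j1] := hy j.
  by rewrite mulr_ge0 //= mulr_ile1.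
have := hy i; nra.
Qed.

(** The powers [x^(i+1)] and [x^(k-i)] lie on the same side of 1, so their product minus 1 is at
    least the sum of their two excesses. *)
Lemma powsum_step x k : 0 <= x ->
  2 * \sum_(i < k) (x ^+ i.+1 - 1) <= k%:R * (x ^+ k.+1 - 1).
Proof.
move=> x0.
have -> : 2 * \sum_(i < k) (x ^+ i.+1 - 1) =
   \sum_(i < k) (x ^+ i.+1 - 1 + (x ^+ (k - i) - 1)).
  rewrite [RHS]big_split /=.
  have -> : \sum_(i < k) (x ^+ (k - i) - 1) = \sum_(i < k) (x ^+ i.+1 - 1).
    rewrite (reindex_inj rev_ord_inj) /=; apply: eq_bigr => i _.
    by rewrite subKn.
  by ring.
have -> : k%:R * (x ^+ k.+1 - 1) = \sum_(i < k) (x ^+ k.+1 - 1).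
  by rewrite sumr_const card_ord mulr_natl.
apply: ler_sum => i _.
have -> : x ^+ k.+1 = x ^+ i.+1 * x ^+ (k - i).
  by rewrite -exprD addSn subnKC // ltnW.
have : 0 <= (x ^+ i.+1 - 1) * (x ^+ (k - i) - 1).
  have [x1|x1] := leP x 1.
    by rewrite mulr_le0 // subr_le0 exprn_ile1.
  by rewrite mulr_ge0 // subr_ge0 exprn_ege1 // ltW.
lra.
Qed.

(** For [x != 1], the sum over [i < d], divided by [d (d - 1)], is the slope of the chord from 1 to
    [d] of [d |-> (x^d - 1) / (d (x - 1))]. These slopes increase by [powsum_step]. *)
Lemma powsum_ratio x d e : 0 <= x -> (0 < d)%N -> (d <= e)%N ->
  e%:R * e.-1%:R * \sum_(i < d) (x ^+ i - 1) <= d%:R * d.-1%:R * \sum_(i < e) (x ^+ i - 1).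
Proof.
move=> x0; case: d => [//|d] _; elim: e => [//|e IH].
rewrite leq_eqVlt => /orP[/eqP[->]//|]; rewrite ltnS => de.
have {}IH := IH de; case: e de IH => [//|e] de IH.
rewrite /= [X in _ <= _ * X]big_ord_recr /=.
case: (posnP d) => [d0|d0].
  by rewrite d0 big_ord1 expr0 subrr mulr0 mulr0 mul0r.
have e0 : (0 < e)%N by lia.
have S : 2 * \sum_(i < e.+1) (x ^+ i - 1) <= e%:R * (x ^+ e.+1 - 1).
  rewrite big_ord_recl expr0 subrr add0r.
  by rewrite (eq_bigr (fun i : 'I_e => x ^+ i.+1 - 1)) ?powsum_step.
rewrite /= in IH.
set Zd := \sum_(i < d.+1) _ in IH *; set Ze := \sum_(i < e.+1) _ in IH S *.
set X := x ^+ e.+1 - 1 in S *.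
rewrite -(ler_pM2l (x := e%:R)) ?ltr0n //.
have D0 : 0 <= d.+1%:R * d%:R :> R by rewrite mulr_ge0.
apply: (@le_trans _ _ (e.+2%:R * (d.+1%:R * d%:R * Ze))).
  have -> : e%:R * (e.+2%:R * e.+1%:R * Zd) = e.+2%:R * (e.+1%:R * e%:R * Zd) :> R by ring.
  by rewrite ler_wpM2l.
have -> : e.+2%:R = e%:R + 2 :> R by rewrite -addn2 natrD.
rewrite [X in X <= _](_ : _ = (d.+1%:R * d%:R) * ((e%:R + 2) * Ze)); last by ring.
rewrite [X in _ <= X](_ : _ = (d.+1%:R * d%:R) * (e%:R * (Ze + X))); last by ring.
rewrite ler_wpM2l //; lra.
Qed.

End PowerSums.

(** * Equations between the densities of two vertex types *)

Section TwoTypes.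
Variable R : realType.
Implicit Types (p u v w x z : R) (d e : nat).

Lemma subrX1_sum x d : x ^+ d - 1 = (x - 1) * (d%:R + \sum_(i < d) (x ^+ i - 1)).
Proof.
rewrite subrX1; congr (_ * _); rewrite sumrB sumr_const card_ord.
by rewrite addrCA subrr addr0.
Qed.

(** The two coefficients interpolate [(x^d - 1) / d] linearly between [d = 1], the degree in a
    matching, and [d = e], the degree of the centre of a star. *)
Definition interp_lo (d e : nat) : R := d%:R * (e%:R - d%:R) / (e%:R - 1).
Definition interp_hi (d e : nat) : R := d%:R * (d%:R - 1) / (e%:R * (e%:R - 1)).

Lemma interp_hi_ge0 d e : (1 < e)%N -> 0 <= interp_hi d e.
Proof.
move=> e1; rewrite /interp_hi divr_ge0 //.
  case: d => [|d]; first by rewrite mul0r.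
  by rewrite -natr1 addrK mulr_ge0.
by rewrite mulr_ge0 // subr_ge0 ler1n ltnW.
Qed.

(* [z] is [(x ^+ d - 1) / (x - 1) - d]: divided by [d], the quotient is convex
   in [d], so its value lies below the chord through [d = 1] and [d = e]. *)
Lemma interp1 x d e : 0 <= x -> (1 < e)%N -> (d <= e)%N ->
  exists2 z, 0 <= z &
  interp_lo d e * (x - 1) + interp_hi d e * (x ^+ e - 1) - (x ^+ d - 1) = (x - 1) * z.
Proof.
move=> x0 e1 de.
have eR : e%:R != 0 :> R by rewrite pnatr_eq0; lia.
have e1R : e%:R - 1 != 0 :> R by rewrite subr_eq0 pnatr_eq1; lia.
exists (interp_hi d e * (\sum_(i < e) (x ^+ i - 1)) - \sum_(i < d) (x ^+ i - 1)).
  case: (posnP d) => [->|d0].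
    by rewrite big_ord0 subr0 /interp_hi !mul0r.
  rewrite subr_ge0 -(ler_pM2l (x := e%:R * e.-1%:R)); last first.
    by rewrite mulr_gt0 // ltr0n; lia.
  have P (k : nat) : (0 < k)%N -> k.-1%:R = k%:R - 1 :> R.
    by case: k => // k _; rewrite -natr1 addrK.
  rewrite (le_trans (powsum_ratio x0 d0 de)) // /interp_hi !P; [|lia..].
  by rewrite le_eqVlt; apply/orP; left; apply/eqP; field; rewrite eR e1R.
rewrite !subrX1_sum /interp_lo /interp_hi; field; rewrite ?eR ?e1R //.
Qed.

(** The homogeneous form of [interp1] at [x = w / v], with [v = 0] treated apart. The factor [w - v]
    in the remainder carries its sign, so that one identity gives an upper bound for [w > v] and a
    lower bound for [w < v]. *)
Lemma interpH w v d e : 0 <= w -> 0 <= v -> (1 < e)%N -> (d <= e)%N ->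
  exists2 z, 0 <= z &
  interp_lo d e * (w - v) * v ^+ e.-1 + interp_hi d e * (w ^+ e - v ^+ e)
    - (w ^+ d * v ^+ (e - d) - v ^+ e) = (w - v) * z.
Proof.
move=> w0 v0 e1 de; have [v00|vp] := eqVneq v 0.
  have eR : e%:R != 0 :> R by rewrite pnatr_eq0; lia.
  have e1R : e%:R - 1 != 0 :> R by rewrite subr_eq0 pnatr_eq1; lia.
  rewrite v00 !expr0n subr0.
  have -> : (e == 0)%N = false by lia.
  have -> : (e.-1 == 0)%N = false by lia.
  move: de; rewrite leq_eqVlt => /orP[/eqP->|de].
    exists 0 => //; rewrite subnn eqxx /= /interp_hi; field; by rewrite eR e1R.
  have -> : (e - d == 0)%N = false by lia.
  exists (interp_hi d e * w ^+ e.-1); first by rewrite mulr_ge0 ?interp_hi_ge0 ?exprn_ge0.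
  by rewrite !subr0 !mulr0 add0r subr0 -{2}(prednK (ltnW e1)) exprS; ring.
have {}vp : 0 < v by rewrite lt_neqAle eq_sym vp.
have x0 : 0 <= w / v by rewrite divr_ge0.
have [z z0 Ez] := interp1 x0 e1 de.
exists (z * v ^+ e.-1); first by rewrite mulr_ge0 ?exprn_ge0.
have vN : v != 0 by rewrite gt_eqF.
have We : w ^+ e = (w / v) ^+ e * v ^+ e by rewrite expr_div_n divfK // expf_neq0.
have Wd : w ^+ d * v ^+ (e - d) = (w / v) ^+ d * v ^+ e.
  rewrite expr_div_n -{2}(subnK de) exprD [_ ^+ (e - d) * _]mulrC mulrA divfK //.
  by rewrite expf_neq0.
have Ve : v ^+ e = v * v ^+ e.-1 by rewrite -exprS prednK // ltnW.
have Wv : w - v = v * (w / v - 1) by rewrite mulrBr mulr1 mulrC divfK.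
rewrite We Wd Wv Ve.
transitivity (v * v ^+ e.-1 * (interp_lo d e * (w / v - 1) + interp_hi d e * ((w / v) ^+ e - 1)
     - ((w / v) ^+ d - 1))); first by ring.
by rewrite Ez; ring.
Qed.

Section Degrees.
Variables (I : finType) (d : I -> nat) (e : nat).
Hypothesis e1 : (1 < e)%N.
Hypothesis de : forall i, (d i <= e)%N.
Hypothesis sumd : (\sum_i d i = 2 * e)%N.
Hypothesis sumd2 : (\sum_i d i ^ 2 <= e * e + e)%N.

(** The total star weight of the degree sequence: 0 for a matching, 1 for a star. *)
Let sigma : R := \sum_i interp_hi (d i) e.

Let sumdR : \sum_i (d i)%:R = 2 * e%:R :> R.
Proof. by rewrite -natr_sum sumd natrM. Qed.

Let sumd2R : @Order.le _ R (\sum_i (d i)%:R ^+ 2) (e%:R * e%:R + e%:R).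
Proof.
rewrite -natrM -natrD (eq_bigr (fun i => (d i ^ 2)%:R)).
  by rewrite -natr_sum ler_nat.
by move=> i _; rewrite natrX.
Qed.

Let sigma_le1 : sigma <= 1.
Proof.
have eP : 0 < e%:R * (e%:R - 1) :> R by rewrite mulr_gt0 ?subr_gt0 ?ltr0n ?ltr1n // ltnW.
rewrite /sigma /interp_hi -mulr_suml ler_pdivrMr // mul1r.
rewrite (eq_bigr (fun i => (d i)%:R ^+ 2 - (d i)%:R)); last by move=> i _; ring.
by move: sumd2R; rewrite sumrB sumdR; lra.
Qed.

Let sum_lo : \sum_i interp_lo (d i) e = (2 - sigma) * e%:R.
Proof.
have N1 : e%:R != 0 :> R by rewrite pnatr_eq0; lia.
have N2 : e%:R - 1 != 0 :> R by rewrite subr_eq0 pnatr_eq1; lia.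
have -> : (2 - sigma) * e%:R = \sum_i (d i)%:R - e%:R * sigma by rewrite sumdR; ring.
rewrite /sigma mulr_sumr -sumrB; apply: eq_bigr => i _.
by rewrite /interp_lo /interp_hi; field; rewrite N1 N2.
Qed.

(** Two incompatible bounds on [w]. Interpolating the degrees in both equations and multiplying the
    results gives [w^2 < u v]; the second equation and the union bound give [w^2 >= u v]. *)
Lemma two_type_eq_lt u v w : 0 <= v -> v < u -> 0 <= w ->
  \sum_i w ^+ d i * v ^+ (e - d i) = u ^+ e + (#|I|%:R - 1) * v ^+ e ->
  \sum_i w ^+ d i * u ^+ (e - d i) = v ^+ e + (#|I|%:R - 1) * u ^+ e -> False.
Proof.
move=> v0 vu w0 E1 E2; have u0 : 0 < u by lra.
have e0 : (0 < e)%N by exact: ltnW.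
have e10 : (0 < e.-1)%N by rewrite -ltnS prednK.
have powE (x : R) k : (k <= e)%N -> x ^+ e = x ^+ k * x ^+ (e - k).
  by move=> ke; rewrite -exprD subnKC.
have {}E1 : \sum_i (w ^+ d i * v ^+ (e - d i) - v ^+ e) = u ^+ e - v ^+ e.
  by rewrite sumrB E1 sumr_const -mulr_natl; ring.
have {}E2 : \sum_i (u ^+ e - w ^+ d i * u ^+ (e - d i)) = u ^+ e - v ^+ e.
  by rewrite sumrB E2 sumr_const -mulr_natl; ring.
have uve : v ^+ e < u ^+ e by rewrite ltrXn2r // -lt0n.
have vw : v < w.
  rewrite ltNge; apply/negP => wv.
  have : \sum_i (w ^+ d i * v ^+ (e - d i) - v ^+ e) <= 0.
    apply: sumr_le0 => i _; rewrite subr_le0 (powE v _ (de i)).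
    by rewrite ler_wpM2r ?exprn_ge0 // lerXn2r.
  by rewrite E1; lra.
have wu : w < u.
  rewrite ltNge; apply/negP => uw.
  have : \sum_i (u ^+ e - w ^+ d i * u ^+ (e - d i)) <= 0.
    apply: sumr_le0 => i _; rewrite subr_le0 (powE u _ (de i)).
    by rewrite ler_wpM2r ?exprn_ge0 ?lerXn2r // ?nnegrE ltW.
  by rewrite E2; lra.
have wp : 0 < w by lra.
(* [P'] and [S'] are the increments of the [e]-th power over [[v, w]] and [[w, u]]; [P] and [S] are
   their linearizations at the outer ends [v] and [u]. *)
pose P := e%:R * (w - v) * v ^+ e.-1; pose P' := w ^+ e - v ^+ e.
pose S := e%:R * (u - w) * u ^+ e.-1; pose S' := u ^+ e - w ^+ e.
have I1 : (1 - sigma) * P' + S' <= (2 - sigma) * P.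
  have : u ^+ e - v ^+ e <= (2 - sigma) * e%:R * (w - v) * v ^+ e.-1 + sigma * P'.
    rewrite -E1 -sum_lo /sigma !mulr_suml -big_split /=; apply: ler_sum => i _.
    have [z z0] := interpH w0 v0 e1 (de i).
    have W : 0 <= (w - v) * z by rewrite mulr_ge0 // subr_ge0 ltW.
    by rewrite /P' => Ez; rewrite -Ez in W; lra.
  by rewrite /P /P' /S'; nra.
have I2 : (1 - sigma) * S' + P' <= (2 - sigma) * S.
  have : u ^+ e - v ^+ e <= (2 - sigma) * e%:R * (u - w) * u ^+ e.-1 + sigma * S'.
    rewrite -E2 -sum_lo /sigma !mulr_suml -big_split /=; apply: ler_sum => i _.
    have [z z0] := interpH w0 (ltW u0) e1 (de i).
    have W : 0 <= (u - w) * z by rewrite mulr_ge0 // subr_ge0 ltW.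
    by rewrite /S' => Ez; rewrite -[u - w]opprB mulNr -Ez in W; lra.
  by rewrite /S /P' /S'; nra.
have P'p : 0 < P' by rewrite subr_gt0 ltrXn2r // -lt0n.
have S'p : 0 < S' by rewrite subr_gt0 ltrXn2r // -?lt0n // ltW.
(* The product of the left sides of [I1] and [I2] equals [(2 - sigma)^2 P' S' + (1 - sigma) (P' -
   S')^2]. *)
have PS : P' * S' <= P * S.
  have s1 : 0 <= 1 - sigma by rewrite subr_ge0.
  have s2 : 0 < 2 - sigma by lra.
  have L1 : 0 <= (1 - sigma) * P' + S' by rewrite addr_ge0 // ?mulr_ge0 // ltW.
  have L2 : 0 <= (1 - sigma) * S' + P' by rewrite addr_ge0 // ?mulr_ge0 // ltW.
  have := ler_pM L1 L2 I1 I2.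
  have -> : (2 - sigma) * P * ((2 - sigma) * S) = (2 - sigma) ^+ 2 * (P * S) by ring.
  move=> H; rewrite -(ler_pM2l (x := (2 - sigma) ^+ 2)) ?exprn_gt0 //.
  apply: le_trans H.
  have : 0 <= (1 - sigma) * (P' - S') ^+ 2 by rewrite mulr_ge0 // sqr_ge0.
  by nra.
pose a := Num.sqrt u; pose b := Num.sqrt v; pose c := Num.sqrt w.
have [a2 b2 c2] : [/\ a ^+ 2 = u, b ^+ 2 = v & c ^+ 2 = w].
  by split; rewrite sqr_sqrtr // ltW.
have a0 : 0 < a by rewrite sqrtr_gt0.
have c0 : 0 < c by rewrite sqrtr_gt0.
have b0 : 0 <= b by rewrite sqrtr_ge0.
have A1 : e%:R * (w - v) * (c * b) ^+ e.-1 < P'.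
  by have := subrXX_ge_geom v0 vw e10; rewrite prednK.
have A2 : e%:R * (u - w) * (a * c) ^+ e.-1 < S'.
  by have := subrXX_ge_geom w0 wu e10; rewrite prednK.
have [vz|vz] := eqVneq v 0.
  move: PS; rewrite /P vz expr0n gtn_eqF //.
  by rewrite mulr0 mul0r; have := mulr_gt0 P'p S'p; lra.
have bp : 0 < b by rewrite sqrtr_gt0 lt_neqAle eq_sym vz.
(* By [A1] and [A2] the increments exceed their linearizations at the geometric means [c b] and
   [a c]. In [PS] everything then cancels except powers of [c^2 = w] and of [a b]. *)
have w_lt : w < a * b.
  have : (e%:R * (w - v) * (c * b) ^+ e.-1) * (e%:R * (u - w) * (a * c) ^+ e.-1) < P * S.
    apply: lt_le_trans PS; rewrite ltr_pM // ?mulr_ge0 ?exprn_ge0 ?mulr_ge0 ?subr_ge0 // ltW //.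
  rewrite /P /S -b2 -a2 -c2.
  set k := (X in X < _); set l := (X in _ < X).
  have -> : k = (e%:R ^+ 2 * (w - v) * (u - w) * (a * b) ^+ e.-1) * (c ^+ 2) ^+ e.-1.
    by rewrite /k a2 b2 c2 -c2 !exprMn; ring.
  have -> : l = (e%:R ^+ 2 * (w - v) * (u - w) * (a * b) ^+ e.-1) * (a * b) ^+ e.-1.
    by rewrite /l -!exprM ![(2 * _)%N]mulnC !exprM a2 b2 c2 !exprMn; ring.
  rewrite ltr_pM2l; last first.
    by rewrite !mulr_gt0 ?exprn_gt0 ?mulr_gt0 ?subr_gt0 ?ltr0n.
  by rewrite ltr_pXn2r ?nnegrE ?sqr_ge0 ?mulr_ge0 ?(ltW a0) // c2.
(* The union bound for [(w / u)^(d i)], whose product is [(w / u)^(2e)], turns [E2] divided by [u^e]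
   into [(v / u)^e <= (w / u)^(2e)]. *)
have w_ge : a * b <= w.
  have y01 i : 0 <= (w / u) ^+ d i <= 1.
    by rewrite exprn_ge0 ?divr_ge0 ?(ltW u0) //= exprn_ile1 ?divr_ge0 ?(ltW u0) // ler_pdivrMr // mul1r ltW.
  have := sub_prod_le_sum (index_enum I) y01.
  rewrite prodrXr sumd => H.
  have {}H : u ^+ e * v ^+ e <= w ^+ (2 * e).
    have : u ^+ e * (1 - (w / u) ^+ (2 * e)) <= u ^+ e - v ^+ e.
      rewrite -E2 (le_trans (ler_wpM2l (exprn_ge0 e (ltW u0)) H)) // mulr_sumr.
      apply: ler_sum => i _; rewrite mulrBr mulr1 {2}(powE u _ (de i)) expr_div_n.
      rewrite le_eqVlt; apply/orP; left; apply/eqP; congr (_ - _).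
      have : u ^+ d i != 0 by rewrite expf_neq0 // gt_eqF.
      by move=> N; field.
    rewrite mulrBr mulr1 => H2.
    have {}H2 : v ^+ e <= u ^+ e * (w / u) ^+ (2 * e) by lra.
    have := ler_wpM2l (exprn_ge0 e (ltW u0)) H2.
    rewrite mulrA -exprD addnn -mul2n expr_div_n mulrC.
    have N : u ^+ (2 * e) != 0 by rewrite expf_neq0 // gt_eqF.
    by rewrite [u ^+ (2 * e) * _]mulrC divfK // mulrC.
  rewrite -(ler_pXn2r (n := (2 * e)%N)) ?nnegrE ?(ltW a0, mulr_ge0) ?muln_gt0 //.
  have -> // : (a * b) ^+ (2 * e) = u ^+ e * v ^+ e.
  by rewrite -a2 -b2 -!exprM exprMn.
by have := lt_le_trans w_lt w_ge; rewrite ltxx.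
Qed.

Lemma two_type_eq u v w : 0 <= u -> 0 <= v -> 0 <= w ->
  \sum_i w ^+ d i * v ^+ (e - d i) = u ^+ e + (#|I|%:R - 1) * v ^+ e ->
  \sum_i w ^+ d i * u ^+ (e - d i) = v ^+ e + (#|I|%:R - 1) * u ^+ e -> u = v.
Proof.
move=> u0 v0 w0 E1 E2; case: (ltgtP u v) => // uv.
  by case: (two_type_eq_lt u0 uv w0 E2 E1).
by case: (two_type_eq_lt v0 uv w0 E1 E2).
Qed.

(** The left side is strictly increasing in [w], because some degree is positive. *)
Lemma one_type_eq p w : 0 < p -> 0 <= w ->
  \sum_i w ^+ d i * p ^+ (e - d i) = #|I|%:R * p ^+ e -> w = p.
Proof.
move=> p0 w0 E.
have [i0 di0] : exists i, (0 < d i)%N.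
  case: (pickP (fun i => 0 < d i)%N) => [i ?|H]; first by exists i.
  move: sumd; rewrite big1 => [|i _]; first lia.
  by have := H i; lia.
have {}E : \sum_i (w ^+ d i * p ^+ (e - d i) - p ^+ e) = 0.
  by rewrite sumrB E sumr_const mulr_natl subrr.
have powE (x : R) k : (k <= e)%N -> x ^+ e = x ^+ k * x ^+ (e - k).
  by move=> ke; rewrite -exprD subnKC.
case: (ltgtP w p) => // wp; move: E; rewrite (bigD1 i0) //=.
- have : w ^+ d i0 * p ^+ (e - d i0) - p ^+ e < 0.
    by rewrite subr_lt0 (powE p _ (de i0)) ltr_pM2r ?exprn_gt0 // ltrXn2r // -lt0n.
  have : \sum_(i | i != i0) (w ^+ d i * p ^+ (e - d i) - p ^+ e) <= 0.
    apply: sumr_le0 => i _; rewrite subr_le0 (powE p _ (de i)).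
    by rewrite ler_wpM2r ?exprn_ge0 ?lerXn2r // ?nnegrE ltW.
  by lra.
- have : 0 < w ^+ d i0 * p ^+ (e - d i0) - p ^+ e.
    by rewrite subr_gt0 (powE p _ (de i0)) ltr_pM2r ?exprn_gt0 // ltrXn2r ?ltW // -lt0n.
  have : 0 <= \sum_(i | i != i0) (w ^+ d i * p ^+ (e - d i) - p ^+ e).
    apply: sumr_ge0 => i _; rewrite subr_ge0 (powE p _ (de i)).
    by rewrite ler_wpM2r ?exprn_ge0 ?lerXn2r // ?nnegrE ltW.
  by lra.
Qed.

End Degrees.

End TwoTypes.

(** * Graphs as edge lists *)

Section EdgeLists.
Variable I : finType.
Implicit Types (E : seq (I * I)) (x : I).

(** Each edge occurs once, in one orientation. The recursive form fits arguments that peel off one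
    edge at a time. *)
Fixpoint simple_edges E : bool :=
  if E is e :: E' then
    [&& e.1 != e.2, e \notin E', (e.2, e.1) \notin E' & simple_edges E']
  else true.

Definition touches x (e : I * I) : bool := (e.1 == x) || (e.2 == x).

Definition edeg E x : nat := count (touches x) E.

Lemma touchesE x (e : I * I) : e.1 != e.2 ->
  touches x e = ((e.1 == x) + (e.2 == x))%N :> nat.
Proof.
rewrite /touches => ne; case: eqVneq => [<-|_] //=.
by rewrite eq_sym (negPf ne).
Qed.

Lemma sum_touches (e : I * I) (h : I -> nat) : e.1 != e.2 ->
  (\sum_x touches x e * h x = h e.1 + h e.2)%N.
Proof.
move=> ne; rewrite (eq_bigr (fun x => (e.1 == x) * h x + (e.2 == x) * h x)%N).
  rewrite big_split /= (bigD1 e.1) //= eqxx mul1n big1 => [|x /negPf].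
    rewrite addn0 (bigD1 e.2) //= eqxx mul1n big1 ?addn0 // => x /negPf.
    by rewrite eq_sym => ->.
  by rewrite eq_sym => ->.
by move=> x _; rewrite touchesE // mulnDl.
Qed.

Lemma sum_edeg E : simple_edges E -> (\sum_x edeg E x = 2 * size E)%N.
Proof.
elim: E => [|e E IH] /=; first by rewrite big1.
case/and4P => ne _ _ /IH E'; rewrite /edeg /= big_split /= -[X in (_ + X)%N]/(\sum_x edeg E x)%N E'.
have := sum_touches (fun _ => 1%N) ne.
rewrite (eq_bigr (fun x => nat_of_bool (touches x e))) => [|x _]; last by rewrite muln1.
by move=> ->; lia.
Qed.

(** Since [a b] is not among the edges, every edge touches at most one of the two vertices. *)
Lemma edeg_pair_le E a b : a != b -> (a, b) \notin E -> (b, a) \notin E ->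
  simple_edges E -> (edeg E a + edeg E b <= size E)%N.
Proof.
move=> ab; elim: E => [|e E IH] //=; rewrite !inE !negb_or.
move=> /andP[n1 m1] /andP[n2 m2] /and4P[ne _ _ s].
have {}IH := IH m1 m2 s; rewrite /edeg /= -/(edeg E a) -/(edeg E b).
suff : ~~ (touches a e && touches b e).
  by case: (touches a e); case: (touches b e) => //=; lia.
case: e n1 n2 ne => i j /= n1 n2 ne; rewrite /touches /=.
apply/negP => /andP[/orP[/eqP E1|/eqP E1] /orP[/eqP E2|/eqP E2]]; subst.
- by rewrite eqxx in ab.
- by rewrite eqxx in n1.
- by rewrite eqxx in n2.
- by rewrite eqxx in ab.
Qed.

(** A new edge [a b] adds [2 (deg a + deg b) + 2] to the sum of squares, at most [2 |E| + 2] by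
    [edeg_pair_le]; this is the increment of [|E|^2 + |E|]. *)
Lemma sum_edeg2 E : simple_edges E ->
  (\sum_x edeg E x ^ 2 <= size E * size E + size E)%N.
Proof.
elim: E => [|e E IH] /=; first by rewrite big1.
case/and4P => ne n1 n2 s; have {}IH := IH s.
rewrite (eq_bigr (fun x => touches x e * 1 + (touches x e * (2 * edeg E x) + edeg E x ^ 2))%N).
  rewrite !big_split /= !sum_touches //.
  have := edeg_pair_le ne _ n2 s; rewrite -surjective_pairing => /(_ n1).
  by move: IH; set S := (\sum_i _)%N; lia.
move=> x _; rewrite /edeg /=; case: (touches x e); rewrite /= ?mul0n ?mul1n //.
by rewrite -!mulnn; lia.
Qed.

Lemma edeg_le E x : (edeg E x <= size E)%N.
Proof. exact: count_size. Qed.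

End EdgeLists.

Lemma prod_bool_all (R : realType) (T : Type) (b : T -> bool) (s : seq T) :
  \prod_(e <- s) (b e)%:R = (all b s)%:R :> R.
Proof.
elim: s => [|e s IH]; first by rewrite big_nil.
by rewrite big_cons IH /= -natrM mulnb.
Qed.

Section GraphEdges.
Variable F : sgraph.

Definition elist : seq (F * F) :=
  [seq e <- enum {: F * F} | adj e.1 e.2 && (enum_rank e.1 < enum_rank e.2)%N].

Lemma mem_elist e : (e \in elist) = adj e.1 e.2 && (enum_rank e.1 < enum_rank e.2)%N.
Proof. by rewrite mem_filter mem_enum andbT. Qed.

Lemma simple_elist : simple_edges elist.
Proof.
have : uniq elist by rewrite filter_uniq // enum_uniq.
have : {in elist, forall e, (enum_rank e.1 < enum_rank e.2)%N}.
  by move=> e; rewrite mem_elist => /andP[].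
elim: elist => [//|e E IH] H /= /andP[eE uE].
rewrite eE IH //= => [|f fE]; last by apply: H; rewrite inE fE orbT.
have lt := H e (mem_head _ _).
have -> /= : e.1 != e.2 by apply: contraTneq lt => ->; rewrite ltnn.
rewrite andbT; apply/negP => fE.
have /= := H (e.2, e.1); rewrite inE fE orbT => /(_ isT).
by rewrite ltnNge ltnW.
Qed.

Lemma adj_neq (x y : F) : adj x y -> x != y.
Proof. by apply: contraTneq => ->; rewrite adj_irrefl. Qed.

Lemma size_elist : size elist = nedges F.
Proof.
pose h (e : F * F) := [set e.1; e.2]%SET.
pose D := [set e : F * F | e \in elist]%SET.
have -> : size elist = #|D|.
  by rewrite cardsE; apply/esym/card_uniqP; rewrite filter_uniq // enum_uniq.
have hI : {in D &, injective h}.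
  move=> [a b] [c d]; rewrite !inE !mem_elist /= => /andP[_ ab] /andP[_ cd] /setP E.
  have Ea := E a; have Eb := E b; have Ec := E c; have Ed := E d.
  move: Ea Eb Ec Ed; rewrite !inE /= !eqxx ?orbT /=.
  move=> /esym/orP[/eqP ac|/eqP ad].
    by subst c => _ _ /orP[/eqP dd|/eqP ->] //; subst d; rewrite ltnn in cd.
  subst d => /esym/orP[/eqP bc _ _|/eqP bd]; last by subst b; rewrite ltnn in ab.
  by subst c; have := ltn_trans ab cd; rewrite ltnn.
rewrite -(card_in_imset hI) /nedges /edge_set; apply: eq_card => s.
apply/imsetP/imsetP => [[e]|[e]].
  by rewrite inE mem_elist => /andP[ae _] ->; exists e; rewrite ?inE.
rewrite inE => ae ->; have ne := adj_neq ae.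
have : enum_rank e.1 != enum_rank e.2 by rewrite (inj_eq enum_rank_inj).
rewrite -val_eqE /= neq_ltn => /orP[lt|lt].
  by exists e => //; rewrite inE mem_elist ae.
exists (e.2, e.1); first by rewrite inE mem_elist /= lt adj_sym ae.
by rewrite /h /= finset.setUC.
Qed.

Lemma all_elist (P : F -> F -> bool) : symmetric P ->
  all (fun e => P e.1 e.2) elist = [forall x, forall y, adj x y ==> P x y].
Proof.
move=> Ps; apply/allP/forallP => [H x|H e].
  apply/forallP => y; apply/implyP => xy.
  have : enum_rank x != enum_rank y by rewrite (inj_eq enum_rank_inj) adj_neq.
  rewrite -val_eqE /= neq_ltn => /orP[lt|lt].
    by apply: (H (x, y)); rewrite mem_elist /= xy.
  by rewrite Ps; apply: (H (y, x)); rewrite mem_elist /= adj_sym xy.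
by rewrite mem_elist => /andP[ae _]; have /forallP/(_ e.2)/implyP := H e.1; apply.
Qed.

End GraphEdges.

(** * Counting in boxes of regular pairs *)

Section Counting.
Variables (R : realType) (F V : finType).
Implicit Types (X : F -> {set V}) (f : {ffun F -> V}) (E : seq (F * F)) (i : F).

Definition inbox X f : bool := [forall i, f i \in X i].

Definition upd f i (x : V) : {ffun F -> V} := [ffun j => if j == i then x else f j].

Lemma inbox_upd X f i x : inbox X f -> x \in X i -> inbox X (upd f i x).
Proof.
move=> /forallP fX xX; apply/forallP => j; rewrite ffunE.
by case: eqVneq => [->|].
Qed.

(* [(f, x) |-> (upd f i x, f i)] is an involution of [box * X i]. *)
Lemma sum_resample X i (Phi : {ffun F -> V} -> R) :
  \sum_(f | inbox X f) \sum_(x in X i) Phi (upd f i x) =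
  #|X i|%:R * \sum_(f | inbox X f) Phi f.
Proof.
rewrite pair_big_dep /=.
pose swp (q : {ffun F -> V} * V) := (upd q.1 i q.2, q.1 i).
have swpK : involutive swp.
  case=> f x; rewrite /swp /=; congr pair; last by rewrite ffunE eqxx.
  by apply/ffunP => j; rewrite !ffunE; case: eqVneq => [->|].
rewrite (reindex_inj (inv_inj swpK)) /=.
rewrite (eq_bigl (fun q => inbox X q.1 && (q.2 \in X i))); last first.
  case=> f x /=; apply/andP/andP => -[fX xX].
    have xi : x \in X i by have /forallP/(_ i) := fX; rewrite ffunE eqxx.
    by split=> //; have := inbox_upd fX xX; rewrite -[upd _ _ _]/(swp (swp (f, x))).1 swpK.
  by split; [exact: inbox_upd | have /forallP := fX].
rewrite (eq_bigr (fun q => Phi q.1)); last first.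
  by case=> f x _ /=; rewrite -[upd _ _ _]/(swp (swp (f, x))).1 swpK.
rewrite -(pair_big (inbox X) (fun x => x \in X i) (fun f _ => Phi f)) /=.
by rewrite mulr_sumr; apply: eq_bigr => f _; rewrite sumr_const mulr_natl.
Qed.

Lemma sum_box1 X : \sum_(f | inbox X f) 1 = \prod_i #|X i|%:R :> R.
Proof.
rewrite (eq_bigr (fun i => \sum_(x in X i) 1)); last by move=> i _; rewrite sumr_const.
rewrite bigA_distr_big_dep /=; apply: eq_big => [f|f _]; first by rewrite unfold_in.
by rewrite big1.
Qed.

Section Kernel.
Variable A : rel V.

Definition ecount (S T : {set V}) : R := \sum_(x in S) \sum_(y in T) (A x y)%:R.

(** Regularity in the sense of the cut norm: the error is relative to the whole pair, so subsets of
    every size are allowed. *)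
Definition regpair (delta d : R) (S T : {set V}) : Prop :=
  forall S' T' : {set V}, S' \subset S -> T' \subset T ->
  `|ecount S' T' - d * #|S'|%:R * #|T'|%:R| <= delta * (#|S|%:R * #|T|%:R).

Definition homsum E X : R :=
  \sum_(f | inbox X f) \prod_(e <- E) (A (f e.1) (f e.2))%:R.

Lemma ecountB (d : R) (S T : {set V}) :
  \sum_(x in S) \sum_(y in T) ((A x y)%:R - d) = ecount S T - d * #|S|%:R * #|T|%:R.
Proof.
rewrite (eq_bigr (fun x => \sum_(y in T) (A x y)%:R - d * #|T|%:R)); last first.
  by move=> x _; rewrite sumrB sumr_const mulr_natr.
by rewrite sumrB /ecount sumr_const -[_ *+ #|S|]mulr_natr mulrAC.
Qed.

(** All coordinates but [i] and [j] are frozen and these two are resampled. No other edge joins [i]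
    and [j], so the other edges at [i] confine [x] to a set [S], those at [j] confine [y] to a set
    [T], and the rest form a constant [c]. Regularity bounds the sum of [A - d] over [S] and [T]. *)
Lemma homsum_cons (delta d : R) e E X : simple_edges (e :: E) ->
  regpair delta d (X e.1) (X e.2) ->
  `|homsum (e :: E) X - d * homsum E X| <= delta * \prod_i #|X i|%:R.
Proof.
case: e => i j /= /and4P[ij nE1 nE2 sE] reg.
pose Phi f : R := ((A (f i) (f j))%:R - d) * (all (fun e => A (f e.1) (f e.2)) E)%:R.
have -> : homsum ((i, j) :: E) X - d * homsum E X = \sum_(f | inbox X f) Phi f.
  rewrite /homsum mulr_sumr -sumrB; apply: eq_bigr => f _.
  by rewrite big_cons /= -mulrBl prod_bool_all.
have c0 : 0 <= #|X i|%:R * #|X j|%:R :> R by [].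
have [/eqP|cN] := eqVneq (#|X i|%:R * #|X j|%:R : R) 0.
  rewrite mulf_eq0 !pnatr_eq0 !cards_eq0 => X0.
  have [k /eqP Xk] : exists k, X k == finset.set0.
    by case/orP: X0 => ?; [exists i | exists j].
  rewrite big1 ?normr0 => [|f /forallP/(_ k)]; last by rewrite Xk inE.
  by rewrite (bigD1 k) //= Xk cards0 mul0r mulr0.
have cp : 0 < #|X i|%:R * #|X j|%:R :> R by rewrite lt_neqAle eq_sym cN.
rewrite -(ler_pM2l cp) -{1}(ger0_norm c0) -normrM -mulrA -!sum_resample.
apply: le_trans (ler_norm_sum _ _ _) _.
have -> : #|X i|%:R * #|X j|%:R * (delta * \prod_k #|X k|%:R) =
  \sum_(f | inbox X f) delta * (#|X i|%:R * #|X j|%:R).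
  transitivity ((\sum_(f | inbox X f) 1) * (delta * (#|X i|%:R * #|X j|%:R))).
    by rewrite sum_box1; ring.
  by rewrite mulr_suml; apply: eq_bigr => f _; rewrite mul1r.
apply: ler_sum => f fX.
pose S := [set x in X i | all (fun e => touches i e ==> A (upd f i x e.1) (upd f i x e.2)) E]%SET.
pose T := [set y in X j | all (fun e => touches j e ==> A (upd f j y e.1) (upd f j y e.2)) E]%SET.
pose c := all (fun e => ~~ touches i e && ~~ touches j e ==> A (f e.1) (f e.2)) E.
have key x y : x \in X i -> y \in X j ->
   all (fun e => A (upd (upd f i x) j y e.1) (upd (upd f i x) j y e.2)) E =
   [&& c, x \in S & y \in T].
  move=> xX yX; rewrite !inE xX yX /= /c -!all_predI; apply: eq_in_all => e eE /=.
  have nb : ~~ (touches i e && touches j e).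
    apply/negP => /andP[]; rewrite /touches.
    move: nE1 nE2; case: e eE => a b /= eE n1 n2 /orP[/eqP E1|/eqP E1] /orP[/eqP E2|/eqP E2]; subst.
    - by rewrite eqxx in ij.
    - by rewrite eE in n1.
    - by rewrite eE in n2.
    - by rewrite eqxx in ij.
  move: nb; rewrite /touches !ffunE.
  case: (eqVneq e.1 i) => [E1|N1]; case: (eqVneq e.2 i) => [E2|N2];
  case: (eqVneq e.1 j) => [E3|N3]; case: (eqVneq e.2 j) => [E4|N4] //=;
  rewrite ?andbT ?andbF ?E1 ?E2 ?E3 ?E4 ?eqxx ?(negPf ij) ?[j == i]eq_sym ?(negPf ij) //.
have -> : \sum_(x in X i) \sum_(y in X j) Phi (upd (upd f i x) j y) =
   c%:R * (\sum_(x in S) \sum_(y in T) ((A x y)%:R - d)).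
  rewrite mulr_sumr.
  rewrite [RHS](bigID (fun x => x \in X i)) /= [X in _ + X]big1 ?addr0; last first.
    by move=> x /andP[]; rewrite inE => /andP[->].
  rewrite [LHS](bigID (fun x => x \in S)) /= [X in _ + X]big1 ?addr0; last first.
    move=> x /andP[xX xS]; rewrite big1 // => y yX.
    by rewrite /Phi key // (negPf xS) andbF mulr0.
  apply: eq_big => [x|x /andP[xX xS]]; first by rewrite andbC.
  rewrite mulr_sumr [LHS](bigID (fun y => y \in T)) /= [X in _ + X]big1 ?addr0; last first.
    by move=> y /andP[yX yT]; rewrite /Phi key // (negPf yT) !andbF mulr0.
  apply: eq_big => [y|y /andP[yX yT]]; first by rewrite inE andbA andbb.
  rewrite /Phi key // xS yT !andbT mulrC !ffunE eqxx (negPf ij).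
  by rewrite eqxx.
rewrite normrM ecountB.
have SX : S \subset X i by apply/fintype.subsetP => x; rewrite inE => /andP[].
have TX : T \subset X j by apply/fintype.subsetP => x; rewrite inE => /andP[].
apply: le_trans (reg _ _ SX TX).
by rewrite ger0_norm // ler_piMl // lern1 leq_b1.
Qed.

Lemma counting_lemma (delta : R) (D : F * F -> R) E X : simple_edges E ->
  (forall e, e \in E -> 0 <= D e <= 1) ->
  (forall e, e \in E -> regpair delta (D e) (X e.1) (X e.2)) ->
  `|homsum E X - \prod_(e <- E) D e * \prod_i #|X i|%:R| <=
  (size E)%:R * delta * \prod_i #|X i|%:R.
Proof.
elim: E => [|e E IH] sE D01 reg.
  have -> : homsum [::] X = \prod_i #|X i|%:R.
    by rewrite /homsum -sum_box1; apply: eq_bigr => f _; rewrite big_nil.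
  by rewrite big_nil mul1r !mul0r subrr normr0.
have sE' : simple_edges E by case/and4P: sE.
have H1 := homsum_cons sE (reg e (mem_head _ _)).
have H2 := IH sE' (fun k kE => D01 k (mem_behead (s := e :: E) kE))
                  (fun k kE => reg k (mem_behead (s := e :: E) kE)).
have /andP[d0 d1] := D01 e (mem_head _ _).
rewrite big_cons.
have -> : homsum (e :: E) X - D e * \prod_(k <- E) D k * \prod_i #|X i|%:R =
  (homsum (e :: E) X - D e * homsum E X) +
  D e * (homsum E X - \prod_(k <- E) D k * \prod_i #|X i|%:R) by ring.
apply: le_trans (ler_normD _ _) _; rewrite normrM (ger0_norm d0) /= -natr1.
have := ler_piMl (normr_ge0 (homsum E X - \prod_(k <- E) D k * \prod_i #|X i|%:R)) d1.
lra.
Qed.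

End Kernel.

End Counting.

(** * Multilinear forms on fractional partitions *)

Section Multilinear.
Variables (R : realType) (F V : finType).
Implicit Types (phi psi chi a : F -> V -> R) (h : V -> R) (i j l : F).

Definition fupd phi i h : F -> V -> R := fun j => if j == i then h else phi j.

Definition l1 h : R := \sum_x `|h x|.

Definition ones : F -> V -> R := fun _ _ => 1.

Variable k : {ffun F -> V} -> R.

Definition mform phi : R := \sum_(f : {ffun F -> V}) k f * \prod_i phi i (f i).

Lemma eq_mform phi psi : (forall i x, phi i x = psi i x) -> mform phi = mform psi.
Proof.
by move=> E; apply: eq_bigr => f _; congr (_ * _); apply: eq_bigr => i _.
Qed.

Lemma mform_fupdE phi i h :
  mform (fupd phi i h) = \sum_(f : {ffun F -> V}) k f * (h (f i) * \prod_(j | j != i) phi j (f j)).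
Proof.
apply: eq_bigr => f _; rewrite (bigD1 i) //= /fupd eqxx; congr (_ * (_ * _)).
by apply: eq_bigr => j /negPf ->.
Qed.

Lemma mform_lin phi i (c d : R) h h' :
  mform (fupd phi i (fun x => c * h x + d * h' x)) =
  c * mform (fupd phi i h) + d * mform (fupd phi i h').
Proof.
rewrite !mform_fupdE !mulr_sumr -big_split /=; apply: eq_bigr => f _; ring.
Qed.

Lemma mformB phi i h h' :
  mform (fupd phi i (fun x => h x - h' x)) = mform (fupd phi i h) - mform (fupd phi i h').
Proof.
transitivity (mform (fupd phi i (fun x => 1 * h x + (-1) * h' x))).
  by apply: eq_mform => j x; rewrite /fupd; case: eqP => // _; ring.
by rewrite mform_lin; ring.
Qed.

Lemma mform_fupd_id phi i : mform (fupd phi i (phi i)) = mform phi.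
Proof. by apply: eq_mform => j x; rewrite /fupd; case: eqP => [->|]. Qed.

Lemma mform_scale phi (c : R) : mform (fun i x => c * phi i x) = c ^+ #|F| * mform phi.
Proof.
rewrite mulr_sumr; apply: eq_bigr => f _; rewrite big_split /= prodr_const.
by rewrite mulrCA.
Qed.

Lemma mform_delta i h :
  mform (fupd ones i h) = \sum_x h x * mform (fupd ones i (fun y => (y == x)%:R)).
Proof.
under eq_bigr do rewrite mform_fupdE mulr_sumr.
rewrite exchange_big mform_fupdE /=; apply: eq_bigr => f _.
rewrite (bigD1 (f i)) //= eqxx [X in _ = _ + X]big1 ?addr0 ?mul1r; first by ring.
by move=> x /negPf; rewrite eq_sym => ->; rewrite mul0r !mulr0.
Qed.

Hypothesis k1 : forall f, `|k f| <= 1.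

Lemma mform_le phi : `|mform phi| <= \prod_i l1 (phi i).
Proof.
rewrite /l1 bigA_distr_bigA /=; apply: le_trans (ler_norm_sum _ _ _) _.
apply: ler_sum => f _; rewrite normrM normr_prod.
by rewrite ler_piMl // prodr_ge0.
Qed.

Definition hyb (s : seq F) phi psi : F -> V -> R := fun i => if i \in s then psi i else phi i.

Lemma hyb_cons s phi psi i : forall j x, hyb (i :: s) phi psi j x = fupd (hyb s phi psi) i (psi i) j x.
Proof. by move=> j x; rewrite /hyb /fupd inE; case: eqVneq => [->|]. Qed.

Lemma hyb_notin s phi psi i : i \notin s ->
  forall j x, hyb s phi psi j x = fupd (hyb s phi psi) i (phi i) j x.
Proof. by move=> /negPf ns j x; rewrite /hyb /fupd; case: eqVneq => [->|]; rewrite ?ns. Qed.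

Lemma mform_hyb_step s phi psi i : i \notin s ->
  mform (hyb (i :: s) phi psi) - mform (hyb s phi psi) =
  mform (fupd (hyb s phi psi) i (fun x => psi i x - phi i x)).
Proof.
by move=> ns; rewrite mformB (eq_mform (hyb_cons s phi psi i)) (eq_mform (hyb_notin _ _ ns)).
Qed.

Lemma hyb_enum phi psi : mform (hyb (enum F) phi psi) = mform psi.
Proof. by apply: eq_mform => i x; rewrite /hyb mem_enum. Qed.

(** Telescoping through the hybrids: each step costs [C] in one slot and at most [N] in each of the
    others. *)
Lemma mform_close phi psi (N C : R) : 0 <= C ->
  (forall i, l1 (phi i) <= N) -> (forall i, l1 (psi i) <= N) ->
  (forall i, l1 (fun x => psi i x - phi i x) <= C) ->
  `|mform psi - mform phi| <= #|F|%:R * (C * N ^+ #|F|.-1).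
Proof.
move=> C0 phN psN dC.
have l1_ge0 h : 0 <= l1 h by exact: sumr_ge0.
suff H s : uniq s -> `|mform (hyb s phi psi) - mform phi| <= (size s)%:R * (C * N ^+ #|F|.-1).
  by have := H _ (enum_uniq F); rewrite hyb_enum -cardE.
elim: s => [|i s IH] /=.
  by rewrite mul0r (@eq_mform (hyb [::] phi psi) phi) ?subrr ?normr0.
move=> /andP[ns us]; have {}IH := IH us; have E := mform_hyb_step phi psi ns.
have -> : mform (hyb (i :: s) phi psi) - mform phi =
  mform (fupd (hyb s phi psi) i (fun x => psi i x - phi i x)) + (mform (hyb s phi psi) - mform phi).
  by rewrite -E; ring.
apply: le_trans (ler_normD _ _) _; rewrite -natr1 mulrDl mul1r addrC lerD //.
apply: le_trans (mform_le _) _; rewrite (bigD1 i) //= {1}/fupd eqxx.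
rewrite ler_pM ?prodr_ge0 //.
have -> : N ^+ #|F|.-1 = \prod_(j | j != i) N.
  by rewrite prodr_const; congr (_ ^+ _); rewrite -(cardC1 i).
apply: ler_prod => j ji; rewrite l1_ge0 /= /fupd (negPf ji) /hyb.
by case: ifP.
Qed.

Hypothesis ksym : forall (s : {perm F}) phi, mform (fun i => phi (s i)) = mform phi.

Lemma mform_swap phi i j h h' : i != j ->
  mform (fupd (fupd phi i h) j h') = mform (fupd (fupd phi i h') j h).
Proof.
move=> ij; rewrite -(ksym (tperm i j)); apply: eq_mform => l x; rewrite /fupd.
case: tpermP => [->|->|/eqP li /eqP lj]; rewrite ?eqxx ?(negPf ij) //.
by rewrite (negPf li) (negPf lj).
Qed.

Lemma mform_ones_sym i j h : mform (fupd ones i h) = mform (fupd ones j h).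
Proof.
rewrite -(ksym (tperm i j)); apply: eq_mform => l x; rewrite /fupd.
case: tpermP => [->|->|/eqP li /eqP lj]; rewrite ?eqxx //; last by rewrite (negPf li) (negPf lj).
by rewrite eq_sym; case: eqVneq => // ->; rewrite eqxx.
Qed.

Let n : R := #|V|%:R.
Let m : R := #|F|%:R.

(** The fractional counterpart of a balanced family that covers every point; the mass [n / m] is
    exact, without rounding. *)
Definition fracpart chi : Prop :=
  [/\ forall i x, 0 <= chi i x, forall x, \sum_i chi i x = 1 &
      forall i, \sum_x chi i x = n / m].

Definition density (M : R) h : Prop :=
  (forall x, 0 <= h x <= M) /\ \sum_x h x = n.

Section SecondDifferences.
Variables (B0 M : R).
Hypothesis B0P : forall chi, fracpart chi -> `|mform chi| <= B0.
Hypothesis M1 : 1 <= M.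
Hypothesis F2 : (1 < #|F|)%N.

Let m2 : 2 <= m. Proof. by rewrite /m ler_nat. Qed.
Let m0 : 0 < m. Proof. by rewrite /m ltr0n ltnW. Qed.
Let s : R := (m * M)^-1.
Let M0 : 0 < M. Proof. exact: lt_le_trans ltr01 M1. Qed.
Let s0 : 0 < s. Proof. by rewrite /s invr_gt0 mulr_gt0. Qed.
Let s1 : s <= 1.
Proof. by rewrite /s invf_le1 ?mulr_gt0 // -[1]mul1r ler_pM // (le_trans _ m2) // ler1n. Qed.

(** The slope [s = 1 / (m M)] keeps a damped density in [[0, (1 + 1/m) / m]], so that [m - 2] of
    them leave at least [1 / m] at each point for the two remaining slots. *)
Let damp h : V -> R := fun x => m^-1 * (1 + s * (h x - 1)).

(* Refilling the slots [i] and [j] by [base -/+ (c h + d h')], with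
   [base] half of the mass missing from the other slots, gives fractional
   partitions whose alternating sum isolates the second difference. *)
Lemma mform_damped a i j h h' : i != j ->
  (forall l, density M (a l)) ->
  (forall x, `|h x| <= (4 * m)^-1) -> (forall x, `|h' x| <= (4 * m)^-1) ->
  \sum_x h x = 0 -> \sum_x h' x = 0 ->
  `|mform (fupd (fupd (fun l => damp (a l)) i h) j h')| <= 2 * B0.
Proof.
move=> ij aD hb hb' h0 h0'.
pose chi l := damp (a l).
have chi0 l x : 0 <= chi l x.
  have /andP[a0 aM] := (aD l).1 x.
  rewrite mulr_ge0 ?invr_ge0 ?(ltW m0) //.
  by have := mulr_ge0 (ltW s0) a0; move: s1; nra.
have chiM l x : chi l x <= m^-1 * (1 + m^-1).
  rewrite ler_pM2l ?invr_gt0 // lerD2l.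
  have /andP[a0 aM] := (aD l).1 x.
  have -> : m^-1 = s * M by rewrite /s invfM mulfVK // gt_eqF.
  by rewrite ler_pM2l //; lra.
have chiS l : \sum_x chi l x = n / m.
  rewrite /chi /damp -mulr_sumr big_split /= -mulr_sumr sumrB (aD l).2 !sumr_const.
  by rewrite subrr mulr0 addr0 mulrC.
pose base x := 2^-1 * (1 - \sum_(l | (l != i) && (l != j)) chi l x).
have cardm : #|[pred l | (l != i) && (l != j)]|%:R = m - 2.
  have : (#|[pred l | (l != i) && (l != j)]| + 2 = #|F|)%N.
    rewrite -(cardC [pred l | (l != i) && (l != j)]); congr (_ + _)%N.
    transitivity #|[set i; j]%SET|; first by rewrite cards2 ij.
    apply: eq_card => l.
    by rewrite !inE negb_and !negbK.
  by move=> E; rewrite /m -E natrD addrK.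
(* Half of the remaining [1 / m]: the room that two perturbations of size at most [1 / (4m)] can use
   up. *)
have base_ge x : 2^-1 * m^-1 <= base x.
  rewrite /base ler_pM2l // lerBrDr.
  have : \sum_(l | (l != i) && (l != j)) chi l x <= (m - 2) * (m^-1 * (1 + m^-1)).
    by rewrite -cardm mulr_natl -sumr_const; apply: ler_sum.
  move=> H; rewrite -lerBrDl; apply: le_trans H _.
  rewrite -subr_ge0.
  have -> : 1 - m^-1 - (m - 2) * (m^-1 * (1 + m^-1)) = 2 * m^-1 ^+ 2.
    by field; rewrite gt_eqF.
  by rewrite mulr_ge0 // sqr_ge0.
have baseS : \sum_x base x = n / m.
  rewrite /base -mulr_sumr sumrB exchange_big /= sumr_const.
  rewrite (eq_bigr (fun _ => n / m)) ?sumr_const // -(mulr_natl (n / m)) cardm -/n.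
  by field; rewrite gt_eqF.
pose X (c d : R) := fupd (fupd chi i (fun x => base x - c * h x - d * h' x))
                         j (fun x => base x + c * h x + d * h' x).
have XF c d : `|c| <= 1 -> `|d| <= 1 -> fracpart (X c d).
  move=> c1 d1.
  have cb x : `|c * h x| <= (4 * m)^-1.
    by rewrite normrM -[X in _ <= X]mul1r ler_pM.
  have db x : `|d * h' x| <= (4 * m)^-1.
    by rewrite normrM -[X in _ <= X]mul1r ler_pM.
  have ch0 : \sum_x c * h x = 0 by rewrite -mulr_sumr h0 mulr0.
  have dh0 : \sum_x d * h' x = 0 by rewrite -mulr_sumr h0' mulr0.
  have E4 : (4 * m)^-1 = 4^-1 * m^-1 by rewrite invfM.
  split.
  - move=> l x; rewrite /X /fupd.
    have := cb x; have := db x; have := base_ge x; rewrite E4 !ler_norml.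
    case: ifP => _; first by lra.
    by case: ifP => _; [lra | move=> *; exact: chi0].
  - move=> x; rewrite (bigD1 i) //= (bigD1 j) 1?eq_sym //=.
    rewrite (eq_bigr (fun l => chi l x)); last first.
      by move=> l /andP[/negPf li /negPf lj]; rewrite /X /fupd li lj.
    by rewrite /X /fupd !eqxx (negPf ij) /base; lra.
  - move=> l; rewrite /X /fupd; case: ifP => _.
      by rewrite !big_split /= ch0 dh0 baseS !addr0.
    case: ifP => _; last exact: chiS.
    by rewrite !sumrB ch0 dh0 baseS !subr0.
have expand c d : mform (X c d) =
    mform (fupd (fupd chi i base) j base)
    + c * mform (fupd (fupd chi i base) j h) + d * mform (fupd (fupd chi i base) j h')
    - c * mform (fupd (fupd chi i h) j base) - d * mform (fupd (fupd chi i h') j base)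
    - c * c * mform (fupd (fupd chi i h) j h) - d * d * mform (fupd (fupd chi i h') j h')
    - c * d * (2 * mform (fupd (fupd chi i h) j h')).
  have split2 (phi : F -> V -> R) l (u v w : V -> R) (p q : R) :
      mform (fupd phi l (fun x => u x + p * v x + q * w x)) =
      mform (fupd phi l u) + p * mform (fupd phi l v) + q * mform (fupd phi l w).
    rewrite (@eq_mform _ (fupd phi l (fun x => 1 * (1 * u x + p * v x) + q * w x))).
      by rewrite mform_lin mform_lin; ring.
    by move=> t x; rewrite /fupd; case: ifP => // _; ring.
  have fupdC (u v : V -> R) l x : fupd (fupd chi i u) j v l x = fupd (fupd chi j v) i u l x.
    rewrite /fupd; case: (eqVneq l i) => [->|//]; by rewrite (negPf ij).
  rewrite /X split2.
  have S (v : V -> R) : mform (fupd (fupd chi i (fun x => base x - c * h x - d * h' x)) j v) =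
     mform (fupd (fupd chi i base) j v) - c * mform (fupd (fupd chi i h) j v)
     - d * mform (fupd (fupd chi i h') j v).
    rewrite !(eq_mform (fupdC _ v)).
    rewrite (@eq_mform _ (fupd (fupd chi j v) i (fun x => base x + (- c) * h x + (- d) * h' x))).
      by rewrite split2; ring.
    by move=> t x; rewrite /fupd; case: ifP => // _; ring.
  rewrite !S (mform_swap chi h' h ij); ring.
have N0 : `|0 : R| <= 1 by rewrite normr0.
have N1 : `|1 : R| <= 1 by rewrite normr1.
(* Of the terms of [expand] only the one with [c * d] survives in [H00 - H01 - H10 + H11]; its
   factor 2 turns the bound [4 * B0] into [2 * B0]. *)
have H00 := B0P (XF 0 0 N0 N0); have H01 := B0P (XF 0 1 N0 N1).
have H10 := B0P (XF 1 0 N1 N0); have H11 := B0P (XF 1 1 N1 N1).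
move: H00 H01 H10 H11; rewrite !expand !ler_norml; lra.
Qed.

Let wgt : R := 2 * m / s.
Let wgt1 : 1 <= wgt.
Proof.
rewrite /wgt ler_pdivlMr // mul1r (le_trans s1) //; move: m2; lra.
Qed.

Lemma density1 : density M (fun _ => 1).
Proof. by split=> [x|]; [rewrite ler01 | rewrite sumr_const]. Qed.

(** Undamping slot by slot: [a l] is [m / s] times the difference of [damp (a l)] and
    [(1 - s) damp 1]. Each slot thus costs a factor at most [(m / s) (2 - s)], which is below
    [wgt]. *)
Lemma mform_half_damped (r : seq F) a i j h h' : i != j -> uniq r -> i \notin r -> j \notin r ->
  (forall l, density M (a l)) ->
  (forall x, `|h x| <= (4 * m)^-1) -> (forall x, `|h' x| <= (4 * m)^-1) ->
  \sum_x h x = 0 -> \sum_x h' x = 0 ->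
  `|mform (fupd (fupd (hyb r (fun l => damp (a l)) a) i h) j h')| <= 2 * B0 * wgt ^+ size r.
Proof.
move=> ij ur ir jr aD hb hb' h0 h0'; elim: r ur ir jr a aD => [|l r IH] /=.
  by move=> _ _ _ a aD; rewrite expr0 mulr1; apply: (@mform_damped a).
rewrite !inE !negb_or => /andP[lr ur] /andP[il ir] /andP[jl jr] a aD.
pose a1 := fupd a l (fun _ => 1).
have a1D l' : density M (a1 l') by rewrite /a1 /fupd; case: ifP => // _; exact: density1.
have H1 := IH ur ir jr a aD; have H2 := IH ur ir jr a1 a1D.
pose ctx := fupd (fupd (hyb r (fun l => damp (a l)) a) i h) j h'.
have E u : mform (fupd ctx l u) = mform (fupd (fupd (fupd (hyb r (fun l => damp (a l)) a) l u) i h) j h').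
  apply: eq_mform => t x; rewrite /ctx /fupd.
  by case: (eqVneq t l) => [->|//]; rewrite ![l == _]eq_sym (negPf il) (negPf jl).
have -> : mform (fupd (fupd (hyb (l :: r) (fun l => damp (a l)) a) i h) j h') =
   m / s * (mform (fupd (fupd (hyb r (fun l => damp (a l)) a) i h) j h') -
      (1 - s) * mform (fupd (fupd (hyb r (fun l => damp (a1 l)) a1) i h) j h')).
  have -> : mform (fupd (fupd (hyb (l :: r) (fun l => damp (a l)) a) i h) j h') = mform (fupd ctx l (a l)).
    rewrite E; apply: eq_mform => t x; rewrite /fupd /hyb inE.
    by case: (t == j) => //; case: (t == i) => //; case: (eqVneq t l) => [->|].
  have -> : mform (fupd (fupd (hyb r (fun l => damp (a l)) a) i h) j h') =
      mform (fupd ctx l (fun x => s / m * a l x + (1 - s) / m * 1)).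
    rewrite E; apply: eq_mform => t x; rewrite /fupd /hyb.
    case: (t == j) => //; case: (t == i) => //; case: (eqVneq t l) => [->|//].
    by rewrite (negPf lr) /damp; ring.
  have -> : mform (fupd (fupd (hyb r (fun l => damp (a1 l)) a1) i h) j h') =
      mform (fupd ctx l (fun x => 0 * 1 + m^-1 * 1)).
    rewrite E; apply: eq_mform => t x; rewrite /fupd /hyb.
    case: (t == j) => //; case: (t == i) => //; rewrite /a1 /fupd; case: (eqVneq t l) => [->|//].
    by rewrite (negPf lr) /damp; ring.
  by rewrite !mform_lin; field; rewrite !gt_eqF.
rewrite normrM ger0_norm; last by rewrite divr_ge0 // ltW.
have -> : 2 * B0 * wgt ^+ (size r).+1 = m / s * (2 * (2 * B0 * wgt ^+ size r)).
  by rewrite exprS /wgt; field; rewrite gt_eqF.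
rewrite ler_pM2l ?divr_gt0 //; apply: le_trans (ler_normB _ _) _.
rewrite normrM (ger0_norm (x := 1 - s)) ?subr_ge0 //.
have : 1 - s <= 1 by move: s0; lra.
move/(ler_piMl (normr_ge0 (mform (fupd (fupd (hyb r (fun l => damp (a1 l)) a1) i h) j h')))).
by move: H1 H2; lra.
Qed.

Let B0_ge0 : 0 <= B0.
Proof.
suff /B0P : fracpart (fun _ _ => m^-1) by apply: le_trans.
split=> [i x|x|i]; first by rewrite invr_ge0 ltW.
  by rewrite sumr_const -mulr_natl divff // gt_eqF.
by rewrite sumr_const -mulr_natl.
Qed.

(** The square undoes the scaling of the two differences: a difference of densities is bounded by
    [M] and has to be brought down to [1 / (4m)]. *)
Definition diffbound : R := (4 * m * M) ^+ 2 * (2 * B0 * wgt ^+ #|F|).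

Lemma mform_diff2 a i j (b b' c c' : V -> R) : i != j ->
  (forall l, density M (a l)) ->
  density M b -> density M b' -> density M c -> density M c' ->
  `|mform (fupd (fupd a i (fun x => b x - b' x)) j (fun x => c x - c' x))| <= diffbound.
Proof.
move=> ij aD bD bD' cD cD'.
pose q := (4 * m * M)^-1.
have q0 : 0 < 4 * m * M by rewrite !mulr_gt0.
have small (u u' : V -> R) : density M u -> density M u' ->
   (forall x, `|q * (u x - u' x)| <= (4 * m)^-1) /\ \sum_x q * (u x - u' x) = 0.
  move=> [uM uS] [uM' uS']; split; last by rewrite -mulr_sumr sumrB uS uS' subrr mulr0.
  move=> x; rewrite normrM (ger0_norm (x := q)) ?invr_ge0 ?(ltW q0) // /q ler_pdivrMl //.
  rewrite mulrAC divff ?mul1r ?gt_eqF ?mulr_gt0 //.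
  by have := uM x; have := uM' x; rewrite ler_norml; lra.
have [hb h0] := small _ _ bD bD'; have [hb' h0'] := small _ _ cD cD'.
pose r := [seq l <- enum F | (l != i) && (l != j)].
have ur : uniq r by rewrite filter_uniq // enum_uniq.
have ir : i \notin r by rewrite mem_filter eqxx.
have jr : j \notin r by rewrite mem_filter eqxx andbF.
have H := mform_half_damped ij ur ir jr aD hb hb' h0 h0'.
have E : mform (fupd (fupd a i (fun x => b x - b' x)) j (fun x => c x - c' x)) =
  (4 * m * M) ^+ 2 * mform (fupd (fupd (hyb r (fun l => damp (a l)) a) i
     (fun x => q * (b x - b' x))) j (fun x => q * (c x - c' x))).
  have sc (phi : F -> V -> R) l (u : V -> R) : mform (fupd phi l (fun x => q * u x)) = q * mform (fupd phi l u).
    rewrite (@eq_mform _ (fupd phi l (fun x => q * u x + 0 * u x))) ?mform_lin; first by ring.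
    by move=> t x; rewrite /fupd; case: ifP => // _; ring.
  rewrite sc (mform_swap (hyb r (fun l => damp (a l)) a)) // sc.
  rewrite (mform_swap (hyb r (fun l => damp (a l)) a)) //.
  rewrite (@eq_mform (fupd (fupd (hyb r _ a) i _) j _) (fupd (fupd a i (fun x => b x - b' x)) j (fun x => c x - c' x))).
    by rewrite /q; field; rewrite !gt_eqF.
  move=> t x; rewrite /fupd; case: (eqVneq t j) => // tj; case: (eqVneq t i) => // ti.
  by rewrite /hyb mem_filter ti tj mem_enum.
rewrite E normrM ger0_norm ?sqr_ge0 // /diffbound ler_pM2l ?exprn_gt0 //.
apply: le_trans H _; rewrite ler_wpM2l ?mulr_ge0 // ler_weXn2l //.
by rewrite size_filter cardE count_size.
Qed.

End SecondDifferences.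

End Multilinear.

(** * Approximate additivity from second differences *)

Section Additivity.
Variables (R : realType) (F V : finType) (k : {ffun F -> V} -> R).
Hypothesis ksym : forall (s : {perm F}) phi, mform k (fun i => phi (s i)) = mform k phi.
Variables (B0 M : R).
Hypothesis B0P : forall chi, fracpart chi -> `|mform k chi| <= B0.
Hypothesis M1 : 1 <= M.
Hypothesis F2 : (1 < #|F|)%N.

Let D := diffbound F B0 M.
Let one_fun : V -> R := fun _ => 1.

Lemma fupdC (phi : F -> V -> R) i j u v : i != j ->
  forall l x, fupd (fupd phi i u) j v l x = fupd (fupd phi j v) i u l x.
Proof. by move=> ij l x; rewrite /fupd; case: (eqVneq l i) => [->|//]; rewrite (negPf ij). Qed.

Lemma hyb_density (r : seq F) (a : F -> V -> R) : (forall l, density M (a l)) ->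
  forall l, density M (hyb r (@ones R F V) a l).
Proof. by move=> aD l; rewrite /hyb; case: ifP => // _; exact: density1. Qed.

(** Whenever another slot passes from 1 to [a l], the first difference in slot [i] changes by a
    second difference, hence by at most [D]. *)
Lemma mform_slot (r : seq F) a i : (forall l, density M (a l)) -> uniq r -> i \notin r ->
  `|mform k (fupd (hyb r (@ones R F V) a) i (fun x => a i x - 1)) -
    mform k (fupd (@ones R F V) i (fun x => a i x - 1))| <= (size r)%:R * D.
Proof.
move=> aD; elim: r => [|l r IH] /=; first by rewrite subrr normr0 mul0r.
rewrite inE negb_or => /andP[lr ur] /andP[il ir]; have {}IH := IH ur ir.
have li : l != i by rewrite eq_sym.
set h := (fun x => a i x - 1) in IH *.
have E : mform k (fupd (hyb (l :: r) (@ones R F V) a) i h) =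
   mform k (fupd (hyb r (@ones R F V) a) i h) +
   mform k (fupd (fupd (hyb r (@ones R F V) a) l (fun x => a l x - one_fun x)) i h).
  rewrite (eq_mform _ (fupdC (hyb r (@ones R F V) a) (fun x => a l x - one_fun x) h li)).
  rewrite mformB.
  rewrite (@eq_mform _ _ _ k (fupd (hyb (l :: r) (@ones R F V) a) i h)
    (fupd (fupd (hyb r (@ones R F V) a) i h) l (a l))); last first.
    move=> t x; rewrite -(fupdC _ _ _ li) /fupd /hyb inE.
    by case: (t == i) => //; case: (eqVneq t l) => [->|].
  rewrite (@eq_mform _ _ _ k (fupd (fupd (hyb r (@ones R F V) a) i h) l one_fun)
    (fupd (hyb r (@ones R F V) a) i h)); last first.
    move=> t x; rewrite -(fupdC _ _ _ li) /fupd /hyb.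
    by case: (t == i) => //; case: (eqVneq t l) => [->|//]; rewrite (negPf lr).
  by ring.
have H : `|mform k (fupd (fupd (hyb r (@ones R F V) a) l (fun x => a l x - one_fun x)) i h)| <= D.
  apply: (mform_diff2 ksym B0P M1 F2 li (hyb_density r aD) (aD l)) => //; exact: density1.
rewrite E -natr1 mulrDl mul1r addrAC.
by apply: le_trans (ler_normD _ _) _; rewrite lerD.
Qed.

(** The constant family [1 / m] is a fractional partition, and [ones] is [m] times it. *)
Lemma mform_ones_le : `|mform k (@ones R F V)| <= #|F|%:R ^+ #|F| * B0.
Proof.
have m0 : 0 < #|F|%:R :> R by rewrite ltr0n ltnW.
have fp : fracpart (fun (_ : F) (_ : V) => #|F|%:R^-1 : R).
  split=> [i x|x|i]; first by rewrite invr_ge0 ltW.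
    by rewrite sumr_const -(mulr_natl (#|F|%:R^-1)) divff // gt_eqF.
  by rewrite sumr_const -(mulr_natl (#|F|%:R^-1)).
have -> : mform k (@ones R F V) = #|F|%:R ^+ #|F| * mform k (fun (_ : F) (_ : V) => #|F|%:R^-1).
  rewrite -mform_scale; apply: eq_mform => i x.
  by rewrite /ones divff // gt_eqF.
by rewrite normrM ger0_norm ?exprn_ge0 // ler_pM2l ?exprn_gt0 // B0P.
Qed.

(** Telescoping from [ones] to [a] gives first differences at hybrids, which [mform_slot] moves to
    the base point [ones]. The [m - 1] leftover values at [ones] are bounded by [mform_ones_le]. *)
Lemma mform_additive a : (forall l, density M (a l)) ->
  `|mform k a - \sum_i mform k (fupd (@ones R F V) i (a i))| <=
  #|F|%:R ^+ 2 * D + #|F|%:R * (#|F|%:R ^+ #|F| * B0).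
Proof.
move=> aD.
have D0 : 0 <= D.
  have [i [j ij]] : exists i j : F, i != j.
    have /card_gt0P[i _] : (0 < #|F|)%N by exact: ltnW.
    have /card_gt0P[j] : (0 < #|predC1 i|)%N by rewrite cardC1 -ltnS prednK // ltnW.
    by rewrite inE => ji; exists i, j; rewrite eq_sym.
  exact: le_trans (normr_ge0 _) (mform_diff2 ksym B0P M1 F2 ij aD (aD i) (aD i) (aD i) (aD i)).
have m0 : 0 < #|F|%:R :> R by rewrite ltr0n ltnW.
pose o := mform k (@ones R F V).
pose G i := mform k (fupd (@ones R F V) i (fun x => a i x - one_fun x)).
have GE i : G i = mform k (fupd (@ones R F V) i (a i)) - o.
  by rewrite /G mformB (mform_fupd_id k (@ones R F V) i).
have o_le : `|o| <= #|F|%:R ^+ #|F| * B0 by exact: mform_ones_le.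
suff H r : uniq r -> `|mform k (hyb r (@ones R F V) a) - o - \sum_(i <- r) G i| <=
    (size r)%:R * (#|F|%:R * D).
  have := H _ (enum_uniq F); rewrite hyb_enum -cardE big_enum /=.
  rewrite (eq_bigr (fun i => mform k (fupd (@ones R F V) i (a i)) - o)); last by move=> i _; rewrite GE.
  rewrite sumrB sumr_const -(mulr_natl o) => {}H.
  have mo : `|(#|F|%:R - 1) * o| <= #|F|%:R * (#|F|%:R ^+ #|F| * B0).
    have m1 : 0 <= #|F|%:R - 1 :> R by rewrite subr_ge0 ler1n ltnW.
    by rewrite normrM ger0_norm // ler_pM //; lra.
  have -> : mform k a - \sum_i mform k (fupd (@ones R F V) i (a i)) =
   (mform k a - o - (\sum_i mform k (fupd (@ones R F V) i (a i)) - #|F|%:R * o)) - (#|F|%:R - 1) * o by ring.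
  apply: le_trans (ler_normB _ _) _; rewrite lerD //.
  by apply: le_trans H _; rewrite expr2 mulrA.
elim: r => [|i r IH] /=.
  by rewrite big_nil mul0r subr0 subrr normr0.
move=> /andP[ir ur]; have {}IH := IH ur.
rewrite big_cons -natr1 mulrDl mul1r.
have E := mform_hyb_step k (@ones R F V) a ir.
have -> : mform k (hyb (i :: r) (@ones R F V) a) - o - (G i + \sum_(j <- r) G j) =
  (mform k (hyb r (@ones R F V) a) - o - \sum_(j <- r) G j) +
  (mform k (fupd (hyb r (@ones R F V) a) i (fun x => a i x - 1)) - G i).
  by rewrite -E; ring.
apply: le_trans (ler_normD _ _) _; rewrite lerD //.
apply: le_trans (mform_slot aD ur ir) _; rewrite ler_wpM2r // ler_nat.
by rewrite -(card_uniqP ur) max_card.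
Qed.

End Additivity.

(** * Rounding fractional partitions *)

Section Rounding.
Variables (R : realType) (F V : finType) (k : {ffun F -> V} -> R).
Hypothesis k1 : forall f, `|k f| <= 1.
Hypothesis F2 : (1 < #|F|)%N.
Implicit Types (chi : F -> V -> R) (x y : V) (i j : F).

Let n : R := #|V|%:R.
Let m : R := #|F|%:R.
Let m0 : 0 < m. Proof. by rewrite /m ltr0n ltnW. Qed.
Let n0 : 0 <= n. Proof. by rewrite /n. Qed.

Definition dip x y : V -> R := fun z => (z == x)%:R - (z == y)%:R.

Definition supp chi : nat := #|[set q : F * V | chi q.1 q.2 != 0]%SET|.

Lemma frac_l1 chi i : fracpart chi -> l1 (chi i) = n / m.
Proof. by case=> c0 _ /(_ i) <-; apply: eq_bigr => x _; rewrite ger0_norm. Qed.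

Lemma frac_le1 chi i x : fracpart chi -> chi i x <= 1.
Proof.
case=> c0 c1 _; rewrite -(c1 x) (bigD1 i) //= lerDl; apply: sumr_ge0 => j _; exact: c0.
Qed.

Lemma l1_dip x y : l1 (dip x y) <= 2.
Proof.
have S z : \sum_x (x == z)%:R = 1 :> R.
  by rewrite (bigD1 z) //= eqxx big1 ?addr0 // => t /negPf ->.
apply: (@le_trans _ _ (\sum_z ((z == x)%:R + (z == y)%:R))).
  by apply: ler_sum => z _; apply: le_trans (ler_normB _ _) _; rewrite !normr_nat.
by rewrite big_split /= !S.
Qed.

Lemma sum_dip x y : \sum_z dip x y z = 0.
Proof.
have S z : \sum_x (x == z)%:R = 1 :> R.
  by rewrite (bigD1 z) //= eqxx big1 ?addr0 // => t /negPf ->.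
by rewrite sumrB !S subrr.
Qed.

Lemma n_div_le : n / m <= n.
Proof. by rewrite ler_pdivrMr // ler_peMr // /m ler1n ltnW. Qed.

Lemma mform_dip2 chi i j x y : fracpart chi -> i != j ->
  `|mform k (fupd (fupd chi i (dip x y)) j (dip x y))| <= 4 * n ^+ (#|F| - 2).
Proof.
move=> cF ij; apply: le_trans (mform_le k1 _) _.
have l1_ge0 h : 0 <= l1 h :> R by exact: sumr_ge0.
have Ei : fupd (fupd chi i (dip x y)) j (dip x y) i = dip x y.
  by rewrite /fupd (negPf ij) eqxx.
have Ej : fupd (fupd chi i (dip x y)) j (dip x y) j = dip x y by rewrite /fupd eqxx.
rewrite (bigD1 i) //= (bigD1 j) 1?eq_sym //= mulrA Ei Ej.
rewrite ler_pM ?mulr_ge0 ?prodr_ge0 //.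
  have -> : 4 = 2 * 2 :> R by ring.
  by rewrite ler_pM // l1_dip.
have -> : n ^+ (#|F| - 2) = \prod_(l | (l != i) && (l != j)) n.
  rewrite prodr_const; congr (_ ^+ _); apply/eqP.
  rewrite -(eqn_add2r 2) subnK // -(cardC [pred l | (l != i) && (l != j)]) eqn_add2l.
  apply/eqP; transitivity #|[set i; j]%SET|; last by rewrite cards2 ij.
  by apply: eq_card => l; rewrite !inE negb_and !negbK.
apply: ler_prod => l /andP[li lj]; rewrite l1_ge0 /= /fupd (negPf li) (negPf lj).
by rewrite frac_l1 // n_div_le.
Qed.

Definition slope chi i j x y : R :=
  mform k (fupd chi i (dip x y)) - mform k (fupd chi j (dip x y)).

Lemma slopeN chi i j x y : slope chi i j y x = - slope chi i j x y.
Proof.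
have E l : mform k (fupd chi l (dip y x)) = - mform k (fupd chi l (dip x y)).
  rewrite (@eq_mform _ _ _ k _ (fupd chi l (fun z => (-1) * dip x y z + 0 * dip x y z))).
    by rewrite mform_lin; ring.
  by move=> t z; rewrite /fupd; case: ifP => // _; rewrite /dip; ring.
by rewrite /slope !E; ring.
Qed.

(** Mass [t] moves from [y] to [x] in slot [i] and from [x] to [y] in slot [j], which preserves all
    row and column sums. The form is quadratic in [t]: by the sign condition the linear term does
    not lower the absolute value, and the quadratic term is at most [4 n^(m-2)]. *)
Lemma pipage_step chi i j x y : fracpart chi -> i != j -> x != y ->
  chi i x != 0 -> chi i y != 0 -> chi j x != 0 -> chi j y != 0 ->
  0 <= mform k chi * slope chi i j x y ->
  exists chi', [/\ fracpart chi', (supp chi' < supp chi)%N &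
    `|mform k chi| <= `|mform k chi'| + 4 * n ^+ (#|F| - 2)].
Proof.
move=> cF ij xy ix iy jx jy fL; have [c0 c1 cS] := cF.
(* The largest admissible shift annihilates [chi j x] or [chi i y]. The entries that grow were
   already nonzero, so the support shrinks. *)
pose t := Num.min (chi j x) (chi i y).
have t0 : 0 <= t by rewrite /t le_min !c0.
have t1 : t <= 1 by rewrite /t ge_min frac_le1.
have tjx : t <= chi j x by rewrite /t ge_min lexx.
have tiy : t <= chi i y by rewrite /t ge_min lexx orbT.
pose chi' := fupd (fupd chi i (fun z => 1 * chi i z + t * dip x y z))
                  j (fun z => 1 * chi j z + (- t) * dip x y z).
have chi'i z : chi' i z = chi i z + t * dip x y z by rewrite /chi' /fupd (negPf ij) eqxx mul1r.
have chi'j z : chi' j z = chi j z - t * dip x y z by rewrite /chi' /fupd eqxx mul1r mulNr.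
have chi'l l z : l != i -> l != j -> chi' l z = chi l z.
  by move=> /negPf li /negPf lj; rewrite /chi' /fupd li lj.
have dE z : dip x y z = if z == x then 1 else if z == y then -1 else 0.
  rewrite /dip; case: (eqVneq z x) => [->|_]; first by rewrite (negPf xy) subr0.
  by case: (z == y); rewrite /= ?mulr0n ?sub0r ?oppr0.
exists chi'; split.
- split.
  + move=> l z; case: (eqVneq l i) => [->|li].
      rewrite chi'i dE; case: eqP => [_|_]; first by rewrite mulr1 addr_ge0.
      by case: eqP => [->|_]; rewrite ?mulrN1 ?subr_ge0 // mulr0 addr0.
    case: (eqVneq l j) => [->|lj]; last by rewrite chi'l.
    rewrite chi'j dE; case: eqP => [->|_]; first by rewrite mulr1 subr_ge0.
    by case: eqP => [_|_]; [rewrite mulrN1 opprK addr_ge0 | rewrite mulr0 subr0].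
  + move=> z; rewrite -(c1 z) (bigD1 i) //= (bigD1 j) 1?eq_sym //=.
    rewrite [in RHS](bigD1 i) //= [in RHS](bigD1 j) 1?eq_sym //=.
    rewrite chi'i chi'j (eq_bigr (fun l => chi l z)); first by ring.
    by move=> l /andP[li lj]; rewrite chi'l.
  + move=> l; case: (eqVneq l i) => [->|li].
      rewrite (eq_bigr _ (fun z _ => chi'i z)) big_split /= -mulr_sumr sum_dip cS.
      by rewrite mulr0 addr0.
    case: (eqVneq l j) => [->|lj]; last by rewrite (eq_bigr _ (fun z _ => chi'l l z li lj)).
    rewrite (eq_bigr _ (fun z _ => chi'j z)) sumrB -mulr_sumr sum_dip cS.
    by rewrite mulr0 subr0.
- rewrite /supp proper_card //; apply/fintype.properP; split.
    apply/fintype.subsetP => -[l z]; rewrite !inE /=.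
    case: (eqVneq l i) => [->|li].
      rewrite chi'i dE; case: (eqVneq z x) => [->|_] //.
      by case: (eqVneq z y) => [->|_] //; rewrite mulr0 addr0.
    case: (eqVneq l j) => [->|lj]; last by rewrite chi'l.
    rewrite chi'j dE; case: (eqVneq z x) => [->|_] //.
    by case: (eqVneq z y) => [->|_] //; rewrite mulr0 subr0.
  case: (leP (chi j x) (chi i y)) => le.
    exists (j, x); rewrite !inE //= chi'j dE eqxx mulr1 /t min_l // subrr eqxx.
    by [].
  exists (i, y); rewrite !inE //= chi'i dE [y == x]eq_sym (negPf xy) eqxx mulrN1.
  by rewrite /t min_r ?ltW // subrr eqxx.
have E : mform k chi' = mform k chi + t * slope chi i j x y
    - t * t * mform k (fupd (fupd chi i (dip x y)) j (dip x y)).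
  rewrite /chi' mform_lin.
  have S v : mform k (fupd (fupd chi i (fun z => 1 * chi i z + t * dip x y z)) j v) =
    mform k (fupd chi j v) + t * mform k (fupd (fupd chi i (dip x y)) j v).
    rewrite (eq_mform k (fupdC _ _ _ ij)) mform_lin mul1r; congr (_ + _ * _).
      apply: eq_mform => l z; rewrite -(fupdC _ _ _ ij) /fupd.
      by case: (l == j) => //; case: eqP => [->|].
    by rewrite (eq_mform k (fupdC _ _ _ ij)).
  rewrite !S mform_fupd_id /slope.
  have -> : mform k (fupd (fupd chi i (dip x y)) j (chi j)) = mform k (fupd chi i (dip x y)).
    by apply: eq_mform => l z; rewrite /fupd; case: eqP => [->|//]; rewrite eq_sym (negPf ij).
  by ring.
have K := mform_dip2 x y cF ij.
set f0 := mform k chi in fL E *; set L := slope _ _ _ _ _ in fL E.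
set K0 := mform k (fupd _ _ _) in E K.
have : `|f0| <= `|f0 + t * L|.
  case: (ltgtP f0 0) => [fn|fp|->]; last by rewrite normr0.
    have L0 : L <= 0 by rewrite nmulr_rge0 in fL.
    have : t * L <= 0 by rewrite mulr_ge0_le0.
    by move=> tL; rewrite !ltr0_norm //; lra.
  have L0 : 0 <= L by rewrite pmulr_rge0 in fL.
  have : 0 <= t * L by rewrite mulr_ge0.
  by move=> tL; rewrite !gtr0_norm //; lra.
move=> H; apply: (le_trans H).
have -> : f0 + t * L = mform k chi' + t * t * K0 by rewrite E; ring.
apply: le_trans (ler_normD _ _) _; rewrite lerD2l normrM.
apply: le_trans K; rewrite ler_piMl // ger0_norm ?mulr_ge0 //.
by rewrite mulr_ile1.
Qed.

Definition movable chi : bool :=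
  [exists q : (F * F) * (V * V), [&& q.1.1 != q.1.2, q.2.1 != q.2.2,
     chi q.1.1 q.2.1 != 0, chi q.1.1 q.2.2 != 0, chi q.1.2 q.2.1 != 0 & chi q.1.2 q.2.2 != 0]].

(** Exchanging [x] and [y] reverses the slope, so a move with the right sign always exists; each
    move shrinks the support. *)
Lemma pipage N chi : fracpart chi -> (supp chi <= N)%N ->
  exists chi', [/\ fracpart chi', ~~ movable chi' &
    `|mform k chi| <= `|mform k chi'| + N%:R * (4 * n ^+ (#|F| - 2))].
Proof.
elim: N chi => [|N IH] chi cF sN.
all: have [/existsP[[[i j] [x y]] /=]|nm] := boolP (movable chi); last first.
1,3: exists chi; split=> //; rewrite lerDl !mulr_ge0 ?exprn_ge0 //.
all: case/and5P => ij xy ix iy /andP[jx jy].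
all: have [chi1 [cF1 s1 b1]] : exists chi', [/\ fracpart chi', (supp chi' < supp chi)%N &
    `|mform k chi| <= `|mform k chi'| + 4 * n ^+ (#|F| - 2)].
1,3: case: (leP 0 (mform k chi * slope chi i j x y)) => H;
  [ by apply: (@pipage_step chi i j x y)
  | apply: (@pipage_step chi i j y x) => //; [by rewrite eq_sym |
      by rewrite slopeN mulrN oppr_ge0 ltW] ].
- by have := leq_trans s1 sN.
- have [chi' [cF' nm' b']] := IH chi1 cF1 (leq_trans s1 sN).
  exists chi'; split=> //; rewrite -natr1 mulrDl mul1r; lra.
Qed.

(** Induction on the total deficiency: while some class has fewer than [q] points, the classes
    together cannot exhaust [V]. *)
Lemma extend_coloring (c : V -> option F) (q : nat) : (q * #|F| <= #|V|)%N ->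
  (forall i, #|[set x | c x == Some i]%SET| <= q)%N ->
  exists c' : V -> option F, (forall x, c x != None -> c' x = c x) /\
    forall i, #|[set x | c' x == Some i]%SET| = q.
Proof.
move=> qV; move: {2}(\sum_i (q - #|[set x | c x == Some i]%SET|))%N
  (erefl (\sum_i (q - #|[set x | c x == Some i]%SET|))%N) => N.
elim: N c => [|N IH] c EN cq.
  exists c; split=> // i; apply/eqP; rewrite eqn_leq cq /=.
  by move/eqP: EN; rewrite sum_nat_eq0 => /forallP/(_ i); rewrite subn_eq0.
have [i ci] : exists i, (#|[set x | c x == Some i]%SET| < q)%N.
  case: (pickP (fun i => #|[set x | c x == Some i]%SET| < q)%N) => [i ?|H]; first by exists i.
  by move: EN; rewrite big1 // => i _; apply/eqP; rewrite subn_eq0 leqNgt H.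
have [x cx] : exists x, c x == None.
  apply/existsP; apply: contraLR qV => H; rewrite -ltnNge.
  have -> : #|V| = (\sum_i #|[set x | c x == Some i]%SET|)%N.
    rewrite -sum1_card.
    rewrite (eq_bigr (fun x => \sum_i (c x == Some i)%N)%N).
      rewrite exchange_big /=; apply: eq_bigr => j _.
      rewrite -[RHS]sum1_card big_mkcond [RHS]big_mkcond /=; apply: eq_bigr => x _.
      by rewrite inE; case: (c x == Some j).
    move=> x _; move/existsPn/(_ x): H; case: (c x) => [j|] // _.
    rewrite (bigD1 j) //= eqxx big1 // => l lj.
    by case: eqP => // -[E]; rewrite E eqxx in lj.
  have -> : (q * #|F| = \sum_(j : F) q)%N by rewrite sum_nat_const mulnC.
  rewrite (bigD1 i) //= [ltnRHS](bigD1 i) //=.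
  by rewrite -addSn leq_add // leq_sum.
pose c1 y := if y == x then Some i else c y.
have S1 : [set y | c1 y == Some i]%SET = (x |: [set y | c y == Some i])%SET.
  by apply/setP => y; rewrite !inE /c1; case: (eqVneq y x) => [->|]; rewrite ?eqxx.
have S2 j : j != i -> [set y | c1 y == Some j]%SET = [set y | c y == Some j]%SET.
  move=> ji; apply/setP => y; rewrite !inE /c1; case: (eqVneq y x) => [->|] //.
  by rewrite (eqP cx); apply/eqP => -[E]; rewrite E eqxx in ji.
have C1 : #|[set y | c1 y == Some i]%SET| = #|[set y | c y == Some i]%SET|.+1.
  by rewrite S1 cardsU1 inE (eqP cx).
have [||c' [c'1 c'2]] := IH c1.
- rewrite (bigD1 i) //= in EN.
  rewrite (bigD1 i) //= C1 (eq_bigr (fun j => q - #|[set y | c y == Some j]%SET|)%N).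
    by move: EN ci; set A := #|_|; set B := (\sum_(j | _) _)%N; lia.
  by move=> j ji; rewrite S2.
- move=> j; case: (eqVneq j i) => [->|ji]; first by rewrite C1.
  by rewrite S2.
exists c'; split=> // y yN.
have yx : y != x by apply: contraNneq yN => ->.
have E : c1 y = c y by rewrite /c1 (negPf yx).
by rewrite -E; apply: c'1; rewrite E.
Qed.

Definition fractional chi x : bool :=
  [exists q : F * F, [&& q.1 != q.2, chi q.1 x != 0 & chi q.2 x != 0]].

(** When no move is possible, two parts have at most one point of common support, so the fractional
    points inject into the pairs of parts. *)
Lemma card_fractional chi : ~~ movable chi ->
  (#|[set x | fractional chi x]%SET| <= #|F| ^ 2)%N.
Proof.
move=> nm; have /card_gt0P[i0 _] : (0 < #|F|)%N by exact: ltnW.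
set Z := finset _.
pose g x := odflt (i0, i0) [pick q : F * F | [&& q.1 != q.2, chi q.1 x != 0 & chi q.2 x != 0]].
have gP x : x \in Z -> [&& (g x).1 != (g x).2, chi (g x).1 x != 0 & chi (g x).2 x != 0].
  rewrite inE => /existsP[q qP]; rewrite /g; case: pickP => [//|/(_ q)].
  by rewrite qP.
have gI : {in Z &, injective g}.
  move=> x y xZ yZ E; apply/eqP; apply: contraNT nm => xy.
  have /and3P[n1 a1 a2] := gP _ xZ; have := gP _ yZ; rewrite -E => /and3P[_ b1 b2].
  by apply/existsP; exists (g x, (x, y)); rewrite /= n1 xy a1 a2 b1 b2.
by rewrite -(card_in_imset gI) (leq_trans (max_card _)) // card_prod mulnn.
Qed.

(** The term [4 m] comes from at most [m n] moves at a cost of [4 n^(m-2)] each. The term [2 m^3]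
    comes from replacing an immovable partition by a colouring with classes of size [n %/ m], which
    changes each of the [m] slots by at most [2 m^2] in [l1]. *)
Lemma frac_bound (B : R) chi :
  (forall c : V -> option F, (forall i, #|[set x | c x == Some i]%SET| = #|V| %/ #|F|)%N ->
     `|mform k (fun i x => (c x == Some i)%:R)| <= B) ->
  fracpart chi -> `|mform k chi| <= B + (4 * m + 2 * m ^+ 3) * n ^+ #|F|.-1.
Proof.
move=> BP cF.
have sN : (supp chi <= #|F| * #|V|)%N by rewrite -card_prod max_card.
have [chi' [[c0 c1 cS] nm b]] := pipage cF sN.
have cF' : fracpart chi' by [].
pose Z := [set x | fractional chi' x]%SET.
have cZ : #|Z|%:R <= m ^+ 2 by rewrite /m -natrX ler_nat card_fractional.
(* Outside [Z] the partition is already an indicator; the points of [Z] stay uncoloured until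
   [extend_coloring]. *)
pose c x := if x \in Z then None else [pick i | chi' i x != 0].
have cE x i : x \notin Z -> chi' i x = (c x == Some i)%:R.
  move=> xZ; rewrite /c (negPf xZ); case: pickP => [j jx|H]; last first.
    have := c1 x; rewrite big1 => [/eqP|l _]; first by rewrite eq_sym oner_eq0.
    by have := H l => /negbFE/eqP.
  have O l : l != j -> chi' l x = 0.
    move=> lj; apply/eqP; apply: contraNT xZ => lx; rewrite inE; apply/existsP.
    by exists (l, j); rewrite /= lj lx jx.
  have jj : chi' j x = 1 by have := c1 x; rewrite (bigD1 j) //= big1 ?addr0.
  case: (eqVneq i j) => [->|ij]; first by rewrite eqxx jj.
  rewrite O // (_ : _ == _ = false) //; apply/eqP => -[E]; by rewrite E eqxx in ij.
have sumE i : \sum_x chi' i x = #|[set x | c x == Some i]%SET|%:R + \sum_(x in Z) chi' i x.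
  rewrite (bigID (fun x => x \in Z)) /= addrC; congr (_ + _).
  rewrite -sum1_card natr_sum big_mkcond [RHS]big_mkcond /=; apply: eq_bigr => x _.
  rewrite inE; case: (boolP (x \in Z)) => xZ /=; first by rewrite /c xZ.
  by rewrite cE //; case: ifP.
have ZS i : \sum_(x in Z) chi' i x <= m ^+ 2.
  apply: le_trans cZ; rewrite -sum1_card natr_sum.
  by apply: ler_sum => x _; exact: frac_le1.
have ZS0 i : 0 <= \sum_(x in Z) chi' i x by apply: sumr_ge0.
have Wq i : (#|[set x | c x == Some i]%SET| <= #|V| %/ #|F|)%N.
  rewrite leq_divRL ?(ltnW F2) //; have := sumE i; rewrite cS => E.
  have : #|[set x | c x == Some i]%SET|%:R <= n / m by rewrite E lerDl.
  by rewrite ler_pdivlMr // -natrM ler_nat.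
have [c' [c'1 c'2]] := extend_coloring (leq_divM #|V| #|F|) Wq.
have B' := BP c' c'2.
have close i : l1 (fun x => (c' x == Some i)%:R - chi' i x) <= 2 * m ^+ 2.
  apply: (@le_trans _ _ (\sum_x (((c' x == Some i) && (c x != Some i))%:R +
                          (if x \in Z then chi' i x else 0)))).
    apply: ler_sum => x _; case: (boolP (x \in Z)) => xZ.
      have -> : c x = None by rewrite /c xZ.
      rewrite andbT; apply: le_trans (ler_normB _ _) _.
      by rewrite normr_nat ger0_norm.
    rewrite addr0 cE //; case: (eqVneq (c x) (Some i)) => [cx|cx].
      by rewrite c'1 ?cx ?eqxx ?subrr ?normr0.
    by rewrite subr0 andbT normr_nat.
  rewrite big_split /= -big_mkcond /=.
  have -> : \sum_x ((c' x == Some i) && (c x != Some i))%:R =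
     (#|V| %/ #|F|)%:R - #|[set x | c x == Some i]%SET|%:R :> R.
    rewrite -(c'2 i) -!sum1_card !natr_sum [X in _ = X - _]big_mkcond [X in _ = _ - X]big_mkcond -sumrB /=.
    apply: eq_bigr => x _; rewrite !inE; case: (eqVneq (c x) (Some i)) => [cx|cx].
      by rewrite c'1 ?cx // eqxx /= subrr.
    by rewrite andbT subr0; case: ifP.
  have q_le : (#|V| %/ #|F|)%:R <= n / m.
    by rewrite ler_pdivlMr // -natrM ler_nat leq_divM.
  have := ZS i; have := sumE i; rewrite cS; move: q_le; lra.
have U1 i : l1 (fun x => (c' x == Some i)%:R : R) <= n.
  apply: (@le_trans _ _ (\sum_(x : V) 1)); last by rewrite sumr_const.
  by apply: ler_sum => x _; rewrite normr_nat lern1 leq_b1.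
have C1 i : l1 (chi' i) <= n by rewrite frac_l1 // n_div_le.
have H := mform_close k1 (_ : 0 <= 2 * m ^+ 2) C1 U1 close.
have {}H := H (mulr_ge0 (ler0n _ 2) (sqr_ge0 m)).
have E1 : (#|F| * #|V|)%:R * (4 * n ^+ (#|F| - 2)) = 4 * m * n ^+ #|F|.-1.
  have -> : (#|F|.-1 = (#|F| - 2).+1)%N by rewrite -subSn // subSS subn1.
  by rewrite exprS natrM -/m -/n; ring.
have E2 : #|F|%:R * (2 * m ^+ 2 * n ^+ #|F|.-1) = 2 * m ^+ 3 * n ^+ #|F|.-1.
  by rewrite -/m; ring.
rewrite E1 in b; rewrite -/m in H E2; rewrite E2 in H.
have := ler_distD (mform k (fun i x => (c' x == Some i)%:R)) (mform k chi') 0.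
rewrite !subr0 distrC; move: b B' H; lra.
Qed.

End Rounding.

(** * Regular families of subsets *)

Section Density.
Variables (R : realType) (V : finType) (A : rel V).
Implicit Types S T : {set V}.

(** An empty side gives density 0, so that [densK] holds for all sets. *)
Definition dens S T : R := ecount R A S T / (#|S|%:R * #|T|%:R).

Lemma ecount_ge0 S T : 0 <= ecount R A S T.
Proof. by apply: sumr_ge0 => x _; apply: sumr_ge0. Qed.

Lemma ecount_le S T : ecount R A S T <= #|S|%:R * #|T|%:R.
Proof.
apply: (@le_trans _ _ (\sum_(x in S) #|T|%:R)); last by rewrite sumr_const mulr_natl.
apply: ler_sum => x _.
apply: (@le_trans _ _ (\sum_(y in T) 1)); last by rewrite sumr_const.
by apply: ler_sum => y _; rewrite lern1 leq_b1.
Qed.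

Lemma dens01 S T : 0 <= dens S T <= 1.
Proof.
rewrite divr_ge0 ?ecount_ge0 ?mulr_ge0 //=.
have [E|N] := eqVneq (#|S|%:R * #|T|%:R : R) 0; first by rewrite /dens E invr0 mulr0.
by rewrite ler_pdivrMr ?mul1r ?ecount_le // lt_neqAle eq_sym N mulr_ge0.
Qed.

Lemma ecount0l S T : #|S| = 0%N -> ecount R A S T = 0.
Proof. by move/cards0_eq => ->; rewrite /ecount big_set0. Qed.

Lemma ecount0r S T : #|T| = 0%N -> ecount R A S T = 0.
Proof. by move/cards0_eq => ->; rewrite /ecount big1 // => x _; rewrite big_set0. Qed.

Lemma densK S T : dens S T * (#|S|%:R * #|T|%:R) = ecount R A S T.
Proof.
have [/eqP E|N] := eqVneq (#|S|%:R * #|T|%:R : R) 0; last by rewrite divfK.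
rewrite (eqP E) mulr0; move: E; rewrite mulf_eq0 !pnatr_eq0 => /orP[] /eqP H.
  by rewrite ecount0l.
by rewrite ecount0r.
Qed.

Lemma ecount_splitl S' S T : S' \subset S ->
  ecount R A S T = ecount R A S' T + ecount R A (S :\: S') T.
Proof.
move=> sub; rewrite /ecount (big_setID S') /=; congr (_ + _).
by rewrite (finset.setIidPr sub).
Qed.

Lemma ecount_splitr S T' T : T' \subset T ->
  ecount R A S T = ecount R A S T' + ecount R A S (T :\: T').
Proof.
move=> sub; rewrite /ecount -big_split /=; apply: eq_bigr => x _.
by rewrite (big_setID T') /= (finset.setIidPr sub).
Qed.

Lemma weight_densl S' S T : #|S'|%:R / #|S|%:R * dens S' T = ecount R A S' T / (#|S|%:R * #|T|%:R).
Proof.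
have [E|N] := eqVneq (#|S'|%:R : R) 0.
  by rewrite E !mul0r ecount0l ?mul0r //; apply/eqP; rewrite -(pnatr_eq0 R) E.
transitivity (#|S'|%:R / #|S'|%:R * (ecount R A S' T / (#|S|%:R * #|T|%:R))).
  by rewrite /dens !invfM; ring.
by rewrite divff // mul1r.
Qed.

Lemma weight_densr S T' T : #|T'|%:R / #|T|%:R * dens S T' = ecount R A S T' / (#|S|%:R * #|T|%:R).
Proof.
have [E|N] := eqVneq (#|T'|%:R : R) 0.
  by rewrite E !mul0r ecount0r ?mul0r //; apply/eqP; rewrite -(pnatr_eq0 R) E.
transitivity (#|T'|%:R / #|T'|%:R * (ecount R A S T' / (#|S|%:R * #|T|%:R))).
  by rewrite /dens !invfM; ring.
by rewrite divff // mul1r.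
Qed.

End Density.

(** * Energy increment by passing to subsets *)

Section Energy.
Variables (R : realType) (V : finType) (A : rel V) (I : finType) (c : I -> I -> R).
Implicit Types (X : I -> {set V}) (S T : {set V}) (a b : I).

Local Notation dens := (dens R A).

(* For large [c] the square is dominated by the linear term [2 c dens], so a
   family of larger energy also keeps a prescribed bias of the densities. *)
Definition energy X : R :=
  \sum_(q : I * I | q.1 != q.2) (dens (X q.1) (X q.2) + c q.1 q.2) ^+ 2.

Definition part S' S (s : bool) : {set V} := if s then S' else (S :\: S')%SET.

Definition resplit X a S (s : bool) : I -> {set V} :=
  fun i => if i == a then part S (X a) s else X i.

Definition wgt S' S (s : bool) : R := #|part S' S s|%:R / #|S|%:R.

Lemma wgt_ge0 S' S s : 0 <= wgt S' S s.
Proof. by rewrite divr_ge0. Qed.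

Lemma sum_wgt S' S : S' \subset S -> (0 < #|S|)%N -> \sum_s wgt S' S s = 1.
Proof.
move=> sub S0; rewrite big_bool /wgt /= -mulrDl -natrD.
by rewrite cardsDS // subnKC ?subset_leq_card // divff // pnatr_eq0 -lt0n.
Qed.

Lemma part_sub S' S s : S' \subset S -> part S' S s \subset S.
Proof. by case: s => //= _; exact: subsetDl. Qed.

Lemma sum_resplit X a S i j : S \subset X a -> (0 < #|X a|)%N -> i != j ->
  \sum_s wgt S (X a) s * dens (resplit X a S s i) (resplit X a S s j) = dens (X i) (X j).
Proof.
move=> sub X0 ij; rewrite /resplit.
have [ia|ia] := eqVneq i a.
  rewrite -ia eq_sym (negPf ij) in sub X0 *.
  under eq_bigr do rewrite weight_densl.
  by rewrite big_bool /= -mulrDl -ecount_splitl.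
have [ja|ja] := eqVneq j a.
  rewrite -ja in sub X0 *; under eq_bigr do rewrite weight_densr.
  by rewrite big_bool /= -mulrDl -ecount_splitr.
by rewrite -mulr_suml sum_wgt // mul1r.
Qed.

(** The second moment is the squared mean plus the variance, which the shift [d] leaves unchanged;
    of the variance only the term of [j0] is kept. *)
Lemma variance_le (J : finType) (p y : J -> R) (z d : R) (j0 : J) :
  (forall j, 0 <= p j) -> \sum_j p j = 1 -> \sum_j p j * y j = z ->
  (z + d) ^+ 2 + p j0 * (y j0 - z) ^+ 2 <= \sum_j p j * (y j + d) ^+ 2.
Proof.
move=> p0 p1 yz.
have -> : \sum_j p j * (y j + d) ^+ 2 = (z + d) ^+ 2 + \sum_j p j * (y j - z) ^+ 2.
  have -> : \sum_j p j * (y j + d) ^+ 2 =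
     \sum_j p j * (y j - z) ^+ 2 + (2 * (z + d)) * (\sum_j p j * y j)
     + (d ^+ 2 - z ^+ 2) * \sum_j p j.
    rewrite !mulr_sumr -!big_split /=; apply: eq_bigr => j _; ring.
  by rewrite yz p1; ring.
rewrite lerD2l (bigD1 j0) //= lerDl; apply: sumr_ge0 => j _.
by rewrite mulr_ge0 // sqr_ge0.
Qed.

Variables (Kc : R).
Hypothesis cK : forall i j, `|c i j| <= Kc.

Definition emax : R := #|I|%:R ^+ 2 * (1 + Kc) ^+ 2.

Lemma energy_le X : energy X <= emax.
Proof.
apply: (@le_trans _ _ (\sum_(q : I * I) (1 + Kc) ^+ 2)); last first.
  by rewrite sumr_const card_prod -mulr_natl natrM /emax expr2.
rewrite /energy big_mkcond /=; apply: ler_sum => q _; case: ifP => _; last by rewrite sqr_ge0.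
have /andP[d0 d1] := dens01 R A (X q.1) (X q.2).
have K0 : 0 <= Kc by apply: le_trans (cK q.1 q.2).
rewrite -[X in X <= _]real_normK ?num_real // ler_pXn2r ?nnegrE ?addr_ge0 //.
by apply: le_trans (ler_normD _ _) _; rewrite lerD // ger0_norm.
Qed.

Lemma energy_ge0 X : 0 <= energy X.
Proof. by apply: sumr_ge0 => q _; rewrite sqr_ge0. Qed.

(** The four choices of pieces, weighted by size, preserve the mean density of every pair, so by
    convexity no term drops on average. The term of [(a, b)] gains the variance due to the pieces
    [S] and [T]. *)
Lemma energy_split X a b S T (delta : R) : a != b -> 0 <= delta ->
  (forall i, 0 < #|X i|)%N -> S \subset X a -> T \subset X b ->
  delta * (#|X a|%:R * #|X b|%:R) <
    `|ecount R A S T - dens (X a) (X b) * #|S|%:R * #|T|%:R| ->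
  energy X + delta ^+ 2 <=
    \sum_(st : bool * bool) wgt S (X a) st.1 * wgt T (X b) st.2 *
      energy (resplit (resplit X a S st.1) b T st.2).
Proof.
move=> ab d0 X0 Sa Tb irr.
pose p (st : bool * bool) := wgt S (X a) st.1 * wgt T (X b) st.2.
pose Y (st : bool * bool) := resplit (resplit X a S st.1) b T st.2.
have ba : b != a by rewrite eq_sym.
have p0 st : 0 <= p st by rewrite mulr_ge0 ?wgt_ge0.
have p1 : \sum_st p st = 1.
  rewrite -(pair_bigA _ (fun s t => wgt S (X a) s * wgt T (X b) t)) /=.
  by under eq_bigr do rewrite -mulr_sumr sum_wgt // mulr1; rewrite sum_wgt.
have mean i j : i != j -> \sum_st p st * dens (Y st i) (Y st j) = dens (X i) (X j).
  move=> ij; rewrite -(sum_resplit Sa (X0 a) ij).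
  rewrite -(pair_bigA _ (fun s t => p (s, t) * dens (Y (s, t) i) (Y (s, t) j))) /=.
  apply: eq_bigr => s _; rewrite /p /Y /=.
  have Xb : resplit X a S s b = X b by rewrite /resplit (negPf ba).
  rewrite -(@sum_resplit (resplit X a S s) b T i j) ?Xb // mulr_sumr.
  by apply: eq_bigr => t _; rewrite mulrA.
have -> : \sum_st p st * energy (Y st) =
   \sum_(q : I * I | q.1 != q.2) \sum_st p st * (dens (Y st q.1) (Y st q.2) + c q.1 q.2) ^+ 2.
  rewrite exchange_big /=; apply: eq_bigr => st _; by rewrite /energy mulr_sumr.
rewrite /energy (bigD1 (a, b)) //= [X in _ <= X](bigD1 (a, b)) //= addrAC.
apply: lerD; last first.
  apply: ler_sum => -[i j] /= /andP[ij _].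
  apply: le_trans (variance_le (c i j) (true, true) p0 p1 (mean i j ij)).
  by rewrite lerDl mulr_ge0 // sqr_ge0.
apply: le_trans (variance_le (c a b) (true, true) p0 p1 (mean a b ab)).
rewrite lerD2l /Y /resplit eqxx (negPf ab) /= eqxx /p /wgt /=.
have na : 0 < #|X a|%:R :> R by rewrite ltr0n.
have nb : 0 < #|X b|%:R :> R by rewrite ltr0n.
rewrite -densK -mulrA -mulrBl normrM in irr.
set D := dens S T - _ in irr *.
rewrite (ger0_norm (x := #|S|%:R * #|T|%:R)) ?mulr_ge0 // in irr.
set al := #|S|%:R / #|X a|%:R; set be := #|T|%:R / #|X b|%:R.
have al01 : 0 <= al <= 1.
  by rewrite divr_ge0 //= ler_pdivrMr // mul1r ler_nat subset_leq_card.
have be01 : 0 <= be <= 1.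
  by rewrite divr_ge0 //= ler_pdivrMr // mul1r ler_nat subset_leq_card.
have irr' : delta < `|D| * (al * be).
  rewrite -(ltr_pM2r (mulr_gt0 na nb)) /al /be.
  have -> : `|D| * (#|S|%:R / #|X a|%:R * (#|T|%:R / #|X b|%:R)) * (#|X a|%:R * #|X b|%:R) = `|D| * (#|S|%:R * #|T|%:R).
    by field; rewrite !gt_eqF.
  by [].
have ab01 : 0 <= al * be <= 1.
  by have /andP[? ?] := al01; have /andP[? ?] := be01; rewrite mulr_ge0 //= mulr_ile1.
rewrite -[D ^+ 2]real_normK ?num_real //.
(* As [al * be] is at most 1, the variance term [al * be * D^2] is at least [(al * be * D)^2], which
   exceeds [delta^2]. *)
apply: (@le_trans _ _ ((`|D| * (al * be)) ^+ 2)).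
  by rewrite ler_pXn2r ?nnegrE ?mulr_ge0 // ?ltW //; case/andP: ab01.
have /andP[g0 g1] := ab01; rewrite exprMn mulrC ler_wpM2r ?sqr_ge0 // expr2.
by rewrite ler_piMl.
Qed.

(** A choice with a piece of relative size below [tau] contributes at most [tau * emax] to the
    average, and four of them less than [delta^2 / 2]. Hence some choice has two large pieces and
    half of the gain. *)
Lemma energy_increment X a b S T (delta tau : R) : a != b -> 0 < delta -> 0 < tau ->
  8 * tau * emax < delta ^+ 2 ->
  (forall i, 0 < #|X i|)%N -> S \subset X a -> T \subset X b ->
  delta * (#|X a|%:R * #|X b|%:R) <
    `|ecount R A S T - dens (X a) (X b) * #|S|%:R * #|T|%:R| ->
  exists Y : I -> {set V}, [/\ forall i, Y i \subset X i,
    forall i, tau * #|X i|%:R <= #|Y i|%:R &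
    energy X + delta ^+ 2 / 2 <= energy Y].
Proof.
move=> ab d0 t0 tE X0 Sa Tb irr.
have ba : b != a by rewrite eq_sym.
have E := energy_split ab (ltW d0) X0 Sa Tb irr.
pose Y (st : bool * bool) := resplit (resplit X a S st.1) b T st.2.
pose good (st : bool * bool) := [&& tau <= wgt S (X a) st.1, tau <= wgt T (X b) st.2 &
    energy X + delta ^+ 2 / 2 <= energy (Y st)].
have [st /and3P[H1 H2 H3]] : exists st, good st.
  have [st gst|nog] := pickP good; first by exists st.
  exfalso; move: E; apply/negP; rewrite -ltNge.
  pose sm (S' S0 : {set V}) s : R := if wgt S' S0 s < tau then tau else 0.
  have smP (S' S0 : {set V}) s : 0 <= sm S' S0 s by rewrite /sm; case: ifP => // _; rewrite ltW.
  have em0 : 0 <= emax by apply: le_trans (energy_ge0 X) (energy_le X).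
  have W1 : \sum_(st : bool * bool) wgt S (X a) st.1 * wgt T (X b) st.2 = 1.
    rewrite -(pair_bigA _ (fun s t => wgt S (X a) s * wgt T (X b) t)) /=.
    by under eq_bigr do rewrite -mulr_sumr sum_wgt // mulr1; rewrite sum_wgt.
  have bound st : wgt S (X a) st.1 * wgt T (X b) st.2 * energy (Y st) <=
     wgt S (X a) st.1 * wgt T (X b) st.2 * (energy X + delta ^+ 2 / 2) + tau * emax.
    have w0 := wgt_ge0 S (X a) st.1; have w0' := wgt_ge0 T (X b) st.2.
    have w1 : wgt S (X a) st.1 <= 1.
      by rewrite ler_pdivrMr ?ltr0n // mul1r ler_nat subset_leq_card // part_sub.
    have w1' : wgt T (X b) st.2 <= 1.
      by rewrite ler_pdivrMr ?ltr0n // mul1r ler_nat subset_leq_card // part_sub.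
    have eY := energy_le (Y st); have eY0 := energy_ge0 (Y st).
    have eX0 : 0 <= energy X + delta ^+ 2 / 2.
      by rewrite addr_ge0 ?energy_ge0 // divr_ge0 // sqr_ge0.
    have small (w w' : R) : 0 <= w -> w < tau -> 0 <= w' -> w' <= 1 ->
       w * w' * energy (Y st) <= tau * emax.
      move=> *; rewrite ler_pM ?mulr_ge0 //.
      by rewrite -[tau]mulr1 ler_pM // ltW.
    have := nog st; rewrite /good.
    case: (leP tau (wgt S (X a) st.1)) => /= [_|lt1]; last first.
      by move=> _; apply: le_trans (small _ _ w0 lt1 w0' w1') _; rewrite lerDr !mulr_ge0.
    case: (leP tau (wgt T (X b) st.2)) => /= [_|lt2]; last first.
      move=> _; rewrite [wgt S _ _ * _]mulrC.
      by apply: le_trans (small _ _ w0' lt2 w0 w1) _; rewrite lerDr !mulr_ge0.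
    move=> /negbT; rewrite -ltNge => lt3.
    apply: le_trans (ler_wpM2l _ (ltW lt3)) _; first by rewrite mulr_ge0.
    by rewrite lerDl mulr_ge0 // ltW.
  apply: le_lt_trans (ler_sum _ (fun st _ => bound st)) _.
  rewrite big_split /= -mulr_suml W1 mul1r sumr_const card_prod !card_bool.
  rewrite -mulr_natl; move: tE; rewrite -[delta ^+ 2]mul1r; lra.
have wle1 S' S0 s : S' \subset S0 -> (0 < #|S0|)%N -> wgt S' S0 s <= 1.
  move=> sub S00; rewrite ler_pdivrMr ?ltr0n // mul1r ler_nat subset_leq_card //.
  exact: part_sub.
exists (Y st); split => //.
  move=> i; rewrite /Y /resplit; case: (eqVneq i b) => [->|_].
    by rewrite (negPf ba) part_sub.
  by case: (eqVneq i a) => [->|_] //; rewrite part_sub.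
move=> i; rewrite /Y /resplit; case: (eqVneq i b) => [->|_].
  by rewrite (negPf ba) -ler_pdivlMr ?ltr0n.
case: (eqVneq i a) => [->|_]; first by rewrite -ler_pdivlMr ?ltr0n.
by rewrite ler_piMl // (le_trans H1) // wle1.
Qed.

Definition regfam (delta : R) X : Prop :=
  forall i j, i != j -> regpair A delta (dens (X i) (X j)) (X i) (X j).

Lemma irregular_witness (delta : R) X : ~ regfam delta X ->
  exists a b S T, [/\ a != b, S \subset X a, T \subset X b &
     delta * (#|X a|%:R * #|X b|%:R) < `|ecount R A S T - dens (X a) (X b) * #|S|%:R * #|T|%:R|].
Proof.
move=> nreg; apply: contrapT => H; apply: nreg => i j ij S T Si Tj; rewrite leNgt.
by apply/negP => irr; apply: H; exists i, j, S, T.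
Qed.

(** Every increment gains [delta^2 / 2] below the ceiling [emax], so at most [k] of them occur, and
    each keeps a proportion [tau]. *)
Lemma regularize_aux (delta tau : R) k X : 0 < delta -> 0 < tau -> tau <= 1 ->
  8 * tau * emax < delta ^+ 2 -> (forall i, 0 < #|X i|)%N ->
  emax < energy X + k.+1%:R * (delta ^+ 2 / 2) ->
  exists Y : I -> {set V}, [/\ forall i, Y i \subset X i,
    forall i, tau ^+ k * #|X i|%:R <= #|Y i|%:R,
    energy X <= energy Y & regfam delta Y].
Proof.
move=> d0 t0 t1 tE; elim: k X => [|k IH] X X0 eX.
  exists X; split=> // [i|]; first by rewrite mul1r.
  apply: contrapT => /irregular_witness[a [b [S [T [ab Sa Tb irr]]]]].
  have [Y [_ _ en]] := energy_increment ab d0 t0 tE X0 Sa Tb irr.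
  by have := energy_le Y; move: eX; rewrite mul1r; lra.
have [reg|] := pselect (regfam delta X).
  by exists X; split=> // i; rewrite ler_piMl // exprn_ile1 // ltW.
move=> /irregular_witness[a [b [S [T [ab Sa Tb irr]]]]].
have [Y [sub size en]] := energy_increment ab d0 t0 tE X0 Sa Tb irr.
have Y0 i : (0 < #|Y i|)%N.
  by rewrite -(ltr0n R) (lt_le_trans _ (size i)) // mulr_gt0 // ltr0n.
have [|Z [subZ sizeZ enZ regZ]] := IH Y Y0.
  by move: eX; rewrite -natr1 mulrDl; lra.
exists Z; split=> //; last by apply: le_trans enZ; rewrite (le_trans _ en) // lerDl divr_ge0 // sqr_ge0.
  by move=> i; apply: fintype.subset_trans (subZ i) (sub i).
move=> i; apply: le_trans (sizeZ i); rewrite exprSr -mulrA ler_pM2l ?exprn_gt0 //.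
Qed.

End Energy.

(** What matters is the order of the quantifiers: [c0] depends on the index set, [delta] and [Kc],
    but not on the graph, the sets or the bias. *)
Lemma regularize (R : realType) (I : finType) (delta Kc : R) : 0 < delta ->
  exists2 c0 : R, 0 < c0 & forall (V : finType) (A : rel V) (c : I -> I -> R) (X : I -> {set V}),
    (forall i j, `|c i j| <= Kc) -> (forall i, 0 < #|X i|)%N ->
    exists Y : I -> {set V}, [/\ forall i, Y i \subset X i, forall i, c0 * #|X i|%:R <= #|Y i|%:R,
      energy A c X <= energy A c Y & regfam A delta Y].
Proof.
move=> d0; pose E := emax I Kc.
have E0 : 0 <= E by rewrite mulr_ge0 ?sqr_ge0.
pose tau : R := Num.min 1 (delta ^+ 2 / (16 * (E + 1))).
have E1 : 0 < 16 * (E + 1) by rewrite mulr_gt0 // ltr_wpDl.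
have t0 : 0 < tau by rewrite lt_min ltr01 divr_gt0 // exprn_gt0.
have t1 : tau <= 1 by rewrite ge_min lexx.
have tE : 8 * tau * E < delta ^+ 2.
  have : tau <= delta ^+ 2 / (16 * (E + 1)) by rewrite ge_min lexx orbT.
  rewrite ler_pdivlMr // => H.
  have : 0 < delta ^+ 2 by rewrite exprn_gt0.
  have := mulr_ge0 (ltW t0) E0; lra.
have d2 : 0 < delta ^+ 2 / 2 by rewrite divr_gt0 // exprn_gt0.
pose k := Num.truncn (E / (delta ^+ 2 / 2)).
have kE : E < k.+1%:R * (delta ^+ 2 / 2).
  rewrite -ltr_pdivrMr //; apply: truncnS_gt.
exists (tau ^+ k); first by rewrite exprn_gt0.
move=> V A c X cK X0.
apply: (regularize_aux (Kc := Kc)) => //.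
by apply: lt_le_trans kE _; rewrite lerDr energy_ge0.
Qed.

(** * Limits of arrays *)

Section UltraLimits.
Variables (R : realType) (U : set_system nat).
Context {UF : UltraFilter U}.

Lemma ultra_lim (v : nat -> R) (c d : R) : (forall t, c <= v t <= d) ->
  exists2 l : R, c <= l <= d & forall e : R, 0 < e -> U (fun t : nat => `|v t - l| < e).
Proof.
move=> vb.
have [] := @segment_compact R c d (v @ U)%classic _ _.
  apply: (@filterS _ U _ classical_sets.setT); last exact: filterT.
  by move=> t _ /=; rewrite in_itv /= vb.
move=> l [lcd ll]; exists l; first by move: lcd; rewrite /= in_itv.
move=> e e0.
have [//|nU] := in_ultra_setVsetC (fun t : nat => `|v t - l| < e) UF.
have [] := ll (v @` (~` (fun t : nat => `|v t - l| < e)))%classic (ball (l : R) e).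
- by apply: (@filterS _ U _ _ _ _ nU) => t ?; exists t.
- exact: nbhsx_ballx.
move=> _ [[t /= nt <-]]; rewrite -ball_normE /= distrC => lt.
by case: nt.
Qed.

Lemma near_all (T : eqType) (P : T -> nat -> Prop) (s : seq T) :
  (forall z, U (fun j : nat => P z j)) -> U (fun j : nat => forall z, z \in s -> P z j).
Proof.
move=> UP; elim: s => [|z s IH]; first by apply: filterS (@filterT _ U _).
apply: filterS (filterI (UP z) IH) => j [Pz Ps] y; rewrite inE => /orP[/eqP->//|]; exact: Ps.
Qed.

End UltraLimits.

Lemma prod_close (R : realType) (T : eqType) (E : seq T) (x y : T -> R) (eta : R) :
  (forall e, e \in E -> 0 <= x e <= 1) -> (forall e, e \in E -> 0 <= y e <= 1) ->
  (forall e, e \in E -> `|x e - y e| <= eta) ->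
  `|\prod_(e <- E) x e - \prod_(e <- E) y e| <= (size E)%:R * eta.
Proof.
elim: E => [|e E IH] x01 y01 xy; first by rewrite !big_nil subrr normr0 mul0r.
have memE f : f \in E -> f \in e :: E by rewrite inE orbC => ->.
have {}IH := IH (fun f fE => x01 f (memE f fE)) (fun f fE => y01 f (memE f fE))
                (fun f fE => xy f (memE f fE)).
have Y01 : 0 <= \prod_(f <- E) y f <= 1.
  have: forall f, f \in E -> 0 <= y f <= 1 by move=> f /memE; exact: y01.
  elim: (E) => [|f s IHs] H; first by rewrite big_nil ler01 lexx.
  have /IHs/andP[s0 s1] : forall f, f \in s -> 0 <= y f <= 1.
    by move=> h hs; apply: H; rewrite inE hs orbT.
  have /andP[f0 f1] := H f (mem_head _ _).
  by rewrite big_cons mulr_ge0 //= mulr_ile1.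
have /andP[x0 x1] := x01 e (mem_head _ _); have xye := xy e (mem_head _ _).
have /andP[Y0 Y1] := Y01.
rewrite !big_cons.
have -> : x e * \prod_(f <- E) x f - y e * \prod_(f <- E) y f =
  x e * (\prod_(f <- E) x f - \prod_(f <- E) y f) + (x e - y e) * \prod_(f <- E) y f by ring.
apply: le_trans (ler_normD _ _) _; rewrite !normrM (ger0_norm x0) (ger0_norm Y0) /= -natr1.
have := ler_piMl (normr_ge0 (\prod_(f <- E) x f - \prod_(f <- E) y f)) x1.
have := ler_piMr (normr_ge0 (x e - y e)) Y1.
lra.
Qed.

Local Notation pt := (bool * nat)%type.

Section Arrays.
Variables (R : realType) (F : finType) (E : seq (F * F)) (P0 : R).
Hypothesis E_loopless : forall e, e \in E -> e.1 != e.2.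

Definition symavg (w : F -> F -> R) : R :=
  ((#|F|)`!%:R)^-1 * \sum_(s : {perm F}) \prod_(e <- E) w (s e.1) (s e.2).

Lemma symavg_close (w w' : F -> F -> R) (eta : R) :
  (forall i j, 0 <= w i j <= 1) -> (forall i j, 0 <= w' i j <= 1) ->
  (forall i j, i != j -> `|w i j - w' i j| <= eta) ->
  `|symavg w - symavg w'| <= (size E)%:R * eta.
Proof.
move=> w01 w01' ww.
have m0 : 0 < ((#|F|)`!%:R : R) by rewrite ltr0n fact_gt0.
rewrite /symavg -mulrBr normrM (ger0_norm (x := _^-1)) ?invr_ge0 ?(ltW m0) // ler_pdivrMl // -sumrB.
apply: le_trans (ler_norm_sum _ _ _) _.
apply: (@le_trans _ _ (\sum_(s : {perm F}) (size E)%:R * eta)).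
  apply: ler_sum => s _; apply: prod_close => // e eE.
  by apply: ww; rewrite (inj_eq perm_inj) E_loopless.
have -> : (#|F|)`! = #|{perm F}|.
  transitivity #|perm_on [set: F]%SET|; first by rewrite card_perm cardsT.
  by apply: eq_card => s; rewrite !inE; apply/fintype.subsetP => x _; rewrite inE.
by rewrite sumr_const (mulr_natl ((size E)%:R * eta)).
Qed.

Variables (W : nat -> pt -> pt -> R) (g : nat -> pt -> R).
Variables (lo hi : bool -> R) (wl wh : R).
Hypothesis W01 : forall t a b, 0 <= W t a b <= 1.
Hypothesis Wsym : forall t a b, W t a b = W t b a.
Hypothesis gb : forall t b i, lo b <= g t (b, i) <= hi b.
Hypothesis Wc : forall t i j, wl <= W t (true, i) (false, j) <= wh.
Variable Th : (F -> bool) -> Prop.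
Hypothesis Weq : forall t (iota : F -> pt), injective iota ->
  Th (fun l => (iota l).1) -> (forall l, (iota l).2 < t)%N ->
  `|symavg (fun i j => W t (iota i) (iota j)) - P0 - \sum_l g t (iota l)| <= t.+1%:R^-1.

(* Iterated limits along an ultrafilter replace Ramsey's theorem: far out in
   the array, entries depend only on the types of the two points. *)
Lemma array_limit : exists (u v w : R) (a : bool -> R),
  [/\ [/\ 0 <= u <= 1, 0 <= v <= 1, 0 <= w <= 1 & wl <= w <= wh],
      forall b, lo b <= a b <= hi b &
      forall th, Th th ->
       symavg (fun i j => if th i then (if th j then u else w) else (if th j then w else v))
         = P0 + \sum_l a (th l)].
Proof.
have [U [UF Uoo]] := ultraFilterLemma eventually_filter.
have Uge N : U (fun t : nat => (N <= t)%N) by apply: Uoo; exact: nbhs_infty_ge.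
(* Three nested limits: [Wi] in the array index [t], then [L] in the index of the second point, then
   [w] in the index of the first. *)
have /choice[Wi WiP] : forall q : pt * pt, exists l : R, 0 <= l <= 1 /\
    forall e : R, 0 < e -> U (fun t : nat => `|W t q.1 q.2 - l| < e).
  by move=> q; have [l ? ?] := ultra_lim (fun t => W01 t q.1 q.2); exists l.
have /choice[gi giP] : forall q : pt, exists l : R, lo q.1 <= l <= hi q.1 /\
    forall e : R, 0 < e -> U (fun t : nat => `|g t q - l| < e).
  move=> [b i]; have [l ? ?] := ultra_lim (fun t => gb t b i); by exists l.
have Wi01 q : 0 <= Wi q <= 1 by have [] := WiP q.
have Ulim_eq (x y : nat -> R) (lx ly : R) : (forall t, x t = y t) ->
    (forall e : R, 0 < e -> U (fun t : nat => `|x t - lx| < e)) ->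
    (forall e : R, 0 < e -> U (fun t : nat => `|y t - ly| < e)) -> lx = ly.
  move=> xy Hx Hy; apply/eqP; rewrite -subr_eq0 -normr_eq0 eq_le normr_ge0 andbT.
  apply/ler_addgt0Pl => e e0; rewrite addr0.
  have e20 : 0 < e / 2 by rewrite divr_gt0.
  have [t [/= h1 h2]] := filter_ex (filterI (Hx _ e20) (Hy _ e20)).
  rewrite -xy distrC in h2; have := ler_distD (x t) lx ly; rewrite (distrC lx) in h1 *.
  by rewrite (distrC lx (x t)) => /le_trans; apply; move: h1 h2; rewrite distrC (distrC (x t) ly); lra.
have Wisym a b : Wi (a, b) = Wi (b, a).
  by apply: Ulim_eq (fun t => Wsym t a b) (WiP (a, b)).2 (WiP (b, a)).2.
have WiC i j : wl <= Wi ((true, i), (false, j)) <= wh.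
  have [l lb lP] := ultra_lim (fun t => Wc t i j).
  by rewrite -(Ulim_eq _ _ _ _ (fun t => erefl) lP (WiP ((true, i), (false, j))).2).
have /choice[L LP] : forall q : pt * bool, exists l : R, 0 <= l <= 1 /\
    forall e : R, 0 < e -> U (fun j : nat => `|Wi (q.1, (q.2, j)) - l| < e).
  by move=> q; have [l ? ?] := ultra_lim (fun j => Wi01 (q.1, (q.2, j))); exists l.
have LC i : wl <= L ((true, i), false) <= wh.
  have [l lb lP] := ultra_lim (fun j => WiC i j).
  by rewrite -(Ulim_eq _ _ _ _ (fun t => erefl) lP (LP ((true, i), false)).2).
have /choice[w wP] : forall q : bool * bool, exists l : R, 0 <= l <= 1 /\
    forall e : R, 0 < e -> U (fun i : nat => `|L ((q.1, i), q.2) - l| < e).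
  by move=> q; have [l ? ?] := ultra_lim (fun i => (LP ((q.1, i), q.2)).1); exists l.
have wC : wl <= w (true, false) <= wh.
  have [l lb lP] := ultra_lim LC.
  by rewrite -(Ulim_eq _ _ _ _ (fun t => erefl) lP (wP (true, false)).2).
have /choice[a aP] : forall b : bool, exists l : R, lo b <= l <= hi b /\
    forall e : R, 0 < e -> U (fun i : nat => `|gi (b, i) - l| < e).
  move=> b; have [l ? ?] := ultra_lim (v := fun i => gi (b, i)) (c := lo b) (d := hi b) (fun i => (giP (b, i)).1).
  by exists l.
exists (w (true, true)), (w (false, false)), (w (true, false)), a; split.
- by split; [exact: (wP _).1 | exact: (wP _).1 | exact: (wP _).1 |].
- by move=> b; exact: (aP b).1.
move=> th Tth; apply/eqP; rewrite -subr_eq0 -normr_eq0 eq_le normr_ge0 andbT.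
(* The budget: [3 * eta] for each edge, [eta] for the error [1 / (t + 1)], and [2 * eta] for each
   vertex. *)
pose C : R := (size E)%:R * 3 + 1 + #|F|%:R * 2.
have C0 : 0 < C by rewrite /C ltr_wpDr ?mulr_ge0 // ltr_wpDl ?mulr_ge0.
apply/ler_addgt0Pl => /= e0 e00; rewrite addr0.
pose eta := e0 / C; have eta0 : 0 < eta by rewrite divr_gt0.
pose okpt (z : pt) := [/\ `|L (z, true) - w (z.1, true)| < eta,
   `|L (z, false) - w (z.1, false)| < eta & `|gi z - a z.1| < eta].
pose okpair (z y : pt) := `|Wi (z, y) - L (z, y.1)| < eta.
(* Points are chosen one after the other. Closeness to finitely many earlier points holds for almost
   all [j], because the limit in the second point was taken first. *)
have pick (zs : seq pt) b k : exists ys : seq nat,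
   [/\ size ys = k, uniq ys, forall y, y \in ys -> okpt (b, y),
       forall z y, z \in zs -> y \in ys -> okpair z (b, y) &
       pairwise (fun y y' => `[< okpair (b, y) (b, y') >]) ys].
  elim: k => [|k [ys [sy uy oy zy py]]]; first by exists [::].
  have near_new : U (fun j : nat => [/\ okpt (b, j), (forall z, z \in zs -> okpair z (b, j)),
      (forall z, z \in [seq (b, y) | y <- ys] -> okpair z (b, j)) & (\max_(y <- ys) y.+1 <= j)%N]).
    have Ul q : U (fun j : nat => okpair q (b, j)) by exact: (LP (q, b)).2.
    have H1 := @near_all U UF _ _ zs Ul; have H2 := @near_all U UF _ _ [seq (b, y) | y <- ys] Ul.
    have H3 := (wP (b, true)).2 _ eta0; have H4 := (wP (b, false)).2 _ eta0.
    have H5 := (aP b).2 _ eta0; have H6 := Uge (\max_(y <- ys) y.+1)%N.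
    apply: filterS (filterI (filterI (filterI H1 H2) (filterI H3 H4)) (filterI H5 H6)).
    by move=> j [[[h1 h2] [h3 h4]] [h5 h6]]; split.
  have [j [oj zj yj mj]] := filter_ex near_new.
  have jy y : y \in ys -> (y < j)%N.
    by move=> yy; apply: leq_trans mj; rewrite (big_rem y yy) /= leq_max leqnn.
  exists (rcons ys j); split.
  - by rewrite size_rcons sy.
  - by rewrite rcons_uniq uy andbT; apply/negP => /jy; rewrite ltnn.
  - by move=> y; rewrite mem_rcons inE => /orP[/eqP->|/oy].
  - by move=> z y zz; rewrite mem_rcons inE => /orP[/eqP->|yy]; [exact: zj | exact: zy].
  - rewrite pairwise_rcons py andbT; apply/allP => y yy; apply/asboolP; apply: yj.
    by apply: map_f.
(* The iterated limits of a mixed pair need not commute. All points of type [true] are chosen before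
   those of type [false], so that only [w (true, false)] occurs; the reverse order is reduced to it
   by the symmetry of [Wi]. *)
have [xs [sx ux ox _ px]] := pick [::] true #|F|.
have [ys [sy uy oy xy py]] := pick [seq (true, x) | x <- xs] false #|F|.
pose X (l : F) := nth 0%N xs (enum_rank l); pose Y (l : F) := nth 0%N ys (enum_rank l).
have Xin l : X l \in xs by rewrite mem_nth // sx.
have Yin l : Y l \in ys by rewrite mem_nth // sy.
pose iota l : pt := if th l then (true, X l) else (false, Y l).
have iota1 : (fun l => (iota l).1) = th by apply/funext => l; rewrite /iota; case: (th l).
have iotaI : injective iota.
  move=> l l'; rewrite /iota; case: (th l); case: (th l') => // -[] /eqP.
    by rewrite nth_uniq ?sx // => /eqP/val_inj/enum_rank_inj.
  by rewrite nth_uniq ?sy // => /eqP/val_inj/enum_rank_inj.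
pose ww i j := if th i then (if th j then w (true, true) else w (true, false))
               else (if th j then w (true, false) else w (false, false)).
have okE (z y : pt) (b : bool) : okpt z -> okpair z y -> y.1 = b -> `|Wi (z, y) - w (z.1, b)| < 2 * eta.
  move=> [k1 k2 _] k3 yb; rewrite /okpair yb in k3.
  have k4 : `|L (z, b) - w (z.1, b)| < eta by case: (b).
  have := ler_distD (L (z, b)) (Wi (z, y)) (w (z.1, b)) => /le_lt_trans; apply.
  by rewrite mulrDl mul1r; move: k3 k4; lra.
have pw (b : bool) (zs : seq nat) (Z : F -> nat) : size zs = #|F| ->
   (forall l, Z l = nth 0%N zs (enum_rank l)) ->
   (forall y, y \in zs -> okpt (b, y)) ->
   pairwise (fun y y' => `[< okpair (b, y) (b, y') >]) zs ->
   forall i j, i != j -> `|Wi ((b, Z i), (b, Z j)) - w (b, b)| < 2 * eta.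
  move=> sz ZE oz /(pairwiseP 0%N) pz i j ij.
  wlog lt : i j ij / (enum_rank i < enum_rank j)%N.
    move=> H; have : enum_rank i != enum_rank j by rewrite (inj_eq enum_rank_inj).
    rewrite -val_eqE /= neq_ltn => /orP[|] lt; first exact: H.
    by rewrite Wisym; apply: H => //; rewrite eq_sym.
  have zi : okpt (b, Z i) by apply: oz; rewrite ZE mem_nth // sz.
  apply: (okE (b, Z i) (b, Z j) b zi) => //.
  by rewrite !ZE; apply/asboolP; apply: pz => //; rewrite inE /= sz ltn_ord.
have crossP i j : `|Wi ((true, X i), (false, Y j)) - w (true, false)| < 2 * eta.
  apply: (okE (true, X i) (false, Y j) false (ox _ (Xin i))) => //.
  by apply: xy => //; apply: map_f.
have Wiota i j : i != j -> `|Wi (iota i, iota j) - ww i j| <= 2 * eta.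
  move=> ij; apply: ltW; rewrite /iota /ww; case: (th i); case: (th j).
  - exact: (pw true xs X).
  - exact: crossP.
  - by rewrite Wisym; exact: crossP.
  - exact: (pw false ys Y).
have giota l : `|gi (iota l) - a (th l)| <= eta.
  apply: ltW; rewrite /iota; case: (th l); first by have [] := ox _ (Xin l).
  by have [] := oy _ (Yin l).
have [t [tW tg ti te]] : exists t, [/\ forall i j, `|W t (iota i) (iota j) - Wi (iota i, iota j)| < eta,
    forall l, `|g t (iota l) - gi (iota l)| < eta, forall l, ((iota l).2 < t)%N & t.+1%:R^-1 < eta].
  have H1 := @near_all U UF _ _ (enum {: F * F})
    (fun q : F * F => (WiP (iota q.1, iota q.2)).2 _ eta0).
  have H2 := @near_all U UF _ _ (enum F) (fun l => (giP (iota l)).2 _ eta0).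
  have H3 := Uge (\max_l (iota l).2.+1)%N.
  have H4 : U (fun t : nat => t.+1%:R^-1 < eta).
    apply: filterS (Uge (Num.truncn (eta^-1)).+1) => t /= tt.
    rewrite invf_plt ?posrE ?ltr0n //; apply: lt_le_trans (truncnS_gt _) _.
    by rewrite ler_nat (leq_trans tt).
  have [t [[h1 h2] [h3 h4]]] := filter_ex (filterI (filterI H1 H2) (filterI H3 H4)).
  exists t; split => //.
  - by move=> i j; apply: (h1 (i, j)); rewrite mem_enum.
  - by move=> l; apply: h2; rewrite mem_enum.
  - by move=> l; apply: leq_trans h3; exact: (leq_bigmax (F := fun l => (iota l).2.+1)).
have Q := Weq iotaI _ ti; rewrite iota1 in Q; have {}Q := Q Tth.
have S : `|symavg ww - symavg (fun i j => W t (iota i) (iota j))| <= (size E)%:R * (3 * eta).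
  apply: symavg_close => // [i j|i j ij].
    by rewrite /ww; case: (th i); case: (th j); exact: (wP _).1.
  have h1 := Wiota i j ij; have h2 := ltW (tW i j).
  have := ler_distD (Wi (iota i, iota j)) (ww i j) (W t (iota i) (iota j)) => /le_trans; apply.
  by rewrite distrC in h1; rewrite distrC in h2; lra.
have G : `|\sum_l g t (iota l) - \sum_l a (th l)| <= #|F|%:R * (2 * eta).
  rewrite -sumrB; apply: le_trans (ler_norm_sum _ _ _) _.
  apply: (@le_trans _ _ (\sum_(l : F) 2 * eta)); last by rewrite sumr_const (mulr_natl (2 * eta)).
  apply: ler_sum => l _; have h1 := giota l; have h2 := ltW (tg l).
  have := ler_distD (gi (iota l)) (g t (iota l)) (a (th l)) => /le_trans; apply.
  by move: h1 h2; lra.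
rewrite -/(ww) in S *.
have -> : symavg ww - (P0 + \sum_l a (th l)) =
  (symavg ww - symavg (fun i j => W t (iota i) (iota j)))
  + (symavg (fun i j => W t (iota i) (iota j)) - P0 - \sum_l g t (iota l))
  + (\sum_l g t (iota l) - \sum_l a (th l)) by ring.
apply: le_trans (ler_normD _ _) _; apply: le_trans (lerD (ler_normD _ _) (lexx _)) _.
have -> : e0 = C * eta by rewrite /eta mulrC divfK // gt_eqF.
rewrite /C; move: S Q G te; set q := t.+1%:R^-1 => S Q G te; nra.
Qed.

End Arrays.

(** * The symmetrized counting form *)

Lemma card_perm_fact (F : finType) : #|{perm F}| = (#|F|)`!.
Proof.
transitivity #|perm_on [set: F]%SET|; last by rewrite card_perm cardsT.
by apply: eq_card => s; rewrite !inE; apply/esym/fintype.subsetP => x _; rewrite inE.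
Qed.

Section SymmetricKernel.
Variables (R : realType) (F V : finType) (E : seq (F * F)) (A : rel V) (P0 : R).
Hypothesis P01 : 0 <= P0 <= 1.

Definition homker (f : {ffun F -> V}) : R :=
  \prod_(e <- E) (A (f e.1) (f e.2))%:R - P0.

(** Averaging over the permutations of the slots makes the form symmetric, as the second differences
    require, and keeps the kernel bounded by 1. *)
Definition symker (f : {ffun F -> V}) : R :=
  ((#|F|)`!%:R)^-1 * \sum_(s : {perm F}) homker [ffun i => f (s i)].

Let m0 : 0 < ((#|F|)`!%:R : R). Proof. by rewrite ltr0n fact_gt0. Qed.

Lemma mform_homker_perm (s : {perm F}) (phi : F -> V -> R) :
  mform homker (fun i => phi (s i)) =
  \sum_(f : {ffun F -> V}) homker [ffun i => f (s i)] * \prod_i phi i (f i).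
Proof.
pose h (f : {ffun F -> V}) := [ffun i => f (s i)] : {ffun F -> V}.
have hI : injective h.
  move=> f f' /ffunP H; apply/ffunP => i; have := H ((s^-1)%g i).
  by rewrite !ffunE permKV.
rewrite /mform (reindex_inj hI) /=; apply: eq_bigr => f _; congr (_ * _).
rewrite [RHS](reindex_inj (@perm_inj _ s)) /=; apply: eq_bigr => i _.
by rewrite ffunE.
Qed.

Lemma mform_symker phi :
  mform symker phi = ((#|F|)`!%:R)^-1 * \sum_(s : {perm F}) mform homker (fun i => phi (s i)).
Proof.
under eq_bigr do rewrite mform_homker_perm.
rewrite exchange_big mulr_sumr; apply: eq_bigr => f _ /=.
by rewrite -mulr_suml /symker mulrA.
Qed.

Lemma symker_sym (t : {perm F}) phi : mform symker (fun i => phi (t i)) = mform symker phi.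
Proof.
rewrite !mform_symker; congr (_ * _); rewrite [RHS](reindex_inj (mulIg t)) /=.
by apply: eq_bigr => s _; apply: eq_mform => i x; rewrite permM.
Qed.

Lemma symker_le1 f : `|symker f| <= 1.
Proof.
rewrite normrM (ger0_norm (x := _^-1)) ?invr_ge0 ?(ltW m0) // ler_pdivrMl // mulr1.
apply: le_trans (ler_norm_sum _ _ _) _.
apply: (@le_trans _ _ (\sum_(s : {perm F}) 1)); last by rewrite sumr_const card_perm_fact.
apply: ler_sum => s _; rewrite /homker prod_bool_all ler_norml.
set b := all _ _; have b1 : b%:R <= 1 :> R by rewrite lern1 leq_b1.
by have := ler0n R b; move: P01; lra.
Qed.

Definition indic (X : F -> {set V}) : F -> V -> R := fun i x => (x \in X i)%:R.

Lemma prod_indic (X : F -> {set V}) (f : {ffun F -> V}) :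
  \prod_i indic X i (f i) = (inbox X f)%:R.
Proof.
rewrite /indic /inbox.
have -> : [forall i, f i \in X i] = all (fun i => f i \in X i) (index_enum F).
  apply/forallP/allP => [H i _|H i]; [exact: H | by apply: H; rewrite mem_index_enum].
exact: prod_bool_all.
Qed.

Lemma mform_homker_indic X : mform homker (indic X) = homsum R A E X - P0 * \prod_i #|X i|%:R.
Proof.
rewrite -sum_box1 mulr_sumr /homsum -sumrB [RHS]big_mkcond; apply: eq_bigr => f _.
by rewrite prod_indic mulr1; case: (inbox X f); rewrite ?mulr1 ?mulr0.
Qed.

(** For disjoint sets this is the deviation of the symmetrized count, so the hypothesis on balanced
    families bounds the form. *)
Lemma mform_symker_indic X : mform symker (indic X) =
  ((#|F|)`!%:R)^-1 * \sum_(s : {perm F}) homsum R A E (fun i => X (s i)) - P0 * \prod_i #|X i|%:R.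
Proof.
rewrite mform_symker.
rewrite (eq_bigr (fun s : {perm F} => homsum R A E (fun i => X (s i)) - P0 * \prod_i #|X i|%:R)).
  rewrite sumrB mulrBr sumr_const card_perm_fact -[in X in _ - X](mulr_natl (P0 * _)).
  by rewrite mulKf // gt_eqF.
move=> s _; rewrite -[LHS]/(mform homker (indic (fun i => X (s i)))) mform_homker_indic.
by rewrite [in RHS](reindex_inj (@perm_inj _ s)).
Qed.

(** The single-vertex function [g] before normalization. *)
Definition root_dev (i : F) (x : V) : R := mform symker (fupd (@ones R F V) i (fun y => (y == x)%:R)).

Lemma l1_ones i : l1 (@ones R F V i) = #|V|%:R.
Proof. by rewrite /l1 (eq_bigr (fun _ => 1)) ?sumr_const // => x _; rewrite normr1. Qed.

Lemma root_dev_le i x : `|root_dev i x| <= #|V|%:R ^+ #|F|.-1.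
Proof.
apply: le_trans (mform_le symker_le1 _) _.
rewrite (bigD1 i) //= {1}/fupd eqxx.
have -> : l1 (fun y => (y == x)%:R : R) = 1.
  rewrite /l1 (bigD1 x) //= eqxx normr1 big1 ?addr0 // => y /negPf ->.
  by rewrite normr0.
rewrite mul1r (eq_bigr (fun _ => #|V|%:R)); last first.
  by move=> j /negPf ji; rewrite /fupd ji l1_ones.
by rewrite prodr_const -(cardC1 i).
Qed.

Lemma mform_root i h : mform symker (fupd (@ones R F V) i h) = \sum_x h x * root_dev i x.
Proof. exact: mform_delta. Qed.

Lemma root_dev_sym i j x : root_dev i x = root_dev j x.
Proof. exact: (mform_ones_sym symker_sym). Qed.

Lemma sum_root_dev i : \sum_x root_dev i x = mform symker (@ones R F V).
Proof.
rewrite -(mform_fupd_id symker (@ones R F V) i) mform_root.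
by apply: eq_bigr => x _; rewrite mul1r.
Qed.

Definition avgdev (i : F) (S : {set V}) : R :=
  (\sum_(x in S) root_dev i x) / (#|S|%:R * #|V|%:R ^+ #|F|.-1).

End SymmetricKernel.

(** * The density equation for a regular family of sets *)

Section BlockEquation.
Variables (R : realType) (F V : finType) (E : seq (F * F)) (A : rel V) (P0 : R).
Hypothesis P01 : 0 <= P0 <= 1.
Hypothesis simpleE : simple_edges E.
Hypothesis F2 : (1 < #|F|)%N.
Let n : R := #|V|%:R.
Let m : R := #|F|%:R.

Local Notation ker := (symker E A P0).

Lemma simple_edges_loopless (e : F * F) : e \in E -> e.1 != e.2.
Proof.
elim: E simpleE => [//|f E' IH] /= /and4P[f12 _ _ s]; rewrite inE => /orP[/eqP->//|].
exact: IH.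
Qed.

Lemma diffbound_lin (B M : R) : diffbound F B M = B * diffbound F 1 M.
Proof. by rewrite /diffbound; ring. Qed.

(** The error of [mform_additive] is linear in the bound on the form; for the bound [B n^m],
    division by [n^m] leaves [B] times this constant. *)
Definition blockconst (M : R) : R := m ^+ 2 * diffbound F 1 M + m * m ^+ #|F|.

(** Additivity is applied to the indicators of the [X i] scaled by [n / #|X i|], which are densities
    bounded by [1 / c]. The counting lemma then turns the homomorphism sums into products of pair
    densities. *)
Lemma block_equation (B delta c : R) (X : F -> {set V}) (i0 : F) :
  0 < c -> c <= 1 -> (0 < #|V|)%N -> 0 <= delta ->
  (forall chi, fracpart chi -> `|mform ker chi| <= B * n ^+ #|F|) ->
  (forall i, c * n <= #|X i|%:R) ->
  (forall i j, i != j -> regpair A delta (dens R A (X i) (X j)) (X i) (X j)) ->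
  `|symavg E (fun i j => dens R A (X i) (X j)) - P0 - \sum_i avgdev E A P0 i0 (X i)|
    <= (size E)%:R * delta + B * blockconst c^-1.
Proof.
move=> c0 c1 V0 d0 BP Xc reg.
have n0 : 0 < n by rewrite ltr0n.
have X0 i : 0 < #|X i|%:R :> R by apply: lt_le_trans (Xc i); rewrite mulr_gt0.
have M1 : 1 <= c^-1 by rewrite invf_ge1.
pose a i x : R := n / #|X i|%:R * (x \in X i)%:R.
have aD i : density c^-1 (a i).
  split=> [x|].
    have q0 : 0 <= n / #|X i|%:R by rewrite divr_ge0 // ltW.
    rewrite /a mulr_ge0 //=; apply: (@le_trans _ _ (n / #|X i|%:R)).
      by rewrite ler_piMr // lern1 leq_b1.
    by rewrite ler_pdivrMr // ler_pdivlMl //.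
  rewrite /a -mulr_sumr -natr_sum -big_mkcond /= sum1_card divfK //.
  by rewrite gt_eqF.
have H := mform_additive (@symker_sym R F V E A P0) BP M1 F2 aD.
have np : 0 < n ^+ #|F| by rewrite exprn_gt0.
have Xp : 0 < \prod_i #|X i|%:R :> R by apply: prodr_gt0.
have Ea : mform ker a = n ^+ #|F| * (mform ker (indic R X) / \prod_i #|X i|%:R).
  rewrite /mform mulr_suml mulr_sumr; apply: eq_bigr => f _.
  rewrite /a big_split /= prodf_div prodr_const /indic; ring.
have Er i : mform ker (fupd (@ones R F V) i (a i)) = n ^+ #|F| * avgdev E A P0 i0 (X i).
  rewrite mform_root /avgdev.
  have -> : \sum_x a i x * root_dev E A P0 i x = n / #|X i|%:R * \sum_(x in X i) root_dev E A P0 i0 x.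
    rewrite mulr_sumr [RHS]big_mkcond; apply: eq_bigr => x _; rewrite /a (root_dev_sym E A P0 i i0).
    by case: (x \in X i); rewrite ?mulr1 // mulr0 mul0r.
  have -> : n ^+ #|F| = n * n ^+ #|F|.-1 by rewrite -exprS prednK // ltnW.
  rewrite -/n; field; rewrite !gt_eqF // exprn_gt0 //.
rewrite (eq_bigr _ (fun i _ => Er i)) -mulr_sumr Ea -mulrBr in H.
rewrite normrM gtr0_norm // in H.
have {}H : `|mform ker (indic R X) / \prod_i #|X i|%:R - \sum_i avgdev E A P0 i0 (X i)|
   <= B * blockconst c^-1.
  rewrite -(ler_pM2l np); apply: le_trans H _.
  rewrite le_eqVlt; apply/orP; left; apply/eqP.
  by rewrite diffbound_lin /blockconst -/m; ring.
rewrite mform_symker_indic mulrBl mulfK ?gt_eqF // -mulrA mulr_suml in H.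
have S : `|symavg E (fun i j => dens R A (X i) (X j)) -
   ((#|F|)`!%:R)^-1 * \sum_(s : {perm F}) homsum R A E (fun i => X (s i)) / \prod_i #|X i|%:R| <=
   (size E)%:R * delta.
  have m0 : 0 < ((#|F|)`!%:R : R) by rewrite ltr0n fact_gt0.
  rewrite /symavg -mulrBr normrM (ger0_norm (x := _^-1)) ?invr_ge0 ?(ltW m0) // ler_pdivrMl // -sumrB.
  apply: le_trans (ler_norm_sum _ _ _) _.
  apply: (@le_trans _ _ (\sum_(s : {perm F}) (size E)%:R * delta)); last first.
    by rewrite sumr_const card_perm_fact (mulr_natl (_ * delta)).
  apply: ler_sum => s _.
  have C := @counting_lemma R F V A delta (fun e => dens R A (X (s e.1)) (X (s e.2))) E (fun i => X (s i)) simpleE.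
  have {}C := C (fun e _ => dens01 R A _ _).
  have {}C : `|homsum R A E (fun i => X (s i)) - \prod_(e <- E) dens R A (X (s e.1)) (X (s e.2)) * \prod_i #|X i|%:R|
      <= (size E)%:R * delta * \prod_i #|X i|%:R.
    rewrite [\prod_i #|X i|%:R](reindex_inj (@perm_inj _ s)) /=; apply: C => e eE.
    by apply: reg; rewrite (inj_eq perm_inj) simple_edges_loopless.
  set D := \prod_(e <- E) _ in C *; set h := homsum _ _ _ _ in C *.
  set Pi := \prod_i _ in C Xp *.
  have -> : D - h / Pi = - ((h - D * Pi) / Pi) by field; rewrite gt_eqF.
  by rewrite normrN normrM normfV (gtr0_norm Xp) ler_pdivrMr.
set T1 := symavg _ _ in S *; set T2 := \sum_i avgdev _ _ _ _ _ in H *.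
set T3 := _^-1 * \sum_(s : {perm F}) _ in S H.
have -> : T1 - P0 - T2 = (T1 - T3) + (T3 - P0 - T2) by ring.
by apply: le_trans (ler_normD _ _) _; rewrite lerD.
Qed.

End BlockEquation.

Section SymavgValues.
Variables (R : realType) (F : finType) (E : seq (F * F)).
Hypothesis E_loopless : forall e, e \in E -> e.1 != e.2.

Let m0 : ((#|F|)`!%:R : R) != 0. Proof. by rewrite pnatr_eq0 -lt0n fact_gt0. Qed.

Lemma eq_symavg (w w' : F -> F -> R) : (forall i j, w i j = w' i j) -> symavg E w = symavg E w'.
Proof.
move=> ww; rewrite /symavg; congr (_ * _); apply: eq_bigr => s _.
by apply: eq_bigr => e _; rewrite ww.
Qed.

Lemma symavg_cst (u : R) : symavg E (fun _ _ => u) = u ^+ size E.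
Proof.
transitivity (((#|F|)`!%:R)^-1 * \sum_(s : {perm F}) u ^+ size E).
  congr (_ * _); apply: eq_bigr => s _.
  by rewrite big_const_seq count_predT iter_mulr mulr1.
by rewrite sumr_const card_perm_fact -[X in _ * X](mulr_natl (u ^+ _)) mulKf.
Qed.

(** After summation over [l] all permutations contribute equally: for [l = s x], the edges at [x]
    receive [w] and the others [v]. No edge receives [u], as there are no loops. *)
Lemma sum_symavg_single (u v w : R) :
  \sum_l symavg E (fun i j => if i == l then (if j == l then u else w)
                              else (if j == l then w else v)) =
  \sum_x w ^+ edeg E x * v ^+ (size E - edeg E x).
Proof.
rewrite /symavg -mulr_sumr exchange_big /=.
rewrite (eq_bigr (fun _ => \sum_x w ^+ edeg E x * v ^+ (size E - edeg E x))).
  by rewrite sumr_const card_perm_fact -[X in _ * X](mulr_natl (\sum_x _)) mulKf.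
move=> s _; rewrite (reindex_inj (@perm_inj _ s)) /=; apply: eq_bigr => x _.
under eq_bigr do rewrite !(inj_eq perm_inj).
have EL := E_loopless; elim: (E) EL => [|e E' IH] EL; first by rewrite big_nil /= mulr1.
have {}IH := IH (fun f fE => EL f (mem_behead (s := e :: E') fE)).
have ne := EL e (mem_head _ _).
rewrite big_cons IH /edeg /= -/(edeg E' x) /touches.
have le := edeg_le E' x.
case: (eqVneq e.1 x) => [e1|e1]; case: (eqVneq e.2 x) => [e2|e2] //=.
- by rewrite e1 e2 eqxx in ne.
- by rewrite add1n subSS exprS mulrA.
- by rewrite add1n subSS exprS mulrA.
- by rewrite add0n subSn // exprS; ring.
Qed.

End SymavgValues.

(** * Symmetric counts determine edge densities *)

Definition ev (P : nat -> Prop) : Prop := exists N, forall n, (N <= n)%N -> P n.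

Lemma ev_and (P Q : nat -> Prop) : ev P -> ev Q -> ev (fun n => P n /\ Q n).
Proof.
move=> [N NP] [M MQ]; exists (maxn N M) => n; rewrite geq_max => /andP[nN nM].
by split; [exact: NP | exact: MQ].
Qed.

Lemma ev_mono (P Q : nat -> Prop) : (forall n, P n -> Q n) -> ev P -> ev Q.
Proof. by move=> PQ [N NP]; exists N => n /NP /PQ. Qed.

Lemma not_ev (P : nat -> Prop) : ~ ev P -> forall N, exists2 n, (N <= n)%N & ~ P n.
Proof.
move=> nP N; apply: contrapT => H; apply: nP; exists N => n nN.
by apply: contrapT => nPn; apply: H; exists n.
Qed.

Section SymToCut.
Variables (R : realType) (F : finType) (E : seq (F * F)) (V : nat -> finType).
Variables (A : forall n, rel (V n)) (p : R).
Hypothesis simpleE : simple_edges E.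
Hypothesis E1 : (1 < size E)%N.
Hypothesis F2 : (1 < #|F|)%N.
Hypothesis p01 : 0 < p <= 1.
Hypothesis Asym : forall n, symmetric (@A n).
Hypothesis Vinf : forall N, ev (fun n => N <= #|V n|)%N.

Let P0 : R := p ^+ size E.
Let nn n : R := #|V n|%:R.
Let m : R := #|F|%:R.

Hypothesis HB : forall eps : R, 0 < eps -> ev (fun n => forall chi, fracpart chi ->
  `|mform (symker E (@A n) P0) chi| <= eps * nn n ^+ #|F|).

Variable i0 : F.

Let P01 : 0 <= P0 <= 1.
Proof. by have /andP[p0 p1] := p01; rewrite /P0 exprn_ge0 ?exprn_ile1 // ltW. Qed.

Let m0 : 0 < m. Proof. by rewrite /m ltr0n ltnW. Qed.

Definition gdev n (x : V n) : R := root_dev E (@A n) P0 i0 x / nn n ^+ #|F|.-1.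

Lemma gdev_le1 n (x : V n) : `|gdev x| <= 1.
Proof.
have V0 : 0 < nn n by rewrite ltr0n; apply/card_gt0P; exists x.
rewrite /gdev normrM normfV (ger0_norm (x := nn n ^+ _)) ?exprn_ge0 ?(ltW V0) //.
by rewrite ler_pdivrMr ?exprn_gt0 // mul1r root_dev_le.
Qed.

Lemma avgdevE n (S : {set V n}) : avgdev E (@A n) P0 i0 S = (\sum_(x in S) gdev x) / #|S|%:R.
Proof. by rewrite /avgdev /gdev -mulr_suml invfM; ring. Qed.

Lemma avgdev_in n (S : {set V n}) (lo hi : R) : (0 < #|S|)%N ->
  (forall x, x \in S -> lo <= gdev x <= hi) -> lo <= avgdev E (@A n) P0 i0 S <= hi.
Proof.
move=> S0 H; have S0' : 0 < #|S|%:R :> R by rewrite ltr0n.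
rewrite avgdevE ler_pdivlMr // ler_pdivrMr //; apply/andP; split.
  rewrite mulr_natr -sumr_const; apply: ler_sum => x xS; by case/andP: (H x xS).
rewrite mulr_natr -sumr_const; apply: ler_sum => x xS; by case/andP: (H x xS).
Qed.

Lemma block_ev (c eps : R) : 0 < c -> c <= 1 -> 0 < eps ->
  ev (fun n => (0 < #|V n|)%N /\ forall (delta : R) (X : F -> {set V n}), 0 <= delta ->
    (forall i, c * nn n <= #|X i|%:R) ->
    (forall i j, i != j -> regpair (@A n) delta (dens R (@A n) (X i) (X j)) (X i) (X j)) ->
    `|symavg E (fun i j => dens R (@A n) (X i) (X j)) - P0 - \sum_i avgdev E (@A n) P0 i0 (X i)|
      <= (size E)%:R * delta + eps).
Proof.
move=> c0 c1 e0; pose K : R := `|blockconst F c^-1| + 1.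
have K0 : 0 < K by rewrite ltr_wpDl.
have eK : 0 < eps / K by rewrite divr_gt0.
apply: ev_mono (ev_and (Vinf 1) (HB eK)) => n [V0 HBn]; split=> // delta X d0 Xc reg.
apply: le_trans (block_equation simpleE F2 i0 c0 c1 V0 d0 HBn Xc reg) _.
rewrite lerD2l mulrAC ler_pdivrMr // ler_pM2l //.
by apply: le_trans (ler_norm _) _; rewrite lerDl.
Qed.

Lemma mean_ev (eps : R) : 0 < eps -> ev (fun n => `|\sum_(x : V n) gdev x| <= eps * nn n).
Proof.
move=> e0; have eK : 0 < eps / m ^+ #|F| by rewrite divr_gt0 // exprn_gt0.
apply: ev_mono (ev_and (Vinf 1) (HB eK)) => n [V0 HBn].
have n0 : 0 < nn n by rewrite ltr0n.
have := mform_ones_le HBn F2.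
rewrite /gdev -mulr_suml (sum_root_dev E (@A n) P0 i0) normrM normfV.
rewrite (ger0_norm (x := nn n ^+ _)) ?exprn_ge0 ?(ltW n0) //.
rewrite ler_pdivrMr ?exprn_gt0 // => H; apply: le_trans H _.
rewrite le_eqVlt; apply/orP; left; apply/eqP.
have -> : nn n ^+ #|F| = nn n * nn n ^+ #|F|.-1 by rewrite -exprS prednK // ltnW.
have -> : #|F|%:R = m by [].
by field; rewrite expf_neq0 // gt_eqF.
Qed.

Lemma dens_sym n (S T : {set V n}) : dens R (@A n) S T = dens R (@A n) T S.
Proof.
rewrite /dens [#|S|%:R * _]mulrC; congr (_ / _); rewrite /ecount exchange_big /=.
by apply: eq_bigr => x _; apply: eq_bigr => y _; rewrite Asym.
Qed.

Lemma inv_pos (t : nat) : 0 < (t.+1%:R : R)^-1.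
Proof. by rewrite invr_gt0 ltr0n. Qed.

Local Notation pt := (bool * nat)%type.

(* Regular subsets of the two level sets give an array whose limit satisfies
   the hypotheses of [two_type_eq], hence [u = v], while the limits of [gdev]
   on the two types are separated by [2 * eta]. *)
Lemma no_two_levels (eta : R) : 0 < eta ->
  ~ (forall N, exists2 n, (N <= n)%N &
      eta * nn n <= #|[set x : V n | eta <= gdev x]%SET|%:R /\
      eta * nn n <= #|[set x : V n | gdev x <= - eta]%SET|%:R).
Proof.
move=> eta0 freq.
pose lo (b : bool) : R := if b then eta else -1.
pose hi (b : bool) : R := if b then 1 else - eta.
have data t : exists Wg : (pt -> pt -> R) * (pt -> R), [/\
    forall a b, 0 <= Wg.1 a b <= 1, forall a b, Wg.1 a b = Wg.1 b a,
    forall b i, lo b <= Wg.2 (b, i) <= hi b &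
    forall iota : F -> pt, injective iota -> (forall l, (iota l).2 < t)%N ->
      `|symavg E (fun i j => Wg.1 (iota i) (iota j)) - P0 - \sum_l Wg.2 (iota l)| <= t.+1%:R^-1].
  pose delta : R := t.+1%:R^-1 / (2 * (size E).+1%:R).
  have d0 : 0 < delta by rewrite divr_gt0 ?inv_pos // mulr_gt0 // ltr0n.
  have e0 : 0 < t.+1%:R^-1 / 2 :> R by rewrite divr_gt0 ?inv_pos.
  (* The [t + 1] copies of each level set are regularized together, with no bias in the energy. *)
  have [c0 c00 reg] := regularize (bool * 'I_t.+1)%type 0 d0.
  pose c := Num.min 1 (c0 * eta).
  have cp : 0 < c by rewrite lt_min ltr01 mulr_gt0.
  have c1 : c <= 1 by rewrite ge_min lexx.
  have [N HN] := block_ev cp c1 e0.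
  have [n nN [Bp Bm]] := freq N; have [V0 {}HN] := HN n nN.
  have n0 : 0 < nn n by rewrite ltr0n.
  pose B (q : bool * 'I_t.+1) : {set V n} :=
    if q.1 then [set x | eta <= gdev x]%SET else [set x | gdev x <= - eta]%SET.
  have Bn q : eta * nn n <= #|B q|%:R by rewrite /B; case: q.1.
  have B0 q : (0 < #|B q|)%N.
    by rewrite -(ltr0n R); apply: lt_le_trans (Bn q); rewrite mulr_gt0.
  have z1 (i j : bool * 'I_t.+1) : `|(fun _ _ => 0 : R) i j| <= 0 by rewrite normr0.
  have {z1}[Y [YB Yc _ Yreg]] := reg (V n) (@A n) (fun _ _ => 0) B z1 B0.
  have Yn q : c * nn n <= #|Y q|%:R.
    apply: le_trans (Yc q); apply: (@le_trans _ _ (c0 * (eta * nn n))); last by rewrite ler_pM2l.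
    by rewrite mulrA ler_pM2r // ge_min lexx orbT.
  have Y0 q : (0 < #|Y q|)%N.
    by rewrite -(ltr0n R); apply: lt_le_trans (Yn q); rewrite mulr_gt0.
  pose idx (a : pt) : bool * 'I_t.+1 := (a.1, inord a.2).
  exists (fun a b => dens R (@A n) (Y (idx a)) (Y (idx b)), fun a => avgdev E (@A n) P0 i0 (Y (idx a))).
  split=> /=.
  - by move=> a b; exact: dens01.
  - by move=> a b; exact: dens_sym.
  - move=> b i; apply: avgdev_in => // x xY.
    have xB := fintype.subsetP (YB (idx (b, i))) x xY.
    have := gdev_le1 x; rewrite ler_norml; move: xB; rewrite /B /=.
    by case: b {xY}; rewrite inE /lo /hi => h /andP[h1 h2]; apply/andP; split.
  - move=> iota iI it.
    apply: le_trans (HN delta (fun l => Y (idx (iota l))) (ltW d0) (fun l => Yn _) _) _.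
      move=> i j ij; apply: Yreg; apply: contra_neq ij; rewrite /idx => -[e1 e2].
      apply: iI; move: e1 (congr1 val e2) (it i) (it j); rewrite /= !inordK; last 2 first.
      - by rewrite (leq_trans (it j)).
      - by rewrite (leq_trans (it i)).
      by case: (iota i) (iota j) => [b1 n1] [b2 n2] /= -> ->.
    rewrite [leRHS]splitr lerD2r /delta mulrA ler_pdivrMr ?mulr_gt0 ?ltr0n //.
    rewrite mulrA divfK ?pnatr_eq0 // [leRHS]mulrC.
    by rewrite ler_pM2r ?inv_pos // ler_nat.
have /choice[Wg WgP] := data.
have [|||||u [v [w [a [[u01 v01 w01 _] ab EQ]]]]] := @array_limit R F E P0 (simple_edges_loopless simpleE)
   (fun t => (Wg t).1) (fun t => (Wg t).2) lo hi 0 1 _ _ _ _ (fun _ => True) _.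
- by move=> t x y; have [] := WgP t.
- by move=> t x y; have [] := WgP t.
- by move=> t b i; have [] := WgP t.
- by move=> t i j; have [] := WgP t.
- by move=> t iota iI _ it; have [_ _ _] := WgP t; apply.
(* Constant types express [a true] and [a false] through [u] and [v]. Summing the equations with one
   vertex of the other type over its position then yields the degree sums. *)
have Eu : u ^+ size E = P0 + m * a true.
  by have := EQ (fun _ => true) I; rewrite symavg_cst sumr_const mulr_natl.
have Ev : v ^+ size E = P0 + m * a false.
  by have := EQ (fun _ => false) I; rewrite symavg_cst sumr_const mulr_natl.
have sum1 (b : bool) (l0 : F) : \sum_l a (if l == l0 then b else ~~ b) = a b + (m - 1) * a (~~ b).
  rewrite (bigD1 l0) //= eqxx (eq_bigr (fun _ => a (~~ b))) => [|l /negPf -> //].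
  rewrite sumr_const -[X in _ + X](mulr_natl (a _)); congr (_ + _ * _).
  by rewrite (cardC1 l0) -subn1 natrB // ltnW.
have E12 : \sum_x w ^+ edeg E x * v ^+ (size E - edeg E x) = u ^+ size E + (m - 1) * v ^+ size E.
  rewrite -(sum_symavg_single (simple_edges_loopless simpleE) u).
  rewrite (eq_bigr (fun _ => P0 + (a true + (m - 1) * a false))); last first.
    move=> l0 _; have := EQ (fun l => if l == l0 then true else ~~ true) I; rewrite sum1 => <-.
    by apply: eq_symavg => i j; case: (i == l0); case: (j == l0).
  by rewrite sumr_const -[LHS](mulr_natl (P0 + _)) Eu Ev -/m; ring.
have E21 : \sum_x w ^+ edeg E x * u ^+ (size E - edeg E x) = v ^+ size E + (m - 1) * u ^+ size E.
  rewrite -(sum_symavg_single (simple_edges_loopless simpleE) v).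
  rewrite (eq_bigr (fun _ => P0 + (a false + (m - 1) * a true))); last first.
    move=> l0 _; have := EQ (fun l => if l == l0 then false else ~~ false) I; rewrite sum1 => <-.
    by apply: eq_symavg => i j; case: (i == l0); case: (j == l0).
  by rewrite sumr_const -[LHS](mulr_natl (P0 + _)) Eu Ev -/m; ring.
have uv : u = v.
  apply: (two_type_eq E1 (edeg_le E) (sum_edeg simpleE) (sum_edeg2 simpleE)) E12 E21.
  - by case/andP: u01.
  - by case/andP: v01.
  - by case/andP: w01.
have : m * a true = m * a false by move: Eu Ev; rewrite uv => -> /addrI.
move/(mulfI (lt0r_neq0 m0)) => aa.
have := ab true; have := ab false; rewrite /lo /hi aa; lra.
Qed.

(** For large [n] one of the two level sets is small, so [gdev] is nearly one-sided and its small
    mean controls its absolute sum. With [eta = zeta / 8] the total is at most [5 * eta]. *)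
Lemma dev_l1 (zeta : R) : 0 < zeta -> ev (fun n => \sum_(x : V n) `|gdev x| <= zeta * nn n).
Proof.
move=> z0; have z8 : 0 < zeta / 8 by rewrite divr_gt0.
pose eta := zeta / 8.
have H : ev (fun n => ~ (eta * nn n <= #|[set x : V n | eta <= gdev x]%SET|%:R /\
      eta * nn n <= #|[set x : V n | gdev x <= - eta]%SET|%:R)).
  apply: contrapT => nev; apply: (no_two_levels z8) => N.
  by have [n nN /contrapT] := not_ev nev N; exists n.
apply: ev_mono (ev_and H (mean_ev z8)) => n [nb mean].
have cardS (P : pred (V n)) : #|[set x | P x]%SET|%:R = \sum_x (P x)%:R :> R.
  by rewrite -sum1_card natr_sum big_mkcond; apply: eq_bigr => x _; rewrite inE; case: (P x).
have nS : nn n = \sum_(x : V n) 1 by rewrite sumr_const.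
have en0 : 0 <= eta * nn n by rewrite mulr_ge0 // ltW.
have [Hp|Hm] : #|[set x : V n | eta <= gdev x]%SET|%:R <= eta * nn n \/
    #|[set x : V n | gdev x <= - eta]%SET|%:R <= eta * nn n.
- have [h1|/ltW] := leP (eta * nn n) #|[set x : V n | eta <= gdev x]%SET|%:R; last by left.
  have [h2|/ltW] := leP (eta * nn n) #|[set x : V n | gdev x <= - eta]%SET|%:R; last by right.
  by case: nb.
- have : \sum_(x : V n) `|gdev x| <=
      2 * \sum_(x : V n) (eta <= gdev x)%R%:R + 2 * (eta * nn n) - \sum_(x : V n) gdev x.
    rewrite nS !mulr_sumr -big_split -sumrB /=; apply: ler_sum => x _.
    have := gdev_le1 x; have e0 : 0 < eta := z8; rewrite ler_norml => /andP[g1 g2].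
    by case: (leP eta (gdev x)) => h /=; case: (ger0P (gdev x)) => h'; lra.
  rewrite -cardS; move: mean Hp; rewrite ler_norml /eta; lra.
- have : \sum_(x : V n) `|gdev x| <=
      2 * \sum_(x : V n) (gdev x <= - eta)%R%:R + 2 * (eta * nn n) + \sum_(x : V n) gdev x.
    rewrite nS !mulr_sumr -!big_split /=; apply: ler_sum => x _.
    have := gdev_le1 x; have e0 : 0 < eta := z8; rewrite ler_norml => /andP[g1 g2].
    by case: (leP (gdev x) (- eta)) => h /=; case: (ger0P (gdev x)) => h'; lra.
  rewrite -cardS; move: mean Hm; rewrite ler_norml /eta; lra.
Qed.

Lemma avgdev_le n (S : {set V n}) (zeta c : R) : 0 < c -> (0 < #|V n|)%N ->
  \sum_(x : V n) `|gdev x| <= zeta * nn n -> c * nn n <= #|S|%:R ->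
  `|avgdev E (@A n) P0 i0 S| <= zeta / c.
Proof.
move=> c0 V0 l1g cS; have n0 : 0 < nn n by rewrite ltr0n.
have S0 : 0 < #|S|%:R :> R by apply: lt_le_trans cS; rewrite mulr_gt0.
rewrite avgdevE normrM normfV (gtr0_norm S0) ler_pdivrMr //.
apply: (@le_trans _ _ (zeta * nn n)).
  apply: le_trans l1g; apply: le_trans (ler_norm_sum _ _ _) _.
  by rewrite big_mkcond; apply: ler_sum => x _; case: ifP.
have z0 : 0 <= zeta.
  by rewrite -(pmulr_lge0 _ n0); apply: le_trans l1g; apply: sumr_ge0.
by rewrite mulrAC ler_pdivlMr // -mulrA [_ * c]mulrC ler_wpM2l.
Qed.

(* One point of type [true], taken inside [S], against points of type [false]
   inside [T] leads to the hypothesis of [one_type_eq]. *)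
Lemma no_biased_pair (sg eps0 wl wh : R) : `|sg| = 1 -> 0 < eps0 ->
  (forall d, 0 <= d <= 1 -> eps0 / 4 <= sg * (d - p) -> wl <= d <= wh) ->
  ~ (wl <= p <= wh) ->
  ~ (forall N, exists2 n, (N <= n)%N & exists S T : {set V n},
       eps0 * nn n ^+ 2 < sg * (ecount R (@A n) S T - p * #|S|%:R * #|T|%:R)).
Proof.
move=> sg1 e00 wlh np freq.
have sgle (x : R) : `|x| <= 1 -> sg * x <= 1.
  by move=> x1; apply: le_trans (ler_norm _) _; rewrite normrM sg1 mul1r.
(* Only one regular subset of [S] is produced, so at most one vertex may be of type [true]. *)
pose Th (th : F -> bool) := forall l l', th l -> th l' -> l = l'.
have data t : exists W : pt -> pt -> R, [/\
    forall a b, 0 <= W a b <= 1, forall a b, W a b = W b a,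
    forall i j, wl <= W (true, i) (false, j) <= wh &
    forall iota : F -> pt, injective iota -> Th (fun l => (iota l).1) -> (forall l, (iota l).2 < t)%N ->
      `|symavg E (fun i j => W (iota i) (iota j)) - P0 - \sum_(l : F) 0| <= t.+1%:R^-1].
  pose q : R := t.+1%:R^-1; have q0 : 0 < q := inv_pos t.
  pose delta : R := q / (3 * (size E).+1%:R).
  have d0 : 0 < delta by rewrite divr_gt0 // mulr_gt0 // ltr0n.
  have e0 : 0 < q / 3 by rewrite divr_gt0.
  (* Enough copies of [T] for more than [t] of them to keep a quarter of the bias [eps0]. *)
  pose N1 := (Num.truncn (4 * t.+1%:R / eps0)).+1.
  have N1P : 4 * t.+1%:R / eps0 < N1%:R by exact: truncnS_gt.
  pose IN : R := N1.+1%:R ^+ 2; have IN0 : 0 < IN by rewrite exprn_gt0 // ltr0n.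
  (* With this weight, a change of at most [IN] in the quadratic part of the energy costs at most
     [eps0 / 4] of the total bias. *)
  pose Kc : R := 2 * IN / eps0.
  have Kc0 : 0 < Kc by rewrite divr_gt0 // mulr_gt0.
  have [c0 c00 reg] := regularize 'I_N1.+1 Kc d0.
  pose c := Num.min 1 (c0 * eps0).
  have cp : 0 < c by rewrite lt_min ltr01 mulr_gt0.
  have c1 : c <= 1 by rewrite ge_min lexx.
  pose zeta : R := c * (q / 3 / m).
  have z0 : 0 < zeta by rewrite mulr_gt0 // divr_gt0.
  have [N HN] := ev_and (block_ev cp c1 e0) (dev_l1 z0).
  have [n nN [S [T ST]]] := freq N; have [[V0 {}HN] l1g] := HN n nN.
  have n0 : 0 < nn n by rewrite ltr0n.
  have Sn : #|S|%:R <= nn n by rewrite ler_nat max_card.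
  have Tn : #|T|%:R <= nn n by rewrite ler_nat max_card.
  pose D := dens R (@A n) S T.
  have /andP[D0 D1] := dens01 R (@A n) S T.
  have p_in : 0 <= p <= 1 by have /andP[? ?] := p01; rewrite ltW.
  have {}ST : eps0 * nn n ^+ 2 < sg * (D - p) * (#|S|%:R * #|T|%:R).
    by apply: lt_le_trans ST _; rewrite -densK -/D; rewrite le_eqVlt; apply/orP; left; apply/eqP; ring.
  have sgD : sg * (D - p) <= 1 by apply: sgle; rewrite ler_norml; move: p_in; rewrite /D; lra.
  have STn : #|S|%:R * #|T|%:R <= nn n ^+ 2 by rewrite expr2 ler_pM.
  have ST0 : 0 < #|S|%:R * #|T|%:R :> R.
    rewrite lt_neqAle mulr_ge0 // andbT eq_sym; apply/eqP => Z; move: ST; rewrite Z mulr0.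
    by apply/negP; rewrite -leNgt mulr_ge0 ?sqr_ge0 // ltW.
  have eST : eps0 * nn n ^+ 2 < #|S|%:R * #|T|%:R.
    by apply: lt_le_trans ST _; rewrite ler_piMl // ltW.
  have Dp : eps0 <= sg * (D - p).
    have : eps0 * (#|S|%:R * #|T|%:R) <= sg * (D - p) * (#|S|%:R * #|T|%:R).
      by apply: le_trans (ltW ST); rewrite ler_pM2l.
    by rewrite ler_pM2r.
  have Se : eps0 * nn n <= #|S|%:R.
    rewrite -(ler_pM2r n0) -mulrA -expr2; apply: le_trans (ltW eST) _.
    by rewrite ler_wpM2l.
  have Te : eps0 * nn n <= #|T|%:R.
    rewrite -(ler_pM2r n0) -mulrA -expr2; apply: le_trans (ltW eST) _.
    by rewrite mulrC ler_wpM2l.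
  pose B (i : 'I_N1.+1) : {set V n} := if i == ord0 then S else T.
  have Bn i : eps0 * nn n <= #|B i|%:R by rewrite /B; case: ifP.
  have B0 i : (0 < #|B i|)%N.
    by rewrite -(ltr0n R); apply: lt_le_trans (Bn i); rewrite mulr_gt0.
  pose cc (i j : 'I_N1.+1) : R := if (i == ord0) && (j != ord0) then sg * Kc else 0.
  have ccK i j : `|cc i j| <= Kc.
    rewrite /cc; case: ifP => _; last by rewrite normr0 ltW.
    by rewrite normrM sg1 mul1r gtr0_norm.
  have {ccK}[Y [YB Yc Yen Yreg]] := reg (V n) (@A n) cc B ccK B0.
  have Yn i : c * nn n <= #|Y i|%:R.
    apply: le_trans (Yc i); apply: (@le_trans _ _ (c0 * (eps0 * nn n))); last by rewrite ler_pM2l.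
    by rewrite mulrA ler_pM2r // ge_min lexx orbT.
  pose d j := dens R (@A n) (Y ord0) (Y j).
  (* The energy does not decrease and each squared density grows by at most 1, so the linear terms
     cannot drop by more than the number of pairs. *)
  have lin : - IN <= \sum_(j | j != ord0) 2 * (sg * Kc) * (d j - D).
    have H : energy (@A n) cc Y - energy (@A n) cc B <=
       \sum_(r : 'I_N1.+1 * 'I_N1.+1) 1 + \sum_(j | j != ord0) 2 * (sg * Kc) * (d j - D).
      have -> : \sum_(j | j != ord0) 2 * (sg * Kc) * (d j - D) =
        \sum_(r : 'I_N1.+1 * 'I_N1.+1) (if r.1 != r.2 then
            2 * cc r.1 r.2 * (dens R (@A n) (Y r.1) (Y r.2) - dens R (@A n) (B r.1) (B r.2)) else 0).
        rewrite -(pair_bigA _ (fun i j => if i != j then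
          2 * cc i j * (dens R (@A n) (Y i) (Y j) - dens R (@A n) (B i) (B j)) else 0)) /=.
        rewrite [RHS](bigD1 ord0) //= [X in _ = _ + X]big1 ?addr0; last first.
          move=> i i_0; rewrite big1 // => j _; rewrite /cc (negPf i_0) /=.
          by rewrite mulr0 mul0r; case: ifP.
        rewrite big_mkcond; apply: eq_bigr => j _; rewrite [ord0 == j]eq_sym.
        by case: eqP => // /eqP j0; rewrite /cc eqxx /= j0 /B eqxx (negPf j0).
      rewrite /energy ![\sum_(r | r.1 != r.2) _]big_mkcond -sumrB -big_split /=; apply: ler_sum => r _.
      case: ifP => _; last by rewrite subrr addr0.
      have /andP[y0 y1] := dens01 R (@A n) (Y r.1) (Y r.2).
      have /andP[b0 b1] := dens01 R (@A n) (B r.1) (B r.2).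
      set y := dens _ _ (Y _) _ in y0 y1 *; set b := dens _ _ (B _) _ in b0 b1 *.
      have y2 : y ^+ 2 <= 1 by rewrite expr_le1.
      have b2 : 0 <= b ^+ 2 by rewrite sqr_ge0.
      by nra.
    move: H Yen; rewrite sumr_const card_prod card_ord -/IN natrM -expr2 -/IN; lra.
  have lin2 : - (eps0 / 4) <= \sum_(j | j != ord0) sg * (d j - D).
    have K2 : 0 < 2 * Kc by rewrite mulr_gt0.
    rewrite -(ler_pM2l K2) mulr_sumr.
    have -> : 2 * Kc * - (eps0 / 4) = - IN by rewrite /Kc; field; rewrite gt_eqF.
    rewrite (eq_bigr (fun j => 2 * (sg * Kc) * (d j - D))) // => j _; ring.
  have cardN1 : #|[pred j : 'I_N1.+1 | j != ord0]|%:R = N1%:R :> R.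
    by rewrite (cardC1 ord0) card_ord.
  pose J := [set j : 'I_N1.+1 | (j != ord0) && (eps0 / 4 <= sg * (d j - p))]%SET.
  (* The biases sum to at least [N1 * eps0 - eps0 / 4], while a term in [J] is at most 1 and every
     other term is below [eps0 / 4]. *)
  have cardJ : (t < #|J|)%N.
    rewrite -(ltr_nat R) -(ltr_pM2l (x := 1)) // !mul1r.
    have up : \sum_(j | j != ord0) sg * (d j - p) <= #|J|%:R + N1%:R * (eps0 / 4).
      have -> : N1%:R * (eps0 / 4) = \sum_(j : 'I_N1.+1 | j != ord0) (eps0 / 4).
        by rewrite sumr_const -[RHS](mulr_natl (eps0 / 4)) cardN1.
      have -> : #|J|%:R = \sum_(j : 'I_N1.+1 | j != ord0) (eps0 / 4 <= sg * (d j - p))%R%:R :> R.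
        rewrite -sum1_card natr_sum big_mkcond [RHS]big_mkcond; apply: eq_bigr => j _.
        by rewrite inE; case: (j != ord0) => //=; case: (_ <= _).
      rewrite -big_split /=; apply: ler_sum => j _.
      have dj1 : sg * (d j - p) <= 1.
        apply: sgle; rewrite ler_norml; have := dens01 R (@A n) (Y ord0) (Y j).
        by move: p_in; rewrite -/(d j); lra.
      by case: (leP (eps0 / 4) (sg * (d j - p))) => h /=; lra.
    have Ed : \sum_(j | j != ord0) sg * (d j - p) =
       \sum_(j | j != ord0) sg * (d j - D) + N1%:R * (sg * (D - p)).
      rewrite -cardN1 mulr_natl -sumr_const -big_split /=; apply: eq_bigr => j _; ring.
    have N1e : N1%:R * eps0 <= N1%:R * (sg * (D - p)) by rewrite ler_wpM2l.
    have N11 : eps0 <= N1%:R * eps0 by rewrite ler_peMl ?(ltW e00) // ler1n.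
    rewrite ltr_pdivrMr // in N1P.
    have tt : t%:R <= t.+1%:R :> R by rewrite ler_nat.
    have t0 : 0 <= t%:R :> R by [].
    move: lin2 up N1e N11 N1P tt t0; rewrite Ed [N1%:R * (eps0 / 4)]mulrA.
    set a1 := t.+1%:R; set a2 := t%:R; set a3 := #|J|%:R; set a4 := N1%:R * eps0.
    set a5 := \sum_(j | _) _; set a6 := N1%:R * _; lra.
  have /card_gt0P[j0 j0J] : (0 < #|J|)%N by apply: leq_ltn_trans cardJ.
  (* The default [j0] lies in [J], so every value of [s] does; [s] is injective on indices below
     [t]. *)
  pose s k := nth j0 (enum J) k.
  have sJ k : s k \in J.
    rewrite /s; case: (ltnP k (size (enum J))) => h; last by rewrite nth_default.
    by rewrite -(mem_enum J) mem_nth.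
  have s_neq k : s k != ord0 by have := sJ k; rewrite inE => /andP[].
  pose idx (a : pt) := if a.1 then ord0 else s a.2.
  exists (fun a b => dens R (@A n) (Y (idx a)) (Y (idx b))); split.
  - by move=> a b; exact: dens01.
  - by move=> a b; exact: dens_sym.
  - move=> i j; apply: wlh; first exact: dens01.
    by have := sJ j; rewrite inE => /andP[].
  - move=> iota iI Thi it; rewrite big1 // subr0.
    have regX i j : i != j -> regpair (@A n) delta (dens R (@A n) (Y (idx (iota i))) (Y (idx (iota j))))
        (Y (idx (iota i))) (Y (idx (iota j))).
      move=> ij; apply: Yreg; rewrite /idx.
      case Ei: (iota i).1; case Ej: (iota j).1 => //.
      - by rewrite (Thi i j Ei Ej) eqxx in ij.
      - by rewrite eq_sym.
      rewrite nth_uniq ?enum_uniq // -?cardE; last 2 first.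
      - exact: ltn_trans (it i) cardJ.
      - exact: ltn_trans (it j) cardJ.
      apply: contra_neq ij => e2; apply: iI.
      by move: Ei Ej e2; case: (iota i) (iota j) => [b1 k1] [b2 k2] /= -> -> ->.
    have H := HN delta (fun l => Y (idx (iota l))) (ltW d0) (fun l => Yn _) regX.
    have av : `|\sum_l avgdev E (@A n) P0 i0 (Y (idx (iota l)))| <= q / 3.
      apply: le_trans (ler_norm_sum _ _ _) _.
      apply: (@le_trans _ _ (\sum_(l : F) zeta / c)).
        by apply: ler_sum => l _; apply: avgdev_le.
      rewrite sumr_const -[leLHS](mulr_natl (zeta / c)) -/m /zeta le_eqVlt.
      by apply/orP; left; apply/eqP; field; rewrite !gt_eqF.
    have dl : (size E)%:R * delta <= q / 3.
      rewrite /delta mulrA ler_pdivrMr ?mulr_gt0 ?ltr0n // [_ * q]mulrC mulrA divfK ?pnatr_eq0 //.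
      by rewrite ler_pM2l // ler_nat.
    rewrite -/q; set T1 := symavg _ _ in H *; set T2 := \sum_l _ in H av.
    have -> : T1 - P0 = (T1 - P0 - T2) + T2 by ring.
    by apply: le_trans (ler_normD _ _) _; move: H av dl; lra.
have /choice[W WP] := data.
have [|||||u [v [w [a [[u01 v01 w01 wC] ab EQ]]]]] := @array_limit R F E P0 (simple_edges_loopless simpleE)
   W (fun _ _ => 0) (fun _ => 0) (fun _ => 0) wl wh _ _ _ _ Th _.
- by move=> t x y; have [] := WP t.
- by move=> t x y; have [] := WP t.
- by move=> t b i; rewrite lexx.
- by move=> t i j; have [] := WP t.
- by move=> t iota iI thi it; have [_ _ _] := WP t; apply.
have a0 b : a b = 0 by apply/eqP; rewrite eq_le andbC; exact: ab.
have /andP[p0 p1] := p01.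
have Ev : v = p.
  have : v ^+ size E = p ^+ size E.
    have := EQ (fun _ => false) (fun _ _ (h : false) => False_rect _ (notF h)).
    by rewrite symavg_cst big1 ?addr0.
  by move/eqP; rewrite eqrXn2 ?(ltW p0) ?(ltnW E1) //; [move/eqP | case/andP: v01].
have Ew : w = p.
  apply: (one_type_eq E1 (edeg_le E) (sum_edeg simpleE) (sum_edeg2 simpleE) p0); first by case/andP: w01.
  rewrite -(sum_symavg_single (simple_edges_loopless simpleE) u).
  rewrite (eq_bigr (fun _ => P0)); last first.
    move=> l0 _; have th0 : Th (fun l => l == l0) by move=> l l' /eqP -> /eqP ->.
    have := EQ _ th0; rewrite [X in _ + X]big1 ?addr0 // => <-.
    by apply: eq_symavg => i j; rewrite Ev.
  by rewrite sumr_const -[LHS](mulr_natl P0).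
by apply: np; rewrite -Ew.
Qed.

(** A failure has the same sign for arbitrarily large [n]. The limit density [w] then lies in a
    closed interval at distance [eps / 4] from [p]. *)
Lemma cut_ev (eps : R) : 0 < eps -> ev (fun n => forall S T : {set V n},
  `|ecount R (@A n) S T - p * #|S|%:R * #|T|%:R| <= eps * nn n ^+ 2).
Proof.
move=> e0; apply: contrapT => /not_ev freq.
pose bad (sg : R) n := exists S T : {set V n},
   eps * nn n ^+ 2 < sg * (ecount R (@A n) S T - p * #|S|%:R * #|T|%:R).
have Hp : ~ (forall N, exists2 n, (N <= n)%N & bad 1 n).
  apply: (@no_biased_pair 1 eps (p + eps / 4) 1) => //; first by rewrite normr1.
    by move=> d d01; rewrite mul1r; lra.
  by move=> /andP[h _]; lra.
have Hm : ~ (forall N, exists2 n, (N <= n)%N & bad (-1) n).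
  apply: (@no_biased_pair (-1) eps 0 (p - eps / 4)) => //; first by rewrite normrN normr1.
    by move=> d d01 h; lra.
  by move=> /andP[_ h]; lra.
apply: Hp => N; apply: contrapT => nN; apply: Hm => M.
have [n nM nbad] := freq (maxn N M).
rewrite geq_max in nM; have /andP[n1 n2] := nM.
exists n => //; apply: contrapT => nb; apply: nbad => S T.
rewrite ler_norml; apply/andP; split; rewrite leNgt; apply/negP => h.
  by apply: nb; exists S, T; lra.
by apply: nN; exists n => //; exists S, T; rewrite mul1r.
Qed.

End SymToCut.

(** * Quasi-randomness and edge densities *)

(** In this form invariance under reordering is evident; [quasi_random_signed] uses it to move an
    edge along the list. *)
Lemma simple_edgesE (I : finType) (E : seq (I * I)) :
  simple_edges E = all (fun e => e.1 != e.2) E && uniq [seq [set e.1; e.2]%SET | e <- E].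
Proof.
elim: E => [//|e E IH] /=; rewrite IH; case: (eqVneq e.1 e.2) => //= ne.
suff K : (e \notin E) && ((e.2, e.1) \notin E) = ([set e.1; e.2]%SET \notin [seq [set x.1; x.2]%SET | x <- E]).
  by rewrite -K; do ![case: (_ \notin _) => //=]; rewrite ?andbF.
apply/idP/idP => [/andP[n1 n2]|n].
  apply/mapP => -[[a b] fE /setP H].
  have H1 := H e.1; have H2 := H e.2; move: H1 H2; rewrite !inE !eqxx /= orbT.
  move=> /esym/orP[/eqP Ea|/eqP Eb] /esym/orP[/eqP Ea'|/eqP Eb'].
  - by rewrite Ea Ea' eqxx in ne.
  - by rewrite (surjective_pairing e) Ea Eb' fE in n1.
  - by rewrite Eb Ea' fE in n2.
  - by rewrite Eb Eb' eqxx in ne.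
apply/andP; split; apply: contra n => h; apply/mapP; first by exists e.
by exists (e.2, e.1) => //=; rewrite finset.setUC.
Qed.

Lemma simple_edges_perm (I : finType) (E E' : seq (I * I)) : perm_eq E E' ->
  simple_edges E = simple_edges E'.
Proof.
by move=> p; rewrite !simple_edgesE (perm_all _ p) (perm_uniq (perm_map _ p)).
Qed.

Section ListGraph.
Variables (I : finType) (L : seq (I * I)).
Hypothesis sL : simple_edges L.

Definition list_adj : rel I := fun x y => ((x, y) \in L) || ((y, x) \in L).

Lemma list_adj_sym : symmetric list_adj.
Proof. by move=> x y; rewrite /list_adj orbC. Qed.

Lemma list_adj_irrefl : irreflexive list_adj.
Proof.
move=> x; rewrite /list_adj orbb; apply/negP => xL.
by have := simple_edges_loopless sL xL; rewrite eqxx.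
Qed.

(** Quasi-randomness speaks of graphs, whereas the expansion of the signed four-cycle count produces
    edge lists. *)
Definition list_graph : sgraph := SGraph list_adj_sym list_adj_irrefl.

Lemma nedges_list_graph : nedges list_graph = size L.
Proof.
move: (sL); rewrite simple_edgesE => /andP[_ u].
rewrite /nedges -(size_map (fun e : I * I => [set e.1; e.2]%SET)) -(card_uniqP u).
apply: eq_card => s; apply/imsetP/mapP => [[[x y]]|[e eL ->]].
  rewrite inE /= => /orP[h|h] ->; first by exists (x, y).
  by exists (y, x) => //=; rewrite finset.setUC.
by exists e => //; rewrite inE /= /list_adj -surjective_pairing eL.
Qed.

Lemma all_list_graph (P : rel I) : symmetric P ->
  [forall x, forall y, @adj list_graph x y ==> P x y] = all (fun e => P e.1 e.2) L.
Proof.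
move=> Ps; apply/forallP/allP => [H e eL|H x].
  have /forallP/(_ e.2)/implyP := H e.1; apply.
  by rewrite /= /list_adj -surjective_pairing eL.
apply/forallP => y; apply/implyP => /orP[h|h]; first exact: (H (x, y)).
by rewrite Ps; exact: (H (y, x)).
Qed.

End ListGraph.

(** * Non-injective maps, disjoint families and four-cycles *)

Section HomCounts.
Variable R : realType.

(** For each pair [i != j], resampling the coordinate [i] shows that a fraction [1 / n] of all maps
    satisfies [f i = f j]. *)
Lemma sum_noninj (F V : finType) : (0 < #|V|)%N ->
  \sum_(f : {ffun F -> V}) (~~ injectiveb f)%:R <= #|F|%:R ^+ 2 * #|V|%:R ^+ #|F| / #|V|%:R :> R.
Proof.
move=> V0; have n0 : 0 < #|V|%:R :> R by rewrite ltr0n.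
have inT (f : {ffun F -> V}) : inbox (fun _ => [set: V]%SET) f by apply/forallP => i; rewrite inE.
have total : \sum_(f : {ffun F -> V}) 1 = #|V|%:R ^+ #|F| :> R.
  have := sum_box1 R (fun _ : F => [set: V]%SET); rewrite prodr_const cardsT => <-.
  by apply: eq_bigl => f; rewrite inT.
have pairE (i j : F) : i != j ->
    \sum_(f : {ffun F -> V}) (f i == f j)%:R = #|V|%:R ^+ #|F| / #|V|%:R :> R.
  move=> ij; apply: (mulfI (lt0r_neq0 n0)); rewrite mulrCA divff ?lt0r_neq0 // mulr1.
  have := sum_resample (fun _ : F => [set: V]%SET) i (fun f => (f i == f j)%:R : R).
  rewrite cardsT [in RHS](eq_bigl predT) // => <-; rewrite -total.
  rewrite (eq_bigl predT) //; apply: eq_bigr => f _.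
  rewrite (bigD1 (f j)) ?inE //= !ffunE eqxx [j == i]eq_sym (negPf ij) eqxx big1 ?addr0 //.
  by move=> x /andP[_ /negPf xj]; rewrite !ffunE eqxx [j == i]eq_sym (negPf ij) xj.
apply: (@le_trans _ _ (\sum_(f : {ffun F -> V}) \sum_(q : F * F | q.1 != q.2) (f q.1 == f q.2)%:R)).
  apply: ler_sum => f _; case: (boolP (injectiveb f)) => [_|]; first exact: sumr_ge0.
  rewrite /injectiveb /dinjectiveb => /negP nI /=.
  have [i [j [ij fij]]] : exists i j, i != j /\ f i = f j.
    apply: contrapT => H; apply: nI; apply/injectiveP => i j fij; apply/eqP.
    by apply: contrapT => /negP ij; apply: H; exists i, j.
  rewrite (bigD1 (i, j)) //= fij eqxx lerDl; exact: sumr_ge0.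
rewrite exchange_big /= (eq_bigr (fun _ => #|V|%:R ^+ #|F| / #|V|%:R)); last by move=> q; exact: pairE.
rewrite sumr_const -[leLHS](mulr_natl (_ / _)) -[leRHS]mulrA ler_wpM2r //.
by rewrite -natrX ler_nat (leq_trans (max_card _)) // card_prod mulnn.
Qed.

Lemma card_sum (T : finType) (P : pred T) : #|[set x | P x]%SET|%:R = \sum_x (P x)%:R :> R.
Proof.
by rewrite -sum1_card natr_sum big_mkcond; apply: eq_bigr => x _; rewrite inE; case: (P x).
Qed.

Lemma hom_count_close (F G : sgraph) (L : seq (F * F)) : (0 < nverts G)%N ->
  (forall P : rel F, symmetric P ->
     [forall x, forall y, adj x y ==> P x y] = all (fun e => P e.1 e.2) L) ->
  `|(hom_count F G)%:R - homsum R (@adj G) L (fun _ => [set: G]%SET)| <=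
   #|F|%:R ^+ 2 * (nverts G)%:R ^+ nverts F / (nverts G)%:R.
Proof.
move=> V0 LP; apply: le_trans (sum_noninj F V0).
rewrite /hom_count card_sum /homsum.
have inT (f : {ffun F -> G}) : inbox (fun _ => [set: G]%SET) f by apply/forallP => i; rewrite inE.
rewrite [X in _ - X](eq_bigl predT) // -sumrB; apply: le_trans (ler_norm_sum _ _ _) _.
apply: ler_sum => f _; rewrite prod_bool_all /inj_hom.
have -> : [forall x, forall y, adj x y ==> adj (f x) (f y)] = all (fun e => adj (f e.1) (f e.2)) L.
  by rewrite -(LP (fun x y => adj (f x) (f y))) // => x y; rewrite adj_sym.
by case: (injectiveb f); case: (all _ _); rewrite /= ?subrr ?normr0 // ?sub0r ?normrN ?normr1.
Qed.

Lemma hom_count_in_disjoint (F G : sgraph) (U : F -> {set G}) :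
  (forall i j : F, i != j -> [disjoint U i & U j]) ->
  (hom_count_in U)%:R = homsum R (@adj G) (elist F) U.
Proof.
move=> dis; rewrite /hom_count_in card_sum /homsum [RHS]big_mkcond; apply: eq_bigr => f _.
rewrite prod_bool_all (@all_elist F (fun x y => adj (f x) (f y))); last by move=> x y; rewrite adj_sym.
rewrite /inj_hom andbC -/(inbox U f); case: (boolP (inbox U f)) => //= /forallP fU.
have -> // : injectiveb f.
apply/injectiveP => i j fij; apply/eqP; apply: contraT => ij.
by have /pred0P/(_ (f i)) := dis i j ij; rewrite /= fU fij fU.
Qed.

Lemma cauchy_sum (I : finType) (a : I -> R) : (\sum_i a i) ^+ 2 <= #|I|%:R * \sum_i a i ^+ 2.
Proof.
have : 0 <= \sum_i \sum_j (a i - a j) ^+ 2 by apply: sumr_ge0 => i _; apply: sumr_ge0 => j _; rewrite sqr_ge0.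
have -> : \sum_i \sum_j (a i - a j) ^+ 2 = 2 * (#|I|%:R * \sum_i a i ^+ 2 - (\sum_i a i) ^+ 2).
  have -> : (\sum_i a i) ^+ 2 = \sum_i \sum_j a i * a j.
    by rewrite expr2 mulr_suml; apply: eq_bigr => i _; rewrite mulr_sumr.
  have -> : #|I|%:R * \sum_i a i ^+ 2 = \sum_i \sum_(j : I) a i ^+ 2.
    by rewrite mulr_sumr; apply: eq_bigr => i _; rewrite sumr_const mulr_natl.
  have E : \sum_i \sum_(j : I) a i ^+ 2 = \sum_(i : I) \sum_j a j ^+ 2 by rewrite exchange_big.
  rewrite mulrBr mulr2n mulrDl mul1r {2}E -mulr2n mulr_sumr.
  rewrite -big_split -sumrB /=; apply: eq_bigr => i _.
  rewrite mulr_sumr -big_split -sumrB /=; apply: eq_bigr => j _; ring.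
by move=> H; rewrite -subr_ge0 -(pmulr_rge0 _ (ltr0n R 2 : 0 < 2)).
Qed.

(** Two applications of Cauchy-Schwarz: the one over [y] removes [T], the one over pairs [(x, x')]
    removes [S]. *)
Lemma cut_le_c4 (V : finType) (B : V -> V -> R) (S T : {set V}) :
  (\sum_(x in S) \sum_(y in T) B x y) ^+ 4 <=
  #|V|%:R ^+ 4 * \sum_x \sum_x' (\sum_y B x y * B x' y) ^+ 2.
Proof.
set n : R := #|V|%:R; have n0 : 0 <= n by [].
pose b x : R := (x \in S)%:R.
pose h y := \sum_x b x * B x y.
have E1 : \sum_(x in S) \sum_(y in T) B x y = \sum_y (y \in T)%:R * h y.
  rewrite exchange_big big_mkcond /=; apply: eq_bigr => y _.
  rewrite /h; case: (y \in T); rewrite ?mul0r // mul1r big_mkcond.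
  by apply: eq_bigr => x _; rewrite /b; case: (x \in S); rewrite ?mul1r ?mul0r.
have H1 : (\sum_y (y \in T)%:R * h y) ^+ 2 <= n * \sum_y h y ^+ 2.
  apply: le_trans (cauchy_sum _) _; rewrite ler_wpM2l //; apply: ler_sum => y _.
  by case: (y \in T); rewrite ?mul1r // mul0r expr0n sqr_ge0.
have E2 : \sum_y h y ^+ 2 = \sum_(q : V * V) b q.1 * b q.2 * (\sum_y B q.1 y * B q.2 y).
  rewrite -(pair_bigA _ (fun x x' => b x * b x' * \sum_y B x y * B x' y)) /=.
  under eq_bigr do rewrite /h expr2 mulr_suml.
  rewrite exchange_big /=; apply: eq_bigr => x _.
  under eq_bigr do rewrite mulr_sumr.
  rewrite exchange_big /=; apply: eq_bigr => x' _.
  by rewrite mulr_sumr; apply: eq_bigr => y _; ring.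
have H2 : (\sum_y h y ^+ 2) ^+ 2 <= n ^+ 2 * \sum_x \sum_x' (\sum_y B x y * B x' y) ^+ 2.
  rewrite E2; apply: le_trans (cauchy_sum _) _.
  rewrite card_prod natrM -expr2 -/n ler_wpM2l ?sqr_ge0 //.
  rewrite (pair_bigA _ (fun x x' => (\sum_y B x y * B x' y) ^+ 2)) /=.
  apply: ler_sum => q _; rewrite /b.
  by case: (q.1 \in S); case: (q.2 \in S); rewrite ?mul1r ?mulr1 ?mul0r ?mulr0 ?mul0r ?expr0n ?sqr_ge0.
rewrite E1 (_ : 4 = 2 * 2)%N // exprM.
apply: (@le_trans _ _ ((n * \sum_y h y ^+ 2) ^+ 2)).
  by rewrite ler_pXn2r ?nnegrE ?sqr_ge0 ?mulr_ge0 // sumr_ge0 // => y _; rewrite sqr_ge0.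
rewrite exprMn exprM (expr2 (n ^+ 2)) -mulrA ler_wpM2l ?sqr_ge0 //.
Qed.

(** The four-cycle as a complete bipartite graph with sides [{0, 1}] and [{2, 3}]. *)
Definition c4 : seq ('I_4 * 'I_4) :=
  [:: (inord 0, inord 2); (inord 0, inord 3); (inord 1, inord 2); (inord 1, inord 3)].

Lemma simple_c4 : simple_edges c4.
Proof. by rewrite /= !inE !xpair_eqE /= -!val_eqE /= !inordK. Qed.

Lemma sum_c4 (V : finType) (B : V -> V -> R) :
  \sum_(f : {ffun 'I_4 -> V}) \prod_(e <- c4) B (f e.1) (f e.2) =
  \sum_x \sum_x' (\sum_y B x y * B x' y) ^+ 2.
Proof.
pose tup (q : (V * V) * (V * V)) : {ffun 'I_4 -> V} :=
  [ffun i : 'I_4 => nth q.1.1 [:: q.1.1; q.1.2; q.2.1; q.2.2] i].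
pose unt (f : {ffun 'I_4 -> V}) := ((f (inord 0), f (inord 1)), (f (inord 2), f (inord 3))).
have tupK : cancel tup unt.
  by move=> [[x x'] [y y']]; rewrite /unt !ffunE !inordK.
have untK : cancel unt tup.
  move=> f; apply/ffunP => i; rewrite ffunE /unt.
  case: i => -[|[|[|[|//]]]] hi /=; congr (f _); apply/val_inj; by rewrite /= inordK.
rewrite (reindex tup) /=; last by exists unt => ? _; [exact: tupK | exact: untK].
rewrite -(pair_bigA _ (fun q r => \prod_(e <- c4) B (tup (q, r) e.1) (tup (q, r) e.2))) /=.
rewrite -(pair_bigA _ (fun x x' => \sum_r \prod_(e <- c4) B (tup ((x, x'), r) e.1) (tup ((x, x'), r) e.2))) /=.
apply: eq_bigr => x _; apply: eq_bigr => x' _.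
rewrite expr2 mulr_suml -(pair_bigA _ (fun y y' => \prod_(e <- c4)
  B (tup ((x, x'), (y, y')) e.1) (tup ((x, x'), (y, y')) e.2))) /=.
apply: eq_bigr => y _; rewrite mulr_sumr; apply: eq_bigr => y' _.
by rewrite !big_cons big_nil /= !ffunE !inordK //=; ring.
Qed.

End HomCounts.

Lemma near_ev (P : nat -> Prop) : (\forall n \near \oo%classic, P n) <-> ev P.
Proof. by split=> [[N _ NP]|[N NP]]; exists N. Qed.

(** * Quasi-randomness, the cut property and the counting properties *)

Section Sequences.
Variables (R : realType) (p : R) (G : nat -> sgraph).
Hypothesis p01 : 0 < p <= 1.
Hypothesis Ginf : forall N, ev (fun n => N <= nverts (G n))%N.

Let nn n : R := (nverts (G n))%:R.

Definition cut_property : Prop := forall eps : R, 0 < eps ->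
  ev (fun n => forall S T : {set G n},
    `|ecount R (@adj (G n)) S T - p * #|S|%:R * #|T|%:R| <= eps * nn n ^+ 2).

Lemma ev_large (C eps : R) : 0 < eps -> ev (fun n => 0 < nn n /\ C <= eps * nn n).
Proof.
move=> e0; apply: ev_mono (Ginf (Num.truncn (C / eps)).+1) => n h.
split; first by rewrite ltr0n (leq_trans _ h).
rewrite mulrC -ler_pdivrMr //; apply: le_trans (ltW (truncnS_gt _)) _.
by rewrite ler_nat.
Qed.

Lemma quasi_random_homsum (I : finType) (L : seq (I * I)) (eps : R) :
  quasi_random p G -> simple_edges L -> 0 < eps ->
  ev (fun n => `|homsum R (@adj (G n)) L (fun _ => [set: G n]%SET) - p ^+ size L * (nn n ^+ #|I|)|
               <= eps * nn n ^+ #|I|).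
Proof.
move=> qr sL e0; have e2 : 0 < eps / 2 by lra.
have /near_ev H := qr (list_graph sL) _ e2.
apply: ev_mono (ev_and H (ev_large (#|I|%:R ^+ 2) e2)) => n [{}H [n0 nC]].
have V0 : (0 < nverts (G n))%N by rewrite -(ltr0n R).
have := @hom_count_close R (list_graph sL) _ _ V0 (@all_list_graph _ _ sL).
move: H; rewrite nedges_list_graph {1 2 4}/nverts /= -/(nn n) -[#|list_graph sL|]/#|I|.
set a := (hom_count _ _)%:R; set b := homsum _ _ _ _; set K := nn n ^+ #|I|; set P := p ^+ _.
move=> H1 H2.
have K0 : 0 <= K by rewrite exprn_ge0 // ltW.
have H3 : #|I|%:R ^+ 2 * K / nn n <= eps / 2 * K.
  by rewrite ler_pdivrMr // [leRHS]mulrAC ler_wpM2r.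
have -> : b - P * K = (a - P * K) - (a - b) by ring.
apply: le_trans (ler_normB _ _) _; lra.
Qed.

(** The signed factors are expanded one at a time, and the main terms of the two counts cancel. The
    power of zero unites the plain count, for empty [L1], with a vanishing main term otherwise. *)
Lemma quasi_random_signed (I : finType) (L1 L2 : seq (I * I)) (eps : R) :
  quasi_random p G -> simple_edges (L1 ++ L2) -> 0 < eps ->
  ev (fun n => `|\sum_(f : {ffun I -> G n}) \prod_(e <- L1) ((adj (f e.1) (f e.2))%:R - p) *
                   \prod_(e <- L2) (adj (f e.1) (f e.2))%:R
                 - 0 ^+ size L1 * p ^+ size L2 * (nn n ^+ #|I|)| <= eps * nn n ^+ #|I|).
Proof.
move=> qr; elim: L1 L2 eps => [|e L1 IH] L2 eps sL e0.
  apply: ev_mono (quasi_random_homsum qr sL e0) => n.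
  rewrite /homsum (eq_bigl predT); last by move=> f; apply/forallP => i; rewrite inE.
  rewrite expr0 mul1r; congr (`|_ - _| <= _); apply: eq_bigr => f _.
  by rewrite big_nil mul1r.
have e2 : 0 < eps / 2 by lra.
have sL' : simple_edges (L1 ++ e :: L2).
  by rewrite (@simple_edges_perm _ _ ((e :: L1) ++ L2)) // (perm_catCA L1 [:: e] L2).
have sL'' : simple_edges (L1 ++ L2) by move: sL => /= /and4P[].
apply: ev_mono (ev_and (IH _ _ sL' e2) (IH _ _ sL'' e2)) => n [H1 H2].
rewrite expr0n /= !mul0r subr0.
move: H1 H2; set a := \sum_f _; set b := \sum_f _; set c := \sum_f _.
have -> : c = a - p * b.
  rewrite mulr_sumr -sumrB; apply: eq_bigr => f _; rewrite !big_cons; ring.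
rewrite /= exprS; set K := nn n ^+ _; set z := 0 ^+ _; set P := p ^+ _ => H1 H2.
have -> : a - p * b = (a - z * (p * P) * K) - p * (b - z * P * K) by ring.
apply: le_trans (ler_normB _ _) _; rewrite normrM.
have : `|p| * `|b - z * P * K| <= `|b - z * P * K|.
  by rewrite ler_piMl // ger0_norm; case/andP: p01 => // /ltW.
lra.
Qed.

(** With all edges of [c4] signed the count is [o(n^4)]; the tolerance [eps^4] prepares the fourth
    root. *)
Lemma quasi_random_cut : quasi_random p G -> cut_property.
Proof.
move=> qr eps e0; have e4 : 0 < eps ^+ 4 by rewrite exprn_gt0.
have sL : simple_edges (c4 ++ [::]) by rewrite cats0; exact: simple_c4.
apply: ev_mono (quasi_random_signed qr sL e4) => n H S T.
rewrite -ecountB -(@ler_pXn2r _ 4) ?nnegrE ?mulr_ge0 ?sqr_ge0 ?(ltW e0) //.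
rewrite -normrX ger0_norm; last by rewrite (exprM _ 2 2) sqr_ge0.
apply: le_trans (cut_le_c4 _ _ _) _; rewrite -sum_c4.
move: H; rewrite expr0n /= !mul0r subr0 card_ord.
set s := \sum_f _; set t := \sum_f _.
have -> : s = t by apply: eq_bigr => f _; rewrite big_nil mulr1.
move=> H; rewrite exprMn -exprM (exprD _ 4 4) mulrA mulrC -/(nn n).
by rewrite ler_wpM2r ?exprn_ge0 //; apply: le_trans (ler_norm _) H.
Qed.

Lemma cut_quasi_random : cut_property -> quasi_random p G.
Proof.
move=> cut F eps e0; apply/near_ev.
have e2 : 0 < eps / 2 by lra.
set d : R := eps / 2 / (size (elist F)).+1%:R.
have d0 : 0 < d by rewrite divr_gt0.
apply: ev_mono (ev_and (cut _ d0) (ev_large (#|F|%:R ^+ 2) e2)) => n [H [n0 nC]].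
have V0 : (0 < nverts (G n))%N by rewrite -(ltr0n R).
have H1 := hom_count_close R V0 (fun P Ps => esym (@all_elist F P Ps)).
have H2 := @counting_lemma R F (G n) (@adj (G n)) d (fun _ => p) (elist F)
  (fun _ => [set: G n]%SET) (simple_elist F).
have {}H2 : `|homsum R (@adj (G n)) (elist F) (fun _ => [set: G n]%SET)
    - p ^+ nedges F * nn n ^+ nverts F| <= (size (elist F))%:R * d * nn n ^+ nverts F.
  move: H2; rewrite prodr_const cardsT -/(nverts _) big_const_seq count_predT iter_mulr_1 size_elist; apply.
    by move=> e _; case/andP: p01 => /ltW -> ->.
  by move=> e _ S T _ _; rewrite cardsT -expr2; exact: H.
move: H1 H2; rewrite -/(nn n) -/(nverts F).
set a := (hom_count _ _)%:R; set b := homsum _ _ _ _; set K := nn n ^+ _; set P := p ^+ _ => H1 H2.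
have K0 : 0 <= K by rewrite exprn_ge0 // ltW.
have H3 : (nverts F)%:R ^+ 2 * K / nn n <= eps / 2 * K.
  by rewrite ler_pdivrMr // [leRHS]mulrAC ler_wpM2r.
have H4 : (size (elist F))%:R * d * K <= eps / 2 * K.
  rewrite ler_wpM2r // /d mulrCA ler_piMr // ?(ltW e2) //.
  by rewrite ler_pdivrMr ?mul1r ?ler_nat.
have -> : a - P * K = (a - b) + (b - P * K) by ring.
apply: le_trans (ler_normD _ _) _; lra.
Qed.

Variable F : sgraph.
Hypothesis F1 : (1 < nedges F)%N.

Let nvertsF : (1 < #|F|)%N.
Proof.
have : (0 < size (elist F))%N by rewrite size_elist ltnW.
case E : (elist F) => [//|e L] _.
have : adj e.1 e.2 by have := mem_head e L; rewrite -E mem_elist => /andP[].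
by move/adj_neq => ne; apply/card_gt1P; exists e.1, e.2.
Qed.

Lemma cut_count : cut_property -> count_property p F G.
Proof.
move=> cut eps e0; apply/near_ev.
set m := #|F|; set s := size (elist F).
set d : R := eps / s.+1%:R.
have d0 : 0 < d by rewrite divr_gt0.
(* Once [n >= m], each [U i] has at least [n / (2m)] points, so a cut error of [d' n^2] is at most
   [d] times the size of any pair. *)
set d' : R := d / (4 * m%:R ^+ 2).
have m0 : 0 < m%:R :> R by rewrite ltr0n ltnW.
have d'0 : 0 < d' by rewrite divr_gt0 // mulr_gt0 // exprn_gt0.
apply: ev_mono (ev_and (cut _ d'0) (Ginf m)) => n [H nm] U [dis cU].
rewrite hom_count_in_disjoint //.
set q := (nverts (G n) %/ nverts F)%N in cU.
have nq : nn n <= 2 * m%:R * q%:R.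
  rewrite -!natrM ler_nat; have mN : (0 < m)%N by exact: ltnW.
  have := divn_eq (nverts (G n)) m; have := ltn_pmod (nverts (G n)) mN.
  have : (0 < nverts (G n) %/ m)%N by rewrite divn_gt0.
  rewrite -/(nverts F) -/q; nia.
have := @counting_lemma R F (G n) (@adj (G n)) d (fun _ => p) (elist F) U (simple_elist F).
rewrite big_const_seq count_predT iter_mulr_1 size_elist => CL.
apply: le_trans (CL _ _) _.
- by move=> e _; case/andP: p01 => /ltW -> ->.
- move=> e _ S T _ _; apply: le_trans (H S T) _; rewrite !cU -expr2 /d' mulrAC ler_pdivrMr; last first.
    by rewrite mulr_gt0 // exprn_gt0.
  rewrite -[leRHS]mulrA ler_pM2l // [leRHS](_ : _ = (2 * m%:R * q%:R) ^+ 2); last by ring.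
  by rewrite ler_pXn2r // nnegrE ?mulr_ge0.
rewrite -size_elist -/s; apply: ler_pM; [by apply: mulr_ge0 => //; exact: ltW | exact: prodr_ge0 | |].
  by rewrite /d mulrCA ler_piMr ?(ltW e0) // ler_pdivrMr ?mul1r ?ler_nat.
rewrite -[leRHS]prodr_const; apply: ler_prod => i _.
by rewrite ler0n ler_nat max_card.
Qed.

Lemma balanced_perm n (U : F -> {set G n}) (s : {perm F}) :
  balanced_family U -> balanced_family (fun i => U (s i)).
Proof.
by move=> [dis cU]; split=> [i j ij|i]; [apply: dis; rewrite (inj_eq perm_inj) | exact: cU].
Qed.

Lemma count_sym_count : count_property p F G -> sym_count_property p F G.
Proof.
move=> cp eps e0; have := cp eps e0 => /near_ev H; apply/near_ev.
apply: ev_mono H => n H U bU.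
set c := p ^+ _ * _; set K := eps * _.
have f0 : 0 < (nverts F)`!%:R :> R by rewrite ltr0n fact_gt0.
have Hs (s : {perm F}) : `|(hom_count_in (fun i => U (s i)))%:R - c| <= K.
  have := H _ (balanced_perm s bU); rewrite /c.
  by rewrite [in X in _ -> X](reindex_inj (@perm_inj _ s)).
have -> : sym_hom_count_in R U - c =
    (nverts F)`!%:R^-1 * \sum_(s : {perm F}) ((hom_count_in (fun i => U (s i)))%:R - c).
  rewrite /sym_hom_count_in sumrB mulrBr sumr_const card_perm_fact.
  by rewrite -[X in _ = _ - _ * X](mulr_natl c) mulKf // gt_eqF.
rewrite normrM ger0_norm ?invr_ge0 ?ler0n // mulrC ler_pdivrMr //.
apply: le_trans (ler_norm_sum _ _ _) _.
apply: le_trans (ler_sum _ (fun s _ => Hs s)) _.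
by rewrite sumr_const card_perm_fact -[leLHS](mulr_natr K).
Qed.

(** Colourings with classes of size [n %/ m] are balanced families, so [frac_bound] gives the bound
    on all fractional partitions that [cut_ev] asks for; its extra term of order [n^(m-1)] is
    absorbed for large [n]. *)
Lemma sym_count_cut : sym_count_property p F G -> cut_property.
Proof.
move=> sp; have [x0 _] : exists x0 : F, true.
  by have /card_gt0P[x _] := ltnW nvertsF; exists x.
have P01 : 0 <= p ^+ size (elist F) <= 1.
  by have /andP[/ltW p0 p1] := p01; rewrite exprn_ge0 ?exprn_ile1.
have E1 : (1 < size (elist F))%N by rewrite size_elist.
move=> eps; apply: (cut_ev (simple_elist F) E1 nvertsF p01 _ Ginf _ x0).
  by move=> n; exact: adj_sym.
move=> {}eps e0; have e2 : 0 < eps / 2 by lra.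
set C : R := 4 * #|F|%:R + 2 * #|F|%:R ^+ 3.
have /near_ev H := sp _ e2.
apply: ev_mono (ev_and H (ev_large C e2)) => n [{}H [n0 nC]] chi cF.
apply: le_trans (@frac_bound _ _ _ _ (symker_le1 _ _ P01) nvertsF (eps / 2 * nn n ^+ #|F|) _ _ cF) _.
  move=> c cc; pose U (i : F) : {set G n} := [set x | c x == Some i]%SET.
  have bU : balanced_family U.
    split=> // i j ij; apply/pred0P => x /=; rewrite !inE.
    by case: eqP => // ->; apply/negP => /eqP[h]; rewrite h eqxx in ij.
  have -> : mform (symker (elist F) (@adj (G n)) (p ^+ size (elist F)))
      (fun (i : F) (x : G n) => (c x == Some i)%:R) =
      sym_hom_count_in R U - p ^+ nedges F * \prod_i #|U i|%:R.
    transitivity (mform (symker (elist F) (@adj (G n)) (p ^+ size (elist F))) (indic R U)).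
      by apply: eq_bigr => f _; congr (_ * _); apply: eq_bigr => i _; rewrite /indic inE.
    rewrite mform_symker_indic size_elist; congr (_ * _ - _); apply: eq_bigr => s _.
    by have [dis _] := balanced_perm s bU; rewrite hom_count_in_disjoint.
  exact: H.
rewrite -/C -[#|G n|%:R]/(nn n).
have -> : nn n ^+ #|F| = nn n * nn n ^+ #|F|.-1 by rewrite -exprS prednK // ltnW.
have K0 : 0 <= nn n ^+ #|F|.-1 by rewrite exprn_ge0 // ltW.
have : C * nn n ^+ #|F|.-1 <= eps / 2 * nn n * nn n ^+ #|F|.-1 by rewrite ler_wpM2r.
by set K := nn n ^+ _; lra.
Qed.

End Sequences.

Theorem theorem2p12 (R : realType) (F : sgraph) (p : R)
    (hF : (1 < nedges F)%N) (hp : 0 < p <= 1)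
    (hclass : regular_graph F \/ star_graph F \/ ~ connected_graph F) :
  quasi_random_property p (count_property p F) /\
  quasi_random_property p (sym_count_property p F).
Proof.
have Ginf (G : nat -> sgraph) : order_to_infty G -> forall N, ev (fun n => N <= nverts (G n))%N.
  by move=> GI N; apply/near_ev; apply: (GI [set k | (N <= k)%N]%classic); exact: nbhs_infty_ge.
split=> G /Ginf GI; split=> [H|/(quasi_random_cut hp GI) cut].
- by apply: (cut_quasi_random hp GI); apply: (sym_count_cut hp GI hF); exact: count_sym_count.
- exact: cut_count.
- by apply: (cut_quasi_random hp GI); exact: (sym_count_cut hp GI hF H).
- by apply: count_sym_count; exact: cut_count.
Qed.
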